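(* Let $\Sigma$ be an entire spacelike surface in $\mathbb R^{2,1}$ with Gaussian curvature bounded from above and below by positive constants. Let $u_\Sigma:\overline{\mathbb D}\to\mathbb R\cup\{+\infty\}$ be the support function of $\Sigma$, and let $\Omega_\Sigma$ be the interior of the set on which $u_\Sigma$ is finite. Then: (i) The essential domain of $u_\Sigma$, i.e. the set on which $u_\Sigma$ is finite, coincides with the convex hull of $\{\xi\in\partial\mathbb D : u_\Sigma(\xi)<+\infty\}$. (ii) For every segment of $\partial\Omega_\Sigma$ with endpoints $\xi_1,\xi_2\in\partial\mathbb D$, the restriction of $u_\Sigma$ to the chord $[\xi_1,\xi_2]$ is the convex envelope of $u_\Sigma|_{\{\xi_1,\xi_2\}}$; that is, if $u_\Sigma(\xi_1)$ or $u_\Sigma(\xi_2)$ is $+\infty$ then $u_\Sigma\equiv+\infty$ on the open chord, and otherwise $u_\Sigma$ on $[\xi_1,\xi_2]$ is the affine function interpolating its values at the endpoints.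
   Context: $\mathbb R^{2,1}$ is $\mathbb R^3$ with the bilinear form $\langle \mathbf x,\mathbf y\rangle=x_1y_1+x_2y_2-x_3y_3$. A $C^1$ surface is spacelike if the induced metric is positive definite; it is entire if the vertical projection $(x_1,x_2,x_3)\mapsto(x_1,x_2)$ restricts to a homeomorphism onto $\mathbb R^2$. For a smooth spacelike surface $\Sigma$, let $\mathbf n$ be the normal field with $\langle\mathbf n,\mathbf n\rangle=-1$ and positive $x_3$-component, and $B(\mathbf v)=D_{\mathbf v}\mathbf n$ the shape operator ($D$ the flat connection). The Gaussian curvature is $\det B$. As a standing convention, surfaces of positive Gaussian curvature are taken, up to time reversal, to be future-convex (the region above $\Sigma$ is convex). $\mathbb D$ is the open unit disk in $\mathbb R^2$. The support function of a nonempty set $S\subset\mathbb R^{2,1}$ is $u_S:\overline{\mathbb D}\to\mathbb R\cup\{+\infty\}$, $u_S(\mathsf y)=\sup_{\mathbf x\in S}\langle\mathbf x,(\mathsf y,1)\rangle$. *)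

(* Defs.v *)
From HB Require Import structures.
From mathcomp Require Import all_boot all_order all_algebra.
From mathcomp Require Import all_classical all_reals all_analysis.
Set Implicit Arguments.
Unset Strict Implicit.
Unset Printing Implicit Defensive.
Import Order.TTheory GRing.Theory Num.Theory.
Import numFieldNormedType.Exports.
Local Open Scope classical_set_scope.
Local Open Scope ring_scope.

Section General.
Context {R : realType}.

Definition homeo_on (S T : topologicalType) (A : set S) (B : set T)
    (f : S -> T) : Prop :=
  set_bij A B f /\
  exists g : T -> S, [/\ {in A, cancel f g},
    {within A, continuous f} & {within B, continuous g}].

(* For [U] open: [f] is of class C^k on [U]. *)
Fixpoint class_C (V W : normedModType R) (k : nat) (U : set V)
    (f : V -> W) : Prop :=
  if k is k'.+1 then
    (forall x, U x -> differentiable f x) /\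
    (forall v, class_C k' U (fun x => 'D_v f x))
  else forall x, U x -> {for x, continuous f}.

Definition smooth_on (V W : normedModType R) (U : set V) (f : V -> W) : Prop :=
  forall k, class_C k U f.

Definition convex_hull (M : lmodType R) (A : set M) : set M :=
  smallest (@convex_set R M) A.

Definition segment (M : lmodType R) (x y : M) : set M :=
  [set (1 - t) *: x + t *: y | t in [set t : R | 0 <= t <= 1]].

Definition boundary (T : topologicalType) (A : set T) : set T :=
  closure A `\` interior A.

End General.

Section Minkowski.
Context {R : realType}.
Local Notation R2 := 'rV[R]_2.
Local Notation R21 := 'rV[R]_3.

Definition mink (x y : R21) : R :=
  x 0 0 * y 0 0 + x 0 1 * y 0 1 - x 0 2 * y 0 2.

Definition vproj (x : R21) : R2 := \row_i [:: x 0 0; x 0 1]`_i.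

(* (y, 1) *)
Definition lift1 (y : R2) : R21 := \row_i [:: y 0 0; y 0 1; 1]`_i.

(* The norm of ['rV[R]_n] in the library is the sup norm, so the Euclidean disk
   is not one of its balls. *)
Definition sqnorm2 (y : R2) : R := y 0 0 ^+ 2 + y 0 1 ^+ 2.
Definition cdisk : set R2 := [set y | sqnorm2 y <= 1].
Definition circle : set R2 := [set y | sqnorm2 y = 1].

Definition regular_chart (S : set R21) (U : set R2) (W : set R21)
    (X : R2 -> R21) : Prop :=
  [/\ open U, open W, homeo_on U (S `&` W) X, smooth_on U X &
      forall u, U u -> injective ('d X u)].

Definition smooth_surface (S : set R21) : Prop :=
  forall p, S p -> exists U W X, W p /\ regular_chart S U W X.

Definition curve_on (S : set R21) (p v : R21) (c : R -> R21) : Prop :=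
  [/\ c 0 = p, (\forall t \near (0 : R), S (c t)) & is_derive (0 : R) 1 c v].

Definition tangent (S : set R21) (p : R21) : set R21 :=
  [set v | exists c, curve_on S p v c].

Definition spacelike (S : set R21) : Prop :=
  forall p v, S p -> tangent S p v -> v != 0 -> 0 < mink v v.

Definition entire (S : set R21) : Prop := homeo_on S [set: R2] vproj.

(* Derivative at [p], along the tangent vector [v], of a field [f] that is only
   meaningful on [S]; it is computed along any curve of [S] with velocity [v]. *)
Definition surf_derive (S : set R21) (f : R21 -> R21) (p v : R21) : R21 :=
  get [set w | exists2 c, curve_on S p v c & is_derive (0 : R) 1 (f \o c) w].

Definition unit_normal (S : set R21) (p : R21) : R21 :=
  get [set n | [/\ mink n n = -1, 0 < n 0 2 &
                   forall v, tangent S p v -> mink n v = 0]].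

Definition shape_op (S : set R21) (p v : R21) : R21 :=
  surf_derive S (unit_normal S) p v.

Definition tangent_basis (S : set R21) (p : R21) : 'M[R]_(2, 3) :=
  get [set E : 'M[R]_(2, 3) |
        row_free E /\ forall v, tangent S p v <-> (v <= E)%MS].

(* [pinvmx E] gives coordinates in the basis formed by the rows of [E]; row [i]
   of the matrix below holds the coordinates of the image of [row i E]. *)
Definition shape_mx (S : set R21) (p : R21) : 'M[R]_2 :=
  let E := tangent_basis S p in
  (\matrix_(i < 2) shape_op S p (row i E)) *m pinvmx E.

Definition gauss_curv (S : set R21) (p : R21) : R := \det (shape_mx S p).

Definition future_convex (S : set R21) : Prop :=
  @convex_set R R21
    [set x | exists p, [/\ S p, vproj p = vproj x & p 0 2 <= x 0 2]].

(* Only meaningful for [y] in [cdisk]. *)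
Definition support_fun (S : set R21) (y : R2) : \bar R :=
  ereal_sup [set (mink x (lift1 y))%:E | x in S].

Definition ess_dom (S : set R21) : set R2 :=
  [set y | cdisk y /\ support_fun S y \is a fin_num].

Definition Omega (S : set R21) : set R2 := interior (ess_dom S).

(* Supremum of the affine functions lying below [phi] on [A]. *)
Definition convex_envelope (A : set R2) (phi : R2 -> \bar R) (y : R2) : \bar R :=
  let aff (l : R2) (c : R) (z : R2) := l 0 0 * z 0 0 + l 0 1 * z 0 1 + c in
  ereal_sup [set e | exists l c,
    (forall z, A z -> ((aff l c z)%:E <= phi z)%E) /\ e = (aff l c y)%:E].

End Minkowski.

(* Main.v *)
Require Import Defs.
From HB Require Import structures.
From mathcomp Require Import all_boot all_order all_algebra.
From mathcomp Require Import all_classical all_reals all_analysis.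
From mathcomp Require Import ring lra.
Set Implicit Arguments.
Unset Strict Implicit.
Unset Printing Implicit Defensive.
Import Order.TTheory GRing.Theory Num.Theory.
Import numFieldNormedType.Exports.
Local Open Scope classical_set_scope.
Local Open Scope ring_scope.

(* S is the graph of a convex f with |grad f| < 1, and u = u_S is its Legendre
   transform.  The lower curvature bound says
   det D^2 f >= a (1 - |grad f|^2)^2, that is, det D^2 u <= 1/(a (1 - |y|^2)^2)
   where u is smooth.  Hence u - w has no interior minimum in the disk if w is
   smooth and convex with det D^2 w larger than this: by convexity of u a minimum
   point y is of the form grad f(x) with x = grad w(y), and the second order
   expansions of f at x and of w at y are then incompatible.  Boundary points of
   the domain of u cause no trouble, because the minimum is pulled back to S.

   Comparing u on caps of the disk with w = affine - k sqrt(1 - |y|^2) shows that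
   u = +oo on every cap in whose circular arc u = +oo.  If the domain of u lies on
   one side h >= 0 of a chord, comparing u on the thin lens 0 <= 2h <= q with
   w = affine - C h - d q + h^2/(a d q), where q^2 is the product of the equations
   of the tangents to the circle at the ends of the chord, and letting d -> 0,
   shows that u is at least the affine interpolation of its values at the ends. *)

(** The function [u] need be neither differentiable nor finite near a contact point, and [f] is used
    only through a differentiable gradient, so contact is tested by pointwise second order
    expansions. The barriers are tuned to the weight in the curvature bound. The Hessian determinant
    of -k sqrt(1 - |y|^2) is k^2/(1 - |y|^2)^2, so one k with a k^2 > 1 serves the whole disk. In
    the lens, 1 - |y|^2 = q^2 - h^2, and 2h <= q makes this at least 3q^2/4. The Hessian of -d q
    alone has rank one; the term h^2/(a d q) supplies the missing direction and raises the
    determinant to at least 2/(a q^4), while the bound to beat is at most (16/9)/(a q^4). Its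
    coefficient blows up as d -> 0, which is harmless because h = 0 on the chord. For the same
    reason C may depend on d; it pushes the barrier down on the curved side 2h = q away from the
    corners. At the corners, where q = 0, lower semicontinuity of [u] takes over. Infinite values of
    [u] are handled through real numbers strictly below them. *)

Section Plane.
Context {R : realType}.
Implicit Types (x y z v w : 'rV[R]_2).

Definition dot x y : R := x 0 0 * y 0 0 + x 0 1 * y 0 1.

Definition pt (s t : R) : 'rV[R]_2 := \row_i [:: s; t]`_i.

Lemma pt0 s t : pt s t 0 0 = s. Proof. by rewrite mxE. Qed.
Lemma pt1 s t : pt s t 0 1 = t. Proof. by rewrite mxE. Qed.

Lemma ord2P (i : 'I_2) : i = 0 \/ i = 1.
Proof. by case: i => [[|[|//]] Hi]; [left|right]; apply/val_inj. Qed.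

Lemma rv2P x y : x 0 0 = y 0 0 -> x 0 1 = y 0 1 -> x = y.
Proof.
by move=> h0 h1; apply/rowP => i; have [->|->] := ord2P i.
Qed.

Lemma ptE x : x = pt (x 0 0) (x 0 1).
Proof. by apply: rv2P; rewrite (pt0, pt1). Qed.

Lemma coord_norm n (x : 'rV[R]_n) i : `|x 0 i| <= `|x|.
Proof.
rewrite [leRHS]/Num.Def.normr/= mx_normrE.
by apply: le_trans (le_bigmax _ _ (0, i)).
Qed.

Lemma norm_rv2_le x c : `|x 0 0| <= c -> `|x 0 1| <= c -> `|x| <= c.
Proof.
move=> h0 h1; have c0 : 0 <= c by exact: le_trans h0.
rewrite [leLHS]/Num.Def.normr/= mx_normrE; apply: bigmax_le => // -[i j] _ /=.
by rewrite (ord1 i); have [->|->] := ord2P j.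
Qed.

Lemma dotC x y : dot x y = dot y x. Proof. by rewrite /dot; ring. Qed.
Lemma dotDl x y z : dot (x + y) z = dot x z + dot y z.
Proof. by rewrite /dot !mxE; ring. Qed.
Lemma dotBl x y z : dot (x - y) z = dot x z - dot y z.
Proof. by rewrite /dot !mxE; ring. Qed.
Lemma dotZl t x y : dot (t *: x) y = t * dot x y.
Proof. by rewrite /dot !mxE; ring. Qed.
Lemma dotDr x y z : dot x (y + z) = dot x y + dot x z.
Proof. by rewrite /dot !mxE; ring. Qed.
Lemma dotBr x y z : dot x (y - z) = dot x y - dot x z.
Proof. by rewrite /dot !mxE; ring. Qed.
Lemma dotZr t x y : dot x (t *: y) = t * dot x y.
Proof. by rewrite /dot !mxE; ring. Qed.

(** The norm of row vectors is the sup norm, whence the factor 2 in place of the Cauchy-Schwarz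
    constant. *)
Lemma dot_le x y : `|dot x y| <= 2 * `|x| * `|y|.
Proof.
rewrite /dot; apply: (le_trans (ler_normD _ _)); rewrite !normrM.
have := ler_pM (normr_ge0 _) (normr_ge0 _) (coord_norm x 0) (coord_norm y 0).
have := ler_pM (normr_ge0 _) (normr_ge0 _) (coord_norm x 1) (coord_norm y 1).
lra.
Qed.

End Plane.

(** * Differentials and their remainders *)

Section Differentiable.
Context {R : realType} {V W : normedModType R}.

Lemma differentiable_eps (f : V -> W) x : differentiable f x ->
  forall e, 0 < e -> exists2 d, 0 < d & forall k, `|k| < d ->
    `|f (x + k) - f x - 'd f x k| <= e * `|k|.
Proof.
move=> /diff_locally /eqaddoP df e e0.
have /nbhs_ballP[d d0 Hd] := df e e0; exists d => // k kd.
have /Hd : ball (0 : V) d k by rewrite -ball_normE /= sub0r normrN.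
by rewrite !fctE /= [k + x]addrC opprD addrA.
Qed.

Lemma eps_is_diff (f : V -> W) (df : {linear V -> W}) x : continuous df ->
  (forall e, 0 < e -> exists2 d, 0 < d & forall k, `|k| < d ->
    `|f (x + k) - f x - df k| <= e * `|k|) -> is_diff x f df.
Proof.
move=> dfc H.
have E : f \o shift x = cst (f x) + df +o_ (0 : V) id.
  apply/eqaddoP => e e0; have [d d0 Hd] := H e e0.
  apply/nbhs_ballP; exists d => // k; rewrite -ball_normE /= sub0r normrN => kd.
  by have := Hd k kd; rewrite !fctE /= [k + x]addrC opprD addrA.
have U := diff_unique dfc E.
split=> //; apply/diff_locallyP; rewrite U; split => //.
Qed.

End Differentiable.

Section Line.
Context {R : realType} {V W : normedModType R}.

Lemma is_derive_line (f : V -> W) x k s df : is_derive (x + s *: k) k f df ->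
  is_derive s 1 (fun t : R => f (x + t *: k)) df.
Proof.
case=> fd <-.
have E : (fun h : R => h^-1 *: (f (x + (h *: 1 + s) *: k) - f (x + s *: k))) =
         (fun h : R => h^-1 *: (f (h *: k + (x + s *: k)) - f (x + s *: k))).
  apply/funext => h; congr (_ *: (f _ - _)).
  by rewrite -[h *: 1]/(h * 1) mulr1 scalerDl addrCA.
split; last by rewrite /derive /= E.
by rewrite /derivable /= E.
Qed.

End Line.

(** * Second order expansions *)

Section Graph.
Context {R : realType}.
Local Notation R2 := 'rV[R]_2.
Context (f : R2 -> R) (G : R2 -> R2).
Context (fG : forall x v, is_derive x v f (dot (G x) v)).
Context (dG : forall x, differentiable G x).

Lemma diffZE x (t : R) k : 'd G x (t *: k) = t *: 'd G x k :> R2.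
Proof. by rewrite linearZ. Qed.

(** The mean value theorem along the segment reduces the remainder to the first order expansion of
    [G] at [x], so that [G] has to be differentiable but not continuously so. *)
Lemma taylor2 (x : R2) (e : R) : 0 < e -> exists2 d, 0 < d & forall k, `|k| < d ->
  `|f (x + k) - f x - dot (G x) k - dot ('d G x k) k / 2| <= e * `|k| ^+ 2.
Proof.
move=> e0; have e2 : 0 < e / 2 by rewrite divr_gt0.
have [d d0 Hd] := differentiable_eps (dG x) e2; exists d => // k kd.
pose r (s : R) := f (x + s *: k) - s * dot (G x) k - s ^+ 2 * (dot ('d G x k) k / 2).
pose r' (s : R) := dot (G (x + s *: k)) k - dot (G x) k - s * dot ('d G x k) k.
have dr (s : R) : is_derive s (1 : R) r (r' s).
  have h1 := is_derive_line (fG (x + s *: k) k).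
  rewrite /r /r'; apply: is_derive_eq.
  by rewrite /GRing.scale /=; field.
have rc : {within `[0, 1], continuous r}.
  by apply: derivable_within_continuous => s _; case: (dr s).
have [c] := MVT ltr01 (fun s _ => dr s) rc.
rewrite in_itv /= => /andP[c0 c1].
rewrite subr0 mulr1 {1 2}/r scale1r scale0r addr0 mul0r expr0n /= mul0r expr1n.
rewrite !mul1r !subr0.
move=> E; have -> : f (x + k) - f x - dot (G x) k - dot ('d G x k) k / 2 = r' c.
  by rewrite -E; ring.
have -> : r' c = dot (G (x + c *: k) - G x - 'd G x (c *: k)) k.
  by rewrite linearZ /= !dotBl dotZl.
apply: (le_trans (dot_le _ _)).
have ck : `|c *: k| <= `|k|.
  by rewrite normrZ gtr0_norm // ler_piMl // ltW.
have := Hd (c *: k) (le_lt_trans ck kd) => H.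
apply: (@le_trans _ _ (2 * (e / 2 * `|k|) * `|k|)).
  rewrite ler_wpM2r // ler_wpM2l //; apply: (le_trans H).
  by rewrite ler_wpM2l // ltW.
lra.
Qed.

Lemma grad_line x k s : is_derive (s : R) (1 : R) (fun t : R => f (x + t *: k))
  (dot (G (x + s *: k)) k).
Proof. by apply: is_derive_line; exact: fG. Qed.

(* The second difference of f along v and w, divided by the square of the step,
   tends to both sides. *)
Lemma hess_sym (x p q : R2) : dot ('d G x p) q = dot ('d G x q) p.
Proof.
have key (v w : R2) (e : R) : 0 < e -> exists2 d, 0 < d & forall t, 0 < t -> t < d ->
    `|f (x + t *: v + t *: w) - f (x + t *: v) - (f (x + t *: w) - f x)
      - t ^+ 2 * dot ('d G x w) v| <= e * t ^+ 2.
  move=> e0; set M := (1 + `|v| + `|w|).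
  have M0 : 0 < M by rewrite /M -addrA ltr_pwDl // addr_ge0.
  have e2 : 0 < e / (4 * M ^+ 2) by rewrite divr_gt0 // mulr_gt0 // exprn_gt0.
  have [d d0 Hd] := differentiable_eps (dG x) e2.
  exists (d / M); first by rewrite divr_gt0.
  move=> t t0; rewrite ltr_pdivlMr // => tM.
  pose r (s : R) := f (x + t *: w + s *: v) - f (x + s *: v).
  pose r' (s : R) := dot (G (x + t *: w + s *: v)) v - dot (G (x + s *: v)) v.
  have dr (s : R) : is_derive s (1 : R) r (r' s).
    have h1 := grad_line (x + t *: w) v s; have h2 := grad_line x v s.
    exact: is_deriveB.
  have rc : {within `[0, t], continuous r}.
    by apply: derivable_within_continuous => s _; case: (dr s).
  have [c] := MVT t0 (fun s _ => dr s) rc.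
  rewrite in_itv /= => /andP[c0 ct].
  rewrite /r scale0r !addr0 subr0 => E.
  have -> : x + t *: v + t *: w = x + t *: w + t *: v by rewrite addrAC.
  have {E}-> : f (x + t *: w + t *: v) - f (x + t *: v) - (f (x + t *: w) - f x)
      - t ^+ 2 * dot ('d G x w) v = t * (r' c - t * dot ('d G x w) v).
    by rewrite E; ring.
  rewrite normrM gtr0_norm //.
  have -> : r' c - t * dot ('d G x w) v =
      dot ((G (x + (t *: w + c *: v)) - G x - 'd G x (t *: w + c *: v))
       - (G (x + c *: v) - G x - 'd G x (c *: v))) v.
    have -> : 'd G x (t *: w + c *: v) = t *: 'd G x w + c *: 'd G x v.
      by rewrite linearD !linearZ.
    rewrite [in RHS]linearZ.
    by rewrite /r' addrA !dotBl dotDl !dotZl; ring.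
  have tv : `|c *: v| <= t * `|v|.
    by rewrite normrZ gtr0_norm // ler_wpM2r // ltW.
  have tw : `|t *: w + c *: v| <= t * M.
    apply: (le_trans (ler_normD _ _)); rewrite [X in X + _]normrZ gtr0_norm //.
    by rewrite /M; lra.
  have tv' : `|c *: v| <= t * M.
    apply: (le_trans tv); apply: (ler_wpM2l (ltW t0)); rewrite /M.
    by have := normr_ge0 w; lra.
  have H1 := Hd _ (le_lt_trans tw tM).
  have H2 := Hd _ (le_lt_trans tv' tM).
  apply: (@le_trans _ _ (t * (2 * (2 * (e / (4 * M ^+ 2) * (t * M))) * M))); last first.
    by rewrite le_eqVlt; apply/orP; left; apply/eqP; field; rewrite gt_eqF.
  apply: (ler_wpM2l (ltW t0)); apply: (le_trans (dot_le _ _)).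
  have vM : `|v| <= M by rewrite /M; have := normr_ge0 w; lra.
  apply: ler_pM => //.
  rewrite ler_wpM2l //; apply: (le_trans (ler_normB _ _)).
  have K : 0 <= e / (4 * M ^+ 2) by exact: ltW.
  have := ler_wpM2l K tw; have := ler_wpM2l K tv'; lra.
apply/eqP; rewrite -subr_eq0 -normr_le0; apply/ler_addgt0Pl => e e0.
rewrite addr0; have e2 : 0 < e / 2 by rewrite divr_gt0.
have [d1 d10 H1] := key p q _ e2; have [d2 d20 H2] := key q p _ e2.
pose t := Num.min d1 d2 / 2.
have t0 : 0 < t by rewrite divr_gt0 // lt_min d10.
have t1 : t < d1.
  by rewrite /t ltr_pdivrMr // minC gt_min; apply/orP; right; lra.
have t2 : t < d2 by rewrite /t ltr_pdivrMr // gt_min; apply/orP; right; lra.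
have := H1 t t0 t1; have := H2 t t0 t2.
rewrite [x + t *: q + t *: p]addrAC.
set A := f _; set B := f _; set C := f _; set D := f _ => h1 h2.
have tt : 0 < t ^+ 2 by rewrite exprn_gt0.
rewrite -(ler_pM2l tt) -[X in X * `|_|]gtr0_norm // -normrM.
have -> : t ^+ 2 * (dot ('d G x p) q - dot ('d G x q) p) =
  (A - C - (B - D) - t ^+ 2 * dot ('d G x q) p) -
  (A - B - (C - D) - t ^+ 2 * dot ('d G x p) q) by ring.
apply: (le_trans (ler_normB _ _)). lra.
Qed.

End Graph.

(** * Determinants and quadratic forms in dimension two *)

Section Ord2.

Lemma sum_ord2 (V : nmodType) (F : 'I_2 -> V) : \sum_i F i = F 0 + F 1.
Proof. by rewrite !big_ord_recl big_ord0 addr0; congr (_ + F _); exact: val_inj. Qed.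

Lemma det_mx22 (R : comPzRingType) (M : 'M[R]_2) :
  \det M = M 0 0 * M 1 1 - M 0 1 * M 1 0.
Proof.
rewrite (expand_det_row _ 0) sum_ord2 /cofactor !det_mx11 !mxE /=.
rewrite expr0 mul1r expr1 mulN1r mulrN.
by congr (_ * M _ _ - _ * M _ _); exact: val_inj.
Qed.

End Ord2.

Section Quad.
Context {R : realFieldType}.

(** At (-q, p) the larger form equals p times its determinant, while completing the square bounds
    the smaller form there from below by its determinant times p^2 / A. Then A <= p concludes. *)
Lemma quad_det_le (p q r A B C : R) : 0 < A -> 0 < A * C - B ^+ 2 ->
  (forall s t, A * s ^+ 2 + 2 * B * s * t + C * t ^+ 2 <=
               p * s ^+ 2 + 2 * q * s * t + r * t ^+ 2) ->
  A * C - B ^+ 2 <= p * r - q ^+ 2.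
Proof.
move=> A0 D0 H.
have pA : A <= p by have := H 1 0; rewrite expr1n expr0n /= !mulr0 !addr0 !mulr1.
have p0 : 0 < p by exact: lt_le_trans pA.
have := H (- q) p => Hq.
have E : A * (A * (- q) ^+ 2 + 2 * B * (- q) * p + C * p ^+ 2) =
  (A * q - B * p) ^+ 2 + (A * C - B ^+ 2) * p ^+ 2 by ring.
have E2 : p * (- q) ^+ 2 + 2 * q * (- q) * p + r * p ^+ 2 = p * (p * r - q ^+ 2) by ring.
rewrite E2 -(ler_pM2l A0) E in Hq.
have H2 : (A * C - B ^+ 2) * p ^+ 2 <= A * (p * (p * r - q ^+ 2)).
  by apply: le_trans Hq; rewrite lerDr sqr_ge0.
have H3 : A * p * (A * C - B ^+ 2) <= A * p * (p * r - q ^+ 2).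
  apply: le_trans (_ : (A * C - B ^+ 2) * p ^+ 2 <= _); last by rewrite -mulrA.
  by rewrite mulrC expr2 ler_wpM2l ?(ltW D0)// ler_wpM2r // ltW.
by rewrite ler_pM2l ?mulr_gt0 in H3.
Qed.

End Quad.

Definition qform {R : realType} (A B C : R) (z : 'rV[R]_2) : R :=
  A * z 0 0 ^+ 2 + 2 * B * z 0 0 * z 0 1 + C * z 0 1 ^+ 2.

(** * Support functions and touching *)

Section Dual.
Context {R : realType}.
Local Notation R2 := 'rV[R]_2.
Context (S : set 'rV[R]_3) (f : R2 -> R) (G : R2 -> R2).
Context (gS : forall p, S p <-> p 0 2 = f (vproj p)).
Context (fG : forall x v, is_derive x v f (dot (G x) v)).
Context (dG : forall x, differentiable G x).
Context (fconv : forall x y (t : R), 0 <= t <= 1 ->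
  f ((1 - t) *: x + t *: y) <= (1 - t) * f x + t * f y).
Local Notation u := (support_fun S).

Definition gpt (x : R2) : 'rV[R]_3 := \row_(i < 3) [:: x 0 0; x 0 1; f x : R]`_i.

Lemma vproj_gpt x : vproj (gpt x) = x.
Proof. by apply: rv2P; rewrite !mxE. Qed.

Lemma gptS x : S (gpt x).
Proof. by apply/gS; rewrite vproj_gpt mxE. Qed.

Lemma mink_lift1 (p : 'rV[R]_3) y : mink p (lift1 y) = dot (vproj p) y - p 0 2.
Proof. by rewrite /mink /dot !mxE /= mulr1. Qed.

Lemma supp_ge x y : ((dot x y - f x)%:E <= u y)%E.
Proof.
apply: ereal_sup_ubound; exists (gpt x); first exact: gptS.
by rewrite mink_lift1 vproj_gpt mxE.
Qed.

Lemma supp_le y (c : \bar R) : (forall x, ((dot x y - f x)%:E <= c)%E) -> (u y <= c)%E.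
Proof.
move=> H; apply: ge_ereal_sup => _ [p /gS Sp <-].
by rewrite mink_lift1 Sp.
Qed.

Lemma supp_gt y (c : R) : (c%:E < u y)%E -> exists x, c < dot x y - f x.
Proof.
move=> /ereal_sup_gt [_ [p /gS Sp <-]]; rewrite lte_fin mink_lift1 Sp => H.
by exists (vproj p).
Qed.

Lemma supp_gtNy y : (-oo < u y)%E.
Proof. exact: lt_le_trans (ltNyr _) (supp_ge 0 y). Qed.

Lemma supp_finE y : (u y \is a fin_num) = (u y < +oo)%E.
Proof. by rewrite fin_numElt supp_gtNy. Qed.

(** Phrased with real upper bounds, so that no weight is multiplied by an infinite value; each
    function under the supremum is affine in the point. *)
Lemma supp_conv y z (A B t : R) : 0 <= t <= 1 -> (u y <= A%:E)%E -> (u z <= B%:E)%E ->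
  (u ((1 - t) *: y + t *: z) <= ((1 - t) * A + t * B)%:E)%E.
Proof.
move=> /andP[t0 t1] hA hB; apply: supp_le => x; rewrite lee_fin.
have hy : dot x y - f x <= A by rewrite -lee_fin; exact: le_trans (supp_ge x y) hA.
have hz : dot x z - f x <= B by rewrite -lee_fin; exact: le_trans (supp_ge x z) hB.
rewrite dotDr !dotZr.
have t1' : 0 <= 1 - t by rewrite subr_ge0.
have := ler_wpM2l t0 hz; have := ler_wpM2l t1' hy; lra.
Qed.

(** By convexity the difference quotient of [f] along the segment is at most f y - f x, and by
    [taylor2] it differs from the slope at [x] by a multiple of t. *)
Lemma tangent_le x y : f x + dot (G x) (y - x) <= f y.
Proof.
set k := y - x; rewrite -subr_ge0 -oppr_le0; apply/ler_addgt0Pl => e e0; rewrite addr0.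
have [d d0 H] := taylor2 fG dG x ltr01.
set M := `|dot ('d G x k) k / 2| + `|k| ^+ 2 + 1.
have M0 : 0 < M by rewrite ltr_wpDl // addr_ge0 // exprn_ge0.
near (0 : R)^'+ => t.
have t0 : 0 < t by near: t; exact: nbhs_right_gt.
have t1 : t < 1 by near: t; exact: nbhs_right_lt.
have tk : `|t *: k| < d.
  rewrite normrZ gtr0_norm //.
  have : t < d / (`|k| + 1) by near: t; apply: nbhs_right_lt; rewrite divr_gt0 // ltr_wpDl.
  rewrite ltr_pdivlMr ?ltr_wpDl // => h.
  by apply: le_lt_trans h; rewrite ler_wpM2l ?(ltW t0) // lerDl.
have tM : t * M < e by rewrite -ltr_pdivlMr //; near: t; apply: nbhs_right_lt; rewrite divr_gt0.
have := H _ tk; rewrite diffZE !dotZr dotZl normrZ (gtr0_norm t0) exprMn.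
rewrite mul1r ler_norml => /andP[h _].
have C : f (x + t *: k) <= (1 - t) * f x + t * f y.
  have -> : x + t *: k = (1 - t) *: x + t *: y.
    by rewrite /k; apply: rv2P; rewrite !mxE; ring.
  by apply: fconv; rewrite !ltW.
rewrite -(ler_pM2l t0).
rewrite /M in tM; move: h tM; set q := dot ('d G x k) k => h tM.
have hq : - (q / 2) <= `|q / 2| by rewrite lerNl; exact: lerNnormlW.
have h3 : t * (t * (`|q / 2| + `|k| ^+ 2)) <= t * e.
  by apply: (ler_wpM2l (ltW t0)); apply: le_trans (ltW tM); apply: (ler_wpM2l (ltW t0)); rewrite lerDl.
have h4 : t * t * - (q / 2) <= t * t * `|q / 2| by rewrite ler_wpM2l // mulr_ge0 ?ltW.
nra.
Unshelve. all: by end_near. Qed.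

(** Fenchel equality: by [tangent_le], [x] maximises the function whose supremum is [u (G x)]. At
    the points [G x] the value of [u] is thus known exactly. *)
Lemma supp_grad x : u (G x) = (dot x (G x) - f x)%:E.
Proof.
apply/eqP; rewrite eq_le supp_ge andbT; apply: supp_le => z; rewrite lee_fin.
by have := tangent_le x z; rewrite dotBr ![dot (G x) _]dotC; lra.
Qed.

Section Touch.
Context (y xh : R2) (A B C uy : R).
Context (A0 : 0 < A) (D0 : 0 < A * C - B ^+ 2).
Local Notation Q := (qform A B C).
Context (uyE : u y = uy%:E).
Context (below : forall e : R, 0 < e -> exists2 d : R, 0 < d & forall z : R2, `|z| < d ->
  ((uy + dot xh z + Q z / 2 - e * `|z| ^+ 2)%:E <= u (y + z)%R)%E).

Let Q_ge0 z : 0 <= Q z.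
Proof.
have E : A * Q z = (A * z 0 0 + B * z 0 1) ^+ 2 + (A * C - B ^+ 2) * z 0 1 ^+ 2.
  by rewrite /qform; ring.
rewrite -(pmulr_rge0 _ A0) E addr_ge0 ?sqr_ge0 // mulr_ge0 ?sqr_ge0 //.
exact: ltW.
Qed.

(** Convexity of [u] makes the local lower expansion a global subgradient inequality: at a fraction
    t of the way along [z], a gap [t * m] would have to be covered by an error of order t^2. The
    real bound [c] stands for u (y + z), which may be infinite. *)
Lemma touch_subgradient (z : R2) (c : R) : (u (y + z) <= c%:E)%E -> uy + dot xh z <= c.
Proof.
move=> uz; rewrite leNgt; apply/negP => H.
have [d d0 Hd] := below ltr01.
set m := uy + dot xh z - c; have m0 : 0 < m by rewrite /m; lra.
have z1 : 0 < `|z| + 1 by rewrite ltr_wpDl.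
have z2 : 0 < `|z| ^+ 2 + 1 by rewrite ltr_wpDl // exprn_ge0.
near (0 : R)^'+ => t.
have t0 : 0 < t by near: t; exact: nbhs_right_gt.
have t1 : t < 1 by near: t; exact: nbhs_right_lt.
have : t < d / (`|z| + 1) by near: t; apply: nbhs_right_lt; rewrite divr_gt0.
rewrite ltr_pdivlMr // mulrDr mulr1 => h1.
have : t < m / (`|z| ^+ 2 + 1) by near: t; apply: nbhs_right_lt; rewrite divr_gt0.
rewrite ltr_pdivlMr // mulrDr mulr1 => h2.
have tz : `|t *: z| < d by rewrite normrZ gtr0_norm //; lra.
have uy' : (u y <= uy%:E)%E by rewrite uyE.
have t01 : 0 <= t <= 1 by rewrite !ltW.
have := le_trans (Hd _ tz) (_ : (_ <= ((1 - t) * uy + t * c)%:E)%E).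
have -> : y + t *: z = (1 - t) *: y + t *: (y + z).
  by apply: rv2P; rewrite !mxE; ring.
move=> /(_ (supp_conv t01 uy' uz)).
rewrite lee_fin dotZr normrZ gtr0_norm // exprMn mul1r => h3.
have := Q_ge0 (t *: z) => h4.
have : t * m <= t * (t * `|z| ^+ 2) by rewrite /m; lra.
by rewrite ler_pM2l //; lra.
Unshelve. all: by end_near. Qed.

(** So the supremum defining [u y] is attained at [xh]. The nontrivial inequality is the subgradient
    inequality evaluated at [G xh], where [supp_grad] gives [u]. *)
Lemma touch_attained : uy = dot xh y - f xh.
Proof.
apply/eqP; rewrite eq_le; apply/andP; split; last first.
  by rewrite -lee_fin -uyE; exact: supp_ge.
have := @touch_subgradient (G xh - y) (dot xh (G xh) - f xh).
rewrite addrCA subrr addr0 supp_grad => /(_ (lexx _)).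
by rewrite dotBr; lra.
Qed.

(* [y] is a subgradient of [f] at [xh]. *)
Lemma touch_grad : y = G xh.
Proof.
set k := y - G xh; suff k0 : dot k k <= 0.
  have k0' : k = 0.
    move: k0; rewrite /dot -!expr2 => k0.
    have k00 := sqr_ge0 (k 0 0); have k01 := sqr_ge0 (k 0 1).
    apply: rv2P; apply/eqP; rewrite [X in _ == X]mxE -sqrf_eq0 eq_le sqr_ge0 andbT; lra.
  by apply/eqP; rewrite -subr_eq0 -/k k0'.
apply/ler_addgt0Pl => e e0; rewrite addr0.
have [d d0 H] := taylor2 fG dG xh ltr01.
set M := `|dot ('d G xh k) k / 2| + `|k| ^+ 2 + 1.
have M0 : 0 < M by rewrite ltr_wpDl // addr_ge0 // exprn_ge0.
near (0 : R)^'+ => t.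
have t0 : 0 < t by near: t; exact: nbhs_right_gt.
have tk : `|t *: k| < d.
  rewrite normrZ gtr0_norm //.
  have : t < d / (`|k| + 1) by near: t; apply: nbhs_right_lt; rewrite divr_gt0 // ltr_wpDl.
  rewrite ltr_pdivlMr ?ltr_wpDl // => h.
  by apply: le_lt_trans h; rewrite ler_wpM2l ?(ltW t0) // lerDl.
have tM : t * M < e by rewrite -ltr_pdivlMr //; near: t; apply: nbhs_right_lt; rewrite divr_gt0.
have := H _ tk; rewrite diffZE !dotZr dotZl normrZ (gtr0_norm t0) exprMn.
rewrite mul1r ler_norml => /andP[_ h].
have C' : dot (xh + t *: k) y - f (xh + t *: k) <= dot xh y - f xh.
  by rewrite -touch_attained -lee_fin -uyE; exact: supp_ge.
rewrite dotDl dotZl in C'.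
rewrite -(ler_pM2l t0).
have -> : dot k k = dot k y - dot (G xh) k.
  by rewrite {2}/k dotBr [dot k (G xh)]dotC.
have hq := ler_norm (dot ('d G xh k) k / 2).
rewrite /M in tM; move: h tM hq; set q := dot ('d G xh k) k => h tM hq.
have h3 : t * (t * (`|q / 2| + `|k| ^+ 2)) <= t * e.
  by apply: (ler_wpM2l (ltW t0)); apply: le_trans (ltW tM); apply: (ler_wpM2l (ltW t0)); rewrite lerDl.
have h4 : t * t * (q / 2) <= t * t * `|q / 2| by rewrite ler_wpM2l // mulr_ge0 ?ltW.
rewrite mulrBr; lra.
Unshelve. all: by end_near. Qed.

(** A second derivative of [u] need not exist, but along G (xh + t v) = y + t (h + r), with r small,
    [supp_grad] gives [u] exactly. Inserting the expansion of [f] and comparing with [below] at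
    order t^2 yields the inequality. *)
Lemma touch_hess (v : R2) : Q ('d G xh v) <= dot ('d G xh v) v.
Proof.
set h : R2 := 'd G xh v.
set N := `|A| + 2 * `|B| + `|C|.
have N0 : 0 <= N by rewrite !addr_ge0 // mulr_ge0.
(* After doubling, the coefficients of [e] in the four errors: the Taylor remainder of [f], the
   product of [v] and r, the cross term of Q(h + r), and the error in [below]. *)
set K := 2 * `|v| ^+ 2 + 4 * `|v| * `|v| + 2 * N * `|h| * `|v| + 2 * (`|h| + `|v|) ^+ 2.
have K0 : 0 <= K.
  by rewrite !addr_ge0 ?mulr_ge0 ?exprn_ge0 ?addr_ge0.
apply/ler_addgt0Pl => e' e'0.
set e := Num.min 1 (e' / (K + 1)).
have K1 : 0 < K + 1 by rewrite ltr_wpDl.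
have e0 : 0 < e by rewrite lt_min ltr01 divr_gt0.
have e1 : e <= 1 by rewrite ge_min lexx.
have eK : e * K <= e'.
  have : e <= e' / (K + 1) by rewrite ge_min lexx orbT.
  by rewrite ler_pdivlMr // mulrDr mulr1; lra.
have [d1 d10 H1] := taylor2 fG dG xh e0.
have [d2 d20 H2] := differentiable_eps (dG xh) e0.
have [d3 d30 H3] := below e0.
have v1 : 0 < `|v| + 1 by rewrite ltr_wpDl.
have hv1 : 0 < `|h| + `|v| + 1 by rewrite ltr_wpDl // addr_ge0.
near (0 : R)^'+ => t.
have t0 : 0 < t by near: t; exact: nbhs_right_gt.
have : t < d1 / (`|v| + 1) by near: t; apply: nbhs_right_lt; rewrite divr_gt0.
rewrite ltr_pdivlMr // mulrDr mulr1 => tv1.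
have : t < d2 / (`|v| + 1) by near: t; apply: nbhs_right_lt; rewrite divr_gt0.
rewrite ltr_pdivlMr // mulrDr mulr1 => tv2.
have : t < d3 / (`|h| + `|v| + 1) by near: t; apply: nbhs_right_lt; rewrite divr_gt0.
rewrite ltr_pdivlMr // mulrDr mulr1 => tv3.
have ntv : `|t *: v| = t * `|v| by rewrite normrZ gtr0_norm.
have := H1 (t *: v); rewrite diffZE !dotZr dotZl ntv => /(_ ltac:(lra)).
have := H2 (t *: v); rewrite diffZE ntv => /(_ ltac:(lra)).
set r := t^-1 *: (G (xh + t *: v) - G xh - t *: 'd G xh v).
have tn0 : t != 0 by rewrite gt_eqF.
have Er : G (xh + t *: v) = y + t *: (h + r).
  by rewrite touch_grad /r /h scalerDr scalerA divff // scale1r; apply: rv2P; rewrite !mxE; ring.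
have -> : G (xh + t *: v) - G xh - t *: 'd G xh v = t *: r.
  by rewrite /r scalerA divff // scale1r.
rewrite normrZ gtr0_norm // mulrCA ler_pM2l // => hr.
have rv : `|r| <= `|v| by apply: le_trans hr _; rewrite ler_piMl.
have nhr : `|h + r| <= `|h| + `|v| by apply: le_trans (ler_normD _ _) _; rewrite lerD2l.
have nth : `|t *: (h + r)| < d3.
  rewrite normrZ gtr0_norm //; apply: le_lt_trans (_ : t * (`|h| + `|v|) < _); last by lra.
  by rewrite ler_wpM2l // ltW.
have := H3 _ nth; rewrite -Er supp_grad Er lee_fin touch_attained.
rewrite ler_norml -touch_grad => h1 /andP[h2 _].
have QtE : Q (t *: (h + r)) = t ^+ 2 * (Q h + (2 * A * h 0 0 * r 0 0 + 2 * B * (h 0 0 * r 0 1 + h 0 1 * r 0 0) + 2 * C * h 0 1 * r 0 1) + Q r).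
  by rewrite /qform !mxE; ring.
rewrite QtE in h1; move: h1.
set b := (X in Q h + X + Q r) => h1.
have hb : - b <= 2 * N * `|h| * `|r|.
  have hh0 := coord_norm h 0; have hh1 := coord_norm h 1.
  have r0 := coord_norm r 0; have r1 := coord_norm r 1.
  have P i j : `|h 0 i| * `|r 0 j| <= `|h| * `|r| by rewrite ler_pM // coord_norm.
  have p1 : - (A * (h 0 0 * r 0 0)) <= `|A| * (`|h| * `|r|).
    by apply: (le_trans (ler_norm _)); rewrite normrN !normrM ler_wpM2l.
  have p2 : - (C * (h 0 1 * r 0 1)) <= `|C| * (`|h| * `|r|).
    by apply: (le_trans (ler_norm _)); rewrite normrN !normrM ler_wpM2l.
  have p3 : - (B * (h 0 0 * r 0 1 + h 0 1 * r 0 0)) <= `|B| * (2 * (`|h| * `|r|)).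
    apply: (le_trans (ler_norm _)); rewrite normrN normrM ler_wpM2l //.
    apply: (le_trans (ler_normD _ _)); rewrite !normrM.
    have := P 0 1; have := P 1 0; lra.
  rewrite /b; move: p1 p2 p3; rewrite /N; lra.
have hb' : - b <= e * (2 * N * `|h| * `|v|).
  apply: (le_trans hb).
  have -> : e * (2 * N * `|h| * `|v|) = 2 * N * `|h| * (e * `|v|) by ring.
  by rewrite ler_wpM2l // !mulr_ge0.
have := Q_ge0 r => Qr.
have hh : `|t *: (h + r)| ^+ 2 <= t ^+ 2 * (`|h| + `|v|) ^+ 2.
  by rewrite normrZ gtr0_norm // exprMn ler_pM2l ?exprn_gt0 // lerXn2r ?nnegrE // addr_ge0.
have dvr : dot v r <= e * (2 * `|v| * `|v|).
  apply: (le_trans (ler_norm _)); apply: (le_trans (dot_le _ _)).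
  have -> : e * (2 * `|v| * `|v|) = 2 * `|v| * (e * `|v|) by ring.
  by rewrite ler_wpM2l // mulr_ge0.
have hv' : dot v h = dot h v by rewrite dotC.
move: h1; rewrite !dotDl !dotDr !dotZl !dotZr !dotDr hv' => h1.
have hh' := ler_wpM2l (ltW e0) hh.
have tt : 0 < t ^+ 2 by rewrite exprn_gt0.
rewrite -(ler_pM2l tt).
have a1 := ler_wpM2l (ltW tt) dvr.
have a2 := ler_wpM2l (ltW tt) hb'.
have a3 := mulr_ge0 (ltW tt) Qr.
have a4 := ler_wpM2l (ltW tt) eK.
move: a4; rewrite /K; rewrite exprMn in h2.
have eyv : dot v y = dot y v by rewrite dotC.
rewrite eyv in h1.
lra.
Unshelve. all: by end_near. Qed.

(** Apply [touch_hess] to v = adj(J) (s, t), whose image under ['d G xh] is d (s, t), with d the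
    determinant. It says that d Q lies below the form of adj(J), so [quad_det_le] gives d^2 (A C -
    B^2) <= d. *)
Lemma touch_det : 0 < \det ('J G xh) ->
  (A * C - B ^+ 2) * \det ('J G xh) <= 1.
Proof.
rewrite det_mx22; set J := 'J G xh => J0.
have dE v : 'd G xh v = v *m J by rewrite /J /jacobian mul_rV_lin1.
have d0 v : ('d G xh v) 0 0 = v 0 0 * J 0 0 + v 0 1 * J 1 0.
  by rewrite dE mxE sum_ord2.
have d1 v : ('d G xh v) 0 1 = v 0 0 * J 0 1 + v 0 1 * J 1 1.
  by rewrite dE mxE sum_ord2.
have Jsym : J 1 0 = J 0 1.
  have := hess_sym fG dG xh (pt 1 0) (pt 0 1).
  by rewrite /dot !d0 !d1 !pt0 !pt1 !(mul0r, mul1r, mulr0, mulr1, addr0, add0r).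
rewrite Jsym -expr2; rewrite Jsym -expr2 in J0.
set d := _ - _ in J0 *.
have H s t : d * A * s ^+ 2 + 2 * (d * B) * s * t + d * C * t ^+ 2 <=
    J 1 1 * s ^+ 2 + 2 * (- J 0 1) * s * t + J 0 0 * t ^+ 2.
  have := touch_hess (pt (J 1 1 * s - J 0 1 * t) (J 0 0 * t - J 0 1 * s)).
  rewrite /qform /dot !d0 !d1 !pt0 !pt1 Jsym.
  have -> : (J 1 1 * s - J 0 1 * t) * J 0 0 + (J 0 0 * t - J 0 1 * s) * J 0 1 = d * s.
    by rewrite /d; ring.
  have -> : (J 1 1 * s - J 0 1 * t) * J 0 1 + (J 0 0 * t - J 0 1 * s) * J 1 1 = d * t.
    by rewrite /d; ring.
  by move=> K; rewrite -(ler_pM2l J0); lra.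
have dA : 0 < d * A by rewrite mulr_gt0.
have E : d * A * (d * C) - (d * B) ^+ 2 = d * (d * (A * C - B ^+ 2)) by ring.
have dD : 0 < d * A * (d * C) - (d * B) ^+ 2 by rewrite E !mulr_gt0.
have := quad_det_le dA dD H; rewrite E sqrrN.
have -> : J 1 1 * J 0 0 - J 0 1 ^+ 2 = d * 1 by rewrite /d; ring.
by rewrite ler_pM2l // mulrC.
Qed.

End Touch.

End Dual.

(** * Coordinatewise differentiation and local inverses *)

Section Coordinates.
Context {R : realType} {V : normedModType R}.

Lemma differentiable_near (W : normedModType R) (f g : V -> W) x :
  (\forall y \near x, f y = g y) -> differentiable f x -> differentiable g x.
Proof.
move=> E df; suff : is_diff x g ('d f x) by move=> /@ex_diff.
apply: eps_is_diff; first exact: diff_continuous.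
move=> e e0; have [d d0 Hd] := differentiable_eps df e0.
have [d' d'0 Hd'] := (nbhs_ballP _ _).1 E.
exists (Num.min d d'); first by rewrite lt_min d0.
move=> k; rewrite lt_min => /andP[kd kd'].
rewrite -(Hd' x (ballxx _ d'0)) -Hd'; first exact: Hd.
by rewrite -ball_normE /= opprD addrA subrr sub0r normrN.
Qed.

Lemma differentiable_pt (f g : V -> R) x : differentiable f x ->
  differentiable g x -> differentiable (fun y => pt (f y) (g y)) x.
Proof.
move=> df dg.
have -> : (fun y => pt (f y) (g y)) =
    (fun y => f y *: pt 1 0 + g y *: pt 0 1).
  by apply/funext => y; apply: rv2P; rewrite !mxE /=; ring.
by apply: differentiableD; apply: differentiableZl.
Qed.

Lemma differentiable_entry n (f : V -> 'rV[R]_n) i x : differentiable f x ->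
  differentiable (fun y => f y 0 i) x.
Proof.
move=> df; have dc := @differentiable_coord R 1 n (f x) 0 i.
exact: (differentiable_comp df dc).
Qed.

Lemma diff_entry n (f : V -> 'rV[R]_n) i x v : differentiable f x ->
  'd (fun y => f y 0 i) x v = ('d f x v) 0 i.
Proof.
move=> df; rewrite -!deriveE //; last exact: differentiable_entry.
have dv : derivable f x v by exact: diff_derivable.
by rewrite (derive_mx dv) mxE.
Qed.

Lemma is_derive_row n (f : V -> 'rV[R]_n) x v (w : 'rV[R]_n) :
  is_derive x v f w <-> forall i, is_derive x v (fun y => f y 0 i) (w 0 i).
Proof.
split=> [[df <-] i|H].
  split; first by move/derivable_mxP : df; apply.
  by rewrite derive_mx // mxE.
have df : derivable f x v by apply/derivable_mxP => i j; rewrite (ord1 i); case: (H j).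
split => //; rewrite derive_mx //; apply/rowP => j; rewrite mxE.
by case: (H j).
Qed.

End Coordinates.

Section Inverse.
Context {R : realType}.
Local Notation R2 := 'rV[R]_2.

Lemma mulmx_continuous (M : 'M[R]_2) : continuous (fun k : R2 => k *m M).
Proof.
have -> : (fun k : R2 => k *m M) =
    (fun k => pt (k 0 0 * M 0 0 + k 0 1 * M 1 0) (k 0 0 * M 0 1 + k 0 1 * M 1 1)).
  by apply/funext => k; apply: rv2P; rewrite !mxE sum_ord2.
move=> k; apply: differentiable_continuous; apply: differentiable_pt;
  by apply: differentiableD; apply: differentiableM => //; exact: differentiable_coord.
Qed.

(* As [g] is known to be continuous, no inverse function theorem is needed. *)
Lemma differentiable_inverse (F g : R2 -> R2) x :
  differentiable F (g x) -> \det ('J F (g x)) != 0 -> {for x, continuous g} ->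
  (\forall y \near x, F (g y) = y) -> differentiable g x.
Proof.
move=> dF J0 gc Fg.
set J := 'J F (g x); have Ju : J \in unitmx by rewrite unitmxE unitfE.
have [C C0 HC] : exists2 C, 0 < C & forall k : R2, `|k *m invmx J| <= C * `|k|.
  have [C C0 HC] := linear_lipschitz (f := mulmxr (invmx J) : {linear R2 -> R2}) (@mulmx_continuous _).
  by exists C.
suff : is_diff x g (mulmxr (invmx J)) by move=> /@ex_diff.
apply: eps_is_diff; first exact: mulmx_continuous.
move=> e e0; set e1 := Num.min (1 / (2 * C)) (e / (2 * C ^+ 2)).
have e10 : 0 < e1 by rewrite lt_min !divr_gt0 ?mulr_gt0 ?exprn_gt0.
have e1C : e1 * C <= 1 / 2.
  have : e1 <= 1 / (2 * C) by rewrite ge_min lexx.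
  by rewrite ler_pdivlMr ?mulr_gt0 //; lra.
have e1C2 : e1 * (2 * C ^+ 2) <= e.
  have : e1 <= e / (2 * C ^+ 2) by rewrite ge_min lexx orbT.
  by rewrite ler_pdivlMr // mulr_gt0 // exprn_gt0.
have [d1 d10 H1] := differentiable_eps dF e10.
have [d2 d20 H2] : exists2 d2, 0 < d2 & forall k : R2, `|k| < d2 -> `|g (x + k) - g x| < d1.
  have /cvgrPdist_lt /(_ _ d10) /nbhs_ballP[d2 d20 H2] := gc.
  exists d2 => // k kd; rewrite distrC; apply: H2.
  by rewrite -ball_normE /= opprD addrA subrr sub0r normrN.
have [d3 d30 H3] := (nbhs_ballP _ _).1 Fg.
exists (Num.min d2 d3); first by rewrite lt_min d20.
move=> k; rewrite lt_min => /andP[kd2 kd3].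
set l := g (x + k) - g x.
have := H1 l (H2 k kd2); rewrite [g x + l]addrC subrK.
rewrite H3; last by rewrite -ball_normE /= opprD addrA subrr sub0r normrN.
rewrite (H3 x (ballxx _ d30)) [x + k]addrC addrK.
have -> : 'd F (g x) l = l *m J by rewrite /J /jacobian mul_rV_lin1.
move=> hl.
have El : l - k *m invmx J = - ((k - l *m J) *m invmx J).
  by rewrite mulmxBl mulmxK // opprB.
have h1 : `|l - k *m invmx J| <= C * (e1 * `|l|).
  by rewrite El normrN; apply: le_trans (HC _) _; rewrite ler_pM2l.
have h2 : `|l| <= 2 * C * `|k|.
  have : `|l| <= `|k *m invmx J| + `|l - k *m invmx J|.
    by rewrite -{1}(subrK (k *m invmx J) l) addrC ler_normD.
  have := HC k; have := ler_wpM2r (normr_ge0 l) e1C; lra.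
apply: (le_trans h1); apply: le_trans (_ : C * e1 * (2 * C * `|k|) <= _).
  by rewrite mulrA ler_pM2l // mulr_gt0.
have := ler_wpM2r (normr_ge0 k) e1C2; lra.
Qed.

End Inverse.

Lemma rv3P (R : realType) (x y : 'rV[R]_3) :
  x 0 0 = y 0 0 -> x 0 1 = y 0 1 -> x 0 2 = y 0 2 -> x = y.
Proof.
move=> h0 h1 h2; apply/rowP => i; case: i => [[|[|[|//]]] Hi].
- by rewrite (_ : Ordinal Hi = 0) //; exact: val_inj.
- by rewrite (_ : Ordinal Hi = 1) //; exact: val_inj.
- by rewrite (_ : Ordinal Hi = 2) //; exact: val_inj.
Qed.

Lemma vproj0 (R : realType) (v : 'rV[R]_3) : vproj v 0 0 = v 0 0.
Proof. by rewrite mxE. Qed.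

Lemma vproj1 (R : realType) (v : 'rV[R]_3) : vproj v 0 1 = v 0 1.
Proof. by rewrite mxE. Qed.

Lemma is_derive_affine (R : realType) (a b s : R) :
  is_derive s (1 : R) (fun t : R => a + t * b) b.
Proof.
have d : is_derive s (1 : R) (cst a + id * cst b : R -> R) (0 + (s *: 0 + b *: 1)).
  by apply: is_deriveD.
by move: d; rewrite scaler0 !add0r /GRing.scale /= mulr1.
Qed.

(** * Entire spacelike surfaces as graphs *)

Section SurfaceGraph.
Context {R : realType}.
Local Notation R2 := 'rV[R]_2.
Local Notation R21 := 'rV[R]_3.
Context (S : set R21).
Context (surfS : smooth_surface S) (slS : spacelike S).
Context (sg : R2 -> R21).
Context (sgS : forall x, S (sg x)) (sgK : forall x, vproj (sg x) = x).
Context (Ksg : forall p, S p -> sg (vproj p) = p) (sg_cont : continuous sg).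

Definition height (x : R2) : R := sg x 0 2.

Definition hgrad (x : R2) : R2 := pt ('D_(pt 1 0) height x) ('D_(pt 0 1) height x).

Lemma graph_height p : S p <-> p 0 2 = height (vproj p).
Proof.
split=> [Sp|E]; first by rewrite /height Ksg.
suff -> : p = sg (vproj p) by [].
have := sgK (vproj p) => /rowP K.
apply: rv3P; last by rewrite E.
- by have := K 0; rewrite !mxE.
- by have := K 1; rewrite !mxE.
Qed.

(** [g] sends a base point to its chart parameter. At this stage it is known to be continuous;
    [chart_inverse] makes it differentiable. *)
Lemma local_chart (x0 : R2) : exists (U : set R2) (X : R2 -> R21) (g : R2 -> R2),
  [/\ open U, smooth_on U X, (forall u, U u -> S (X u)),
     (forall u, U u -> injective ('d X u)) &
     \forall x \near x0, [/\ U (g x), X (g x) = sg x & {for x, continuous g}]].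
Proof.
have [U [W [X [Wp [oU oW [[Xf Xi Xs] [h [hK Xc hc]]] smX inj]]]]] := surfS (sgS x0).
exists U, X, (h \o sg); split => //.
  by move=> u Uu; case: (Xf u Uu).
have nW (x : R2) : W (sg x) -> \forall y \near x, W (sg y).
  by move=> Wx; apply: sg_cont; exact: open_nbhs_nbhs.
near=> x.
have Wx : W (sg x) by near: x; exact: nW.
have SWx : (S `&` W) (sg x) by split.
have [u Uu Xu] := Xs _ SWx.
have hu : h (sg x) = u by rewrite -Xu hK // inE.
split=> /=; [by rewrite hu|by rewrite hu|].
move=> N /= HN.
have /subspace_continuousP /(_ _ SWx) /(_ N HN) := hc.
rewrite /= nbhs_simpl /within /= => /sg_cont.
have := nW x Wx; rewrite /= !nbhs_simpl /=.
apply: filterS2 => y Wy; apply; split => //.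
Unshelve. all: by end_near. Qed.

Lemma curve_through (U : set R2) (X : R2 -> R21) u v : open U -> U u ->
  (forall u', U u' -> S (X u')) -> differentiable X u -> tangent S (X u) ('d X u v).
Proof.
move=> oU Uu XS dX; exists (fun t : R => X (u + t *: v)); split.
- by rewrite scale0r addr0.
- have cl : {for (0 : R), continuous (fun t : R => u + t *: v)}.
    by apply: cvgD; [exact: cvg_cst|apply: cvgZl; exact: cvg_id].
  have NU : nbhs (u + 0 *: v) U by rewrite scale0r addr0; exact: open_nbhs_nbhs.
  by near=> t; apply: XS; near: t; exact: (cl _ NU).
- apply: is_derive_line; rewrite scale0r addr0 -deriveE //.
  exact/derivableP/diff_derivable.
Unshelve. all: by end_near. Qed.

Lemma differentiable_vproj (V : normedModType R) (X : V -> R21) u :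
  differentiable X u -> differentiable (vproj \o X) u.
Proof.
move=> dX; have -> : vproj \o X = (fun y => pt (X y 0 0) (X y 0 1)).
  by apply/funext => y; apply: rv2P; rewrite !mxE.
by apply: differentiable_pt; exact: differentiable_entry.
Qed.

Lemma diff_vproj (V : normedModType R) (X : V -> R21) u v :
  differentiable X u -> 'd (vproj \o X) u v = vproj ('d X u v).
Proof.
move=> dX; have dF := differentiable_vproj dX.
have E0 : (fun y => X y 0 0) = (fun y => (vproj \o X) y 0 0).
  by apply/funext => y; rewrite !mxE.
have E1 : (fun y => X y 0 1) = (fun y => (vproj \o X) y 0 1).
  by apply/funext => y; rewrite !mxE.
apply: rv2P; rewrite -diff_entry // [RHS]mxE /=.
  by rewrite -E0 diff_entry.
by rewrite -E1 diff_entry.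
Qed.

(** A kernel vector would produce a nonzero vertical tangent vector, on which the Minkowski form is
    not positive. *)
Lemma chart_det (U : set R2) (X : R2 -> R21) u : open U -> U u ->
  (forall u', U u' -> S (X u')) -> differentiable X u -> injective ('d X u) ->
  \det ('J (vproj \o X) u) != 0.
Proof.
move=> oU Uu XS dX inj; apply/negP => /det0P[v v0].
have -> : v *m 'J (vproj \o X) u = vproj ('d X u v).
  by rewrite -diff_vproj // /jacobian mul_rV_lin1.
move=> /rowP w0; have W0 := w0 0; have W1 := w0 1; rewrite !mxE /= in W0 W1.
have T := curve_through v oU Uu XS dX.
have wn0 : 'd X u v != 0.
  by apply: contra v0 => /eqP wv; apply/eqP/inj; rewrite wv linear0.
have := slS (XS _ Uu) T wn0; rewrite /mink W0 W1 !mulr0 addr0 sub0r oppr_gt0.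
by rewrite -expr2 ltNge sqr_ge0.
Qed.

Lemma chart_inverse x0 (U : set R2) (X : R2 -> R21) (g : R2 -> R2) : open U ->
  (forall u, U u -> S (X u)) -> (forall u, U u -> differentiable X u) ->
  (forall u, U u -> injective ('d X u)) ->
  (\forall x \near x0, [/\ U (g x), X (g x) = sg x & {for x, continuous g}]) ->
  differentiable g x0.
Proof.
move=> oU XS dX inj H; have [Ug Xg gc] := nbhs_singleton H.
apply: (@differentiable_inverse _ (vproj \o X)) => //.
- by apply: differentiable_vproj; exact: dX.
- exact: (chart_det oU Ug XS (dX _ Ug) (@inj _ Ug)).
- by apply: filterS H => y [_ /= -> _]; rewrite sgK.
Qed.

Lemma height_differentiable x : differentiable height x.
Proof.
have [U [X [g [oU smX XS inj H]]]] := local_chart x.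
have dX u : U u -> differentiable X u by move=> Uu; exact: (smX 1).1.
have dg := chart_inverse oU XS dX inj H.
apply: (@differentiable_near _ _ _ (fun y => X (g y) 0 2)).
  by apply: filterS H => y [_ -> _].
apply: (differentiable_entry (f := X \o g)); apply: differentiable_comp => //.
by apply: dX; case: (nbhs_singleton H).
Qed.

Lemma height_derive x v : is_derive x v height (dot (hgrad x) v).
Proof.
have dh := height_differentiable x.
have -> : dot (hgrad x) v = 'D_v height x.
  rewrite /hgrad /dot pt0 pt1 !deriveE // {3}[v]ptE.
  have -> : pt (v 0 0) (v 0 1) = v 0 0 *: pt 1 0 + v 0 1 *: pt 0 1.
    by apply: rv2P; rewrite !mxE /=; ring.
  by rewrite linearD !linearZ /= [_ * v 0 0]mulrC [_ * v 0 1]mulrC.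
by apply/derivableP; exact: diff_derivable.
Qed.

Lemma diff_height x v : 'd height x v = dot (hgrad x) v.
Proof.
rewrite -deriveE; last exact: height_differentiable.
exact: (@derive_val _ _ _ _ _ _ _ (height_derive x v)).
Qed.

Lemma curve_vproj p w c : curve_on S p w c -> [/\ differentiable c (0 : R),
  is_derive (0 : R) (1 : R) (vproj \o c) (vproj w),
  (vproj \o c) 0 = vproj p & differentiable (vproj \o c) (0 : R)].
Proof.
case=> c0 _ dc; have Dc : differentiable c (0 : R).
  by apply/derivable1_diffP; case: dc.
have Dv := differentiable_vproj Dc.
split => //; last by rewrite /= c0.
have -> : vproj w = 'D_1 (vproj \o c) 0.
  by rewrite deriveE // diff_vproj // -deriveE //; case: dc => _ <-.
by apply/derivableP; exact: diff_derivable.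
Qed.

Lemma tangentP p w : S p -> tangent S p w <-> w 0 2 = dot (hgrad (vproj p)) (vproj w).
Proof.
move=> Sp; split=> [[c Hc]|E].
  have [Dc dv v0 Dv] := curve_vproj Hc; case: Hc => c0 cS dc.
  have d1 : is_derive (0 : R) (1 : R) (fun t => c t 0 2) (w 0 2).
    by have /is_derive_row := dc; apply.
  rewrite -(@derive_val _ _ _ _ _ _ _ d1).
  have -> : 'D_1 (fun t : R => c t 0 2) (0 : R) = 'D_1 (height \o (vproj \o c)) (0 : R).
    apply: near_eq_derive.
    by apply: filterS cS => t /graph_height.
  have dh := height_differentiable ((vproj \o c) 0).
  rewrite deriveE; last exact: differentiable_comp.
  rewrite diff_comp //= -diff_height c0; congr ('d _ _ _).
  by rewrite -deriveE //; exact: derive_val.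
exists (fun t : R => gpt height (vproj p + t *: vproj w)); split.
- by rewrite scale0r addr0; apply: rv3P; rewrite !mxE //=; apply/esym/graph_height.
- by apply: filterE => t; apply: (gptS graph_height).
- apply/is_derive_row => i; case: i => [[|[|[|//]]] Hi].
  + rewrite (_ : Ordinal Hi = 0); last exact: val_inj.
    rewrite (_ : (fun _ => _) = (fun t : R => p 0 0 + t * w 0 0)); last first.
      by apply/funext => t; rewrite !mxE.
    exact: is_derive_affine.
  + rewrite (_ : Ordinal Hi = 1); last exact: val_inj.
    rewrite (_ : (fun _ => _) = (fun t : R => p 0 1 + t * w 0 1)); last first.
      by apply/funext => t; rewrite !mxE.
    exact: is_derive_affine.
  + rewrite (_ : Ordinal Hi = 2); last exact: val_inj.
    rewrite (_ : (fun _ => _) = (fun t : R => height (vproj p + t *: vproj w))); last first.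
      by apply/funext => t; rewrite !mxE.
    rewrite E; apply: is_derive_line; rewrite scale0r addr0; exact: height_derive.
Qed.

(** The tangent vector over the gradient, the steepest one, has square n2 - n2^2. *)
Lemma hgrad_lt1 x : sqnorm2 (hgrad x) < 1.
Proof.
have [g0|g0] := eqVneq (hgrad x) 0.
  by rewrite g0 /sqnorm2 !mxE expr0n /= addr0 ltr01.
set n2 := sqnorm2 (hgrad x).
pose w : R21 := \row_(i < 3) [:: hgrad x 0 0; hgrad x 0 1; n2]`_i.
have w0E : w 0 0 = hgrad x 0 0 by rewrite mxE.
have w1E : w 0 1 = hgrad x 0 1 by rewrite mxE.
have w2E : w 0 2 = n2 by rewrite mxE.
have Ew : vproj w = hgrad x by apply: rv2P; rewrite !mxE.
have T : tangent S (sg x) w.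
  by apply/tangentP => //; rewrite Ew sgK mxE /= /n2 /sqnorm2 /dot !expr2.
have w0 : w != 0.
  by apply: contra g0 => /eqP w0; rewrite -Ew w0; apply/eqP/rv2P; rewrite !mxE.
have := slS (sgS x) T w0.
have -> : mink w w = n2 - n2 ^+ 2 by rewrite /mink w0E w1E w2E /n2 /sqnorm2; ring.
have n0 : 0 <= n2 by rewrite addr_ge0 // sqr_ge0.
have [//|n1] := ltP n2 1.
have := ler_wpM2l n0 n1; rewrite mulr1 -expr2; lra.
Qed.

(** Cramer's rule: the partial derivatives [A] and [B] of a chart are tangent, so [tangentP] gives
    two linear equations for the gradient. Locally it is therefore a rational function of the
    entries of [A] and [B], composed with [g]. *)
Lemma hgrad_differentiable x : differentiable hgrad x.
Proof.
have [U [X [g [oU smX XS inj H]]]] := local_chart x.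
have dX u : U u -> differentiable X u by move=> Uu; exact: (smX 1).1.
have dg := chart_inverse oU XS dX inj H.
have [A AE] : exists A, A = 'D_(pt 1 0) X by exact: (ex_intro _ _ erefl).
have [B BE] : exists B, B = 'D_(pt 0 1) X by exact: (ex_intro _ _ erefl).
have dA u : U u -> differentiable A u by move=> Uu; rewrite AE; exact: ((smX 2).2 (pt 1 0)).1.
have dB u : U u -> differentiable B u by move=> Uu; rewrite BE; exact: ((smX 2).2 (pt 0 1)).1.
pose D u := A u 0 0 * B u 0 1 - A u 0 1 * B u 0 0.
have D0 u : U u -> D u != 0.
  move=> Uu; have := chart_det oU Uu XS (dX _ Uu) (@inj _ Uu).
  have JE v i : (v *m 'J (vproj \o X) u) 0 i = (vproj ('d X u v)) 0 i.
    by rewrite -diff_vproj; [rewrite /jacobian mul_rV_lin1|exact: dX].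
  have J0 i : 'J (vproj \o X) u 0 i = (vproj (A u)) 0 i.
    rewrite AE deriveE; last exact: dX.
    by rewrite -JE [RHS]mxE sum_ord2 pt0 pt1 mul1r mul0r addr0.
  have J1 i : 'J (vproj \o X) u 1 i = (vproj (B u)) 0 i.
    rewrite BE deriveE; last exact: dX.
    by rewrite -JE [RHS]mxE sum_ord2 pt0 pt1 mul1r mul0r add0r.
  by rewrite det_mx22 (J0 0) (J0 1) (J1 0) (J1 1) !vproj0 !vproj1.
pose Gm u := pt ((A u 0 2 * B u 0 1 - A u 0 1 * B u 0 2) * (D u)^-1)
                ((A u 0 0 * B u 0 2 - A u 0 2 * B u 0 0) * (D u)^-1).
apply: (@differentiable_near _ _ _ (Gm \o g)).
  apply: filterS H => y [Ugy Xgy _].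
  have Sy := XS _ Ugy.
  have E (v : R2) : ('d X (g y) v) 0 2 = dot (hgrad y) (vproj ('d X (g y) v)).
    have := curve_through v oU Ugy XS (dX _ Ugy) => /(tangentP _ Sy).
    by rewrite Xgy sgK.
  have EA : A (g y) 0 2 = hgrad y 0 0 * A (g y) 0 0 + hgrad y 0 1 * A (g y) 0 1.
    by rewrite AE deriveE; [rewrite E /dot vproj0 vproj1|exact: dX].
  have EB : B (g y) 0 2 = hgrad y 0 0 * B (g y) 0 0 + hgrad y 0 1 * B (g y) 0 1.
    by rewrite BE deriveE; [rewrite E /dot vproj0 vproj1|exact: dX].
  have := D0 _ Ugy; rewrite /= /Gm /D.
  move: (hgrad y) (A _) (B _) EA EB => p Ay By -> -> Dn.
  by apply: rv2P; rewrite ?pt0 ?pt1; field.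
apply: differentiable_comp => //.
have Ugx : U (g x) by case: (nbhs_singleton H).
have eA i := differentiable_entry i (dA _ Ugx).
have eB i := differentiable_entry i (dB _ Ugx).
have dD : differentiable D (g x).
  by apply: differentiableB; apply: differentiableM.
have dDV : differentiable (fun u => (D u)^-1) (g x).
  by apply: differentiableV => //; exact: D0.
apply: differentiable_pt; (apply: differentiableM => //);
  by apply: differentiableB; apply: differentiableM.
Qed.

(** The future unit normal of a graph of gradient [g]: (g, 1) is orthogonal to the tangent plane and
    has Minkowski square -(1 - |g|^2). *)
Definition nu (g : R2) : R21 :=
  (Num.sqrt (1 - sqnorm2 g))^-1 *: \row_(i < 3) [:: g 0 0; g 0 1; 1]`_i.

(** The differential of [nu] at [g] in the direction [k]. *)
Definition dnu (g k : R2) : R21 :=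
  let s := Num.sqrt (1 - sqnorm2 g) in
  \row_(i < 3) [:: k 0 0 / s + g 0 0 * (dot g k / s ^+ 3);
                   k 0 1 / s + g 0 1 * (dot g k / s ^+ 3); dot g k / s ^+ 3]`_i.

Lemma is_derive_nu (c : R -> R2) k t : sqnorm2 (c t) < 1 ->
  is_derive t (1 : R) c k -> is_derive t (1 : R) (nu \o c) (dnu (c t) k).
Proof.
move=> c1 dc; set s := Num.sqrt (1 - sqnorm2 (c t)).
have q0 : 0 < 1 - sqnorm2 (c t) by rewrite subr_gt0.
have s0 : 0 < s by rewrite sqrtr_gt0.
have d0 : is_derive t (1 : R) (fun y => c y 0 0) (k 0 0) by have /is_derive_row := dc; apply.
have d1 : is_derive t (1 : R) (fun y => c y 0 1) (k 0 1) by have /is_derive_row := dc; apply.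
pose q (y : R) := 1 - (c y 0 0 * c y 0 0 + c y 0 1 * c y 0 1).
have qE y : q y = 1 - sqnorm2 (c y) by rewrite /q /sqnorm2 !expr2.
have dq : is_derive t (1 : R) q (- 2 * dot (c t) k).
  rewrite /q; apply: is_derive_eq.
  by rewrite /GRing.scale /= /dot; ring.
have ds : is_derive t (1 : R) (Num.sqrt \o q) (- (dot (c t) k / s)).
  have dq0 : is_derive (q t) (1 : R) Num.sqrt (2 * Num.sqrt (q t))^-1.
    by apply: is_derive1_sqrt; rewrite qE.
  have := is_derive1_comp dq0 dq; rewrite qE -/s => h.
  apply: is_derive_eq; rewrite /GRing.scale /=; field; exact: lt0r_neq0.
have sqn0 : (Num.sqrt \o q) t != 0 by rewrite /= qE lt0r_neq0.
have di : is_derive t (1 : R) (fun y => ((Num.sqrt \o q) y)^-1) (dot (c t) k / s ^+ 3).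
  have := is_deriveV sqn0 ds; rewrite /= qE -/s => h.
  apply: is_derive_eq; rewrite /GRing.scale /=; field; exact: lt0r_neq0.
apply/is_derive_row => i; case: i => [[|[|[|//]]] Hi].
- rewrite (_ : Ordinal Hi = 0); last exact: val_inj.
  rewrite (_ : (fun _ => _) = (fun y => ((Num.sqrt \o q) y)^-1 * c y 0 0)); last first.
    by apply/funext => y; rewrite /= qE !mxE.
  apply: is_derive_eq; rewrite /GRing.scale /= mxE /= qE -/s; ring.
- rewrite (_ : Ordinal Hi = 1); last exact: val_inj.
  rewrite (_ : (fun _ => _) = (fun y => ((Num.sqrt \o q) y)^-1 * c y 0 1)); last first.
    by apply/funext => y; rewrite /= qE !mxE.
  apply: is_derive_eq; rewrite /GRing.scale /= mxE /= qE -/s; ring.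
- rewrite (_ : Ordinal Hi = 2); last exact: val_inj.
  rewrite (_ : (fun _ => _) = (fun y => ((Num.sqrt \o q) y)^-1)); last first.
    by apply/funext => y; rewrite /= qE !mxE /= mulr1.
  by rewrite mxE.
Qed.

Lemma unit_normalE p : S p -> unit_normal S p = nu (hgrad (vproj p)).
Proof.
move=> Sp; set g := hgrad (vproj p).
have q0 : 0 < 1 - sqnorm2 g by rewrite subr_gt0; exact: hgrad_lt1.
set s := Num.sqrt (1 - sqnorm2 g); have s0 : 0 < s by rewrite sqrtr_gt0.
have ss : s ^+ 2 = 1 - sqnorm2 g by rewrite sqr_sqrtr // ltW.
have nu0 : nu g 0 0 = s^-1 * g 0 0 by rewrite !mxE.
have nu1 : nu g 0 1 = s^-1 * g 0 1 by rewrite !mxE.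
have nu2 : nu g 0 2 = s^-1 by rewrite !mxE /= mulr1.
apply: get_unique.
  split.
  - rewrite /mink nu0 nu1 nu2.
    have -> : s^-1 * g 0 0 * (s^-1 * g 0 0) + s^-1 * g 0 1 * (s^-1 * g 0 1) - s^-1 * s^-1
      = - (1 - sqnorm2 g) / s ^+ 2 by rewrite /sqnorm2; field; exact: lt0r_neq0.
    by rewrite -ss mulNr divff // expf_neq0 // lt0r_neq0.
  - by rewrite nu2 invr_gt0.
  - move=> v /(tangentP _ Sp) vE; rewrite /mink nu0 nu1 nu2 vE -/g /dot.
    by rewrite [vproj v 0 0]mxE [vproj v 0 1]mxE /=; ring.
move=> n [nn n2 nT].
(* Tangent vectors over the two axes; orthogonality to them makes [n] a multiple of (g, 1). *)
pose e0 : R21 := \row_(i < 3) [:: 1; 0; g 0 0]`_i.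
pose e1 : R21 := \row_(i < 3) [:: 0; 1; g 0 1]`_i.
have e00 : e0 0 0 = 1 by rewrite mxE.
have e01 : e0 0 1 = 0 by rewrite mxE.
have e02 : e0 0 2 = g 0 0 by rewrite mxE.
have e10 : e1 0 0 = 0 by rewrite mxE.
have e11 : e1 0 1 = 1 by rewrite mxE.
have e12 : e1 0 2 = g 0 1 by rewrite mxE.
have T0 : tangent S p e0.
  by apply/tangentP => //; rewrite e02 -/g /dot ![vproj _ _ _]mxE /= e00 e01; ring.
have T1 : tangent S p e1.
  by apply/tangentP => //; rewrite e12 -/g /dot ![vproj _ _ _]mxE /= e10 e11; ring.
have := nT _ T0; rewrite /mink e00 e01 e02 => N0.
have := nT _ T1; rewrite /mink e10 e11 e12 => N1.
have n0E : n 0 0 = n 0 2 * g 0 0 by lra.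
have n1E : n 0 1 = n 0 2 * g 0 1 by lra.
have n2E : n 0 2 = s^-1.
  have : (n 0 2 * s) ^+ 2 = 1 ^+ 2.
    rewrite exprMn ss; move: nn; rewrite /mink n0E n1E /sqnorm2; lra.
  move/eqP; rewrite eqrXn2 // ?mulr_ge0 ?ltW // => /eqP h.
  by rewrite -[RHS]mul1r -h mulfK // lt0r_neq0.
by apply: rv3P; rewrite ?nu0 ?nu1 ?nu2 ?n0E ?n1E n2E.
Qed.

(** Every curve with velocity [w] gives the same derivative, so the choice made by [get] is
    determined. *)
Lemma shape_opE p w : S p -> tangent S p w ->
  shape_op S p w = dnu (hgrad (vproj p)) ('d hgrad (vproj p) (vproj w)).
Proof.
move=> Sp Tw; have H c : curve_on S p w c ->
    is_derive (0 : R) (1 : R) (unit_normal S \o c)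
      (dnu (hgrad (vproj p)) ('d hgrad (vproj p) (vproj w))).
  move=> Hc; have [Dc dv v0 Dv] := curve_vproj Hc; case: Hc => c0 cS dc.
  apply: (@near_eq_is_derive _ _ _ (nu \o (hgrad \o (vproj \o c)))).
    by apply: filterS cS => t St /=; rewrite unit_normalE.
  have dh := hgrad_differentiable ((vproj \o c) 0).
  have dhc : is_derive (0 : R) (1 : R) (hgrad \o (vproj \o c))
      ('d hgrad (vproj p) (vproj w)).
    have -> : 'd hgrad (vproj p) (vproj w) = 'D_1 (hgrad \o (vproj \o c)) (0 : R).
      rewrite deriveE; last exact: differentiable_comp.
      rewrite diff_comp //= c0; congr ('d _ _ _).
      by rewrite -deriveE //; apply/esym; exact: derive_val.
    by apply/derivableP/diff_derivable; exact: differentiable_comp.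
  have := @is_derive_nu _ _ _ _ dhc; rewrite /= c0; apply.
  exact: hgrad_lt1.
case: Tw => c Hc; apply: get_unique; first by exists c => //; exact: H.
move=> y [c' Hc' dy].
have := H _ Hc' => dy'.
by rewrite -(@derive_val _ _ _ _ _ _ _ dy) (@derive_val _ _ _ _ _ _ _ dy').
Qed.

(** The rows lift the two coordinate vectors of the plane to the tangent plane of a graph of
    gradient [g]. *)
Definition frame_mx (g : R2) : 'M[R]_(2, 3) :=
  \matrix_(i < 2, j < 3) [:: (i == 0)%:R; (i == 1)%:R; g 0 i]`_j.

Definition proj_mx3 : 'M[R]_(3, 2) := \matrix_(i < 3, j < 2) (i == j :> nat)%:R.

Lemma vproj_mul v : vproj v = v *m proj_mx3.
Proof.
by apply: rv2P; rewrite !mxE !big_ord_recl big_ord0 !mxE /= ?mulr1 ?mulr0 ?addr0 ?add0r;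
  congr (v _ _); exact: val_inj.
Qed.

Lemma frame_mulE g (v : R2) :
  [/\ (v *m frame_mx g) 0 0 = v 0 0, (v *m frame_mx g) 0 1 = v 0 1 &
      (v *m frame_mx g) 0 2 = dot g v].
Proof.
by split; rewrite mxE sum_ord2 !mxE /= ?mulr1 ?mulr0 ?addr0 ?add0r // /dot; ring.
Qed.

Lemma vproj_frame g (v : R2) : vproj (v *m frame_mx g) = v.
Proof. by have [h0 h1 _] := frame_mulE g v; apply: rv2P; rewrite [LHS]mxE. Qed.

(** The matrix of [dnu g] from the plane to the basis [frame_mx g] of the tangent plane. *)
Definition dnu_mx (g : R2) : 'M[R]_2 :=
  let s := Num.sqrt (1 - sqnorm2 g) in
  \matrix_(i < 2, j < 2) ((i == j)%:R / s + g 0 i * g 0 j / s ^+ 3).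

Lemma dnuE g k : sqnorm2 g < 1 -> dnu g k = k *m dnu_mx g *m frame_mx g.
Proof.
move=> g1; have q0 : 0 < 1 - sqnorm2 g by rewrite subr_gt0.
rewrite /dnu /dnu_mx; set s := Num.sqrt (1 - sqnorm2 g); set M := (X in k *m X).
have s0 : 0 < s by rewrite sqrtr_gt0.
have ss : s ^+ 2 = 1 - sqnorm2 g by rewrite sqr_sqrtr // ltW.
have sn0 : s != 0 by exact: lt0r_neq0.
have [h0 h1 h2] := frame_mulE g (k *m M).
have b0 : (k *m M) 0 0 = k 0 0 / s + g 0 0 * (dot g k / s ^+ 3).
  by rewrite mxE sum_ord2 !mxE /= /dot; ring.
have b1 : (k *m M) 0 1 = k 0 1 / s + g 0 1 * (dot g k / s ^+ 3).
  by rewrite mxE sum_ord2 !mxE /= /dot; ring.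
apply: rv3P; rewrite ?h0 ?h1 ?h2 ?b0 ?b1 mxE //=.
have -> : dot g k / s ^+ 3 = dot g k * (s ^+ 2 + sqnorm2 g) / s ^+ 3.
  by rewrite ss subrK mulr1.
by rewrite {2}/dot b0 b1 /sqnorm2 /dot; field.
Qed.

(** The eigenvalues are 1/s orthogonally to [g] and 1/s + |g|^2/s^3 = 1/s^3 along [g], because s^2 +
    |g|^2 = 1. *)
Lemma det_dnu_mx g : sqnorm2 g < 1 -> \det (dnu_mx g) = ((1 - sqnorm2 g) ^+ 2)^-1.
Proof.
move=> g1; have q0 : 0 < 1 - sqnorm2 g by rewrite subr_gt0.
rewrite det_mx22 !mxE /=; set s := Num.sqrt (1 - sqnorm2 g).
have s0 : 0 < s by rewrite sqrtr_gt0.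
have ss : s ^+ 2 = 1 - sqnorm2 g by rewrite sqr_sqrtr // ltW.
have sn0 : s != 0 by exact: lt0r_neq0.
have -> : ((1 - sqnorm2 g) ^+ 2)^-1 = (s ^+ 2 + sqnorm2 g) / s ^+ 4.
  by rewrite ss subrK mul1r -ss -exprM.
by rewrite /sqnorm2; field.
Qed.

Lemma tangent_frame p v : S p ->
  tangent S p v <-> v = vproj v *m frame_mx (hgrad (vproj p)).
Proof.
move=> Sp; rewrite tangentP //; set g := hgrad _.
have [h0 h1 h2] := frame_mulE g (vproj v).
split=> [E|->]; last by rewrite vproj_frame; have [] := frame_mulE g (vproj v).
by apply: rv3P; rewrite ?h0 ?h1 ?h2 // mxE.
Qed.

Lemma tangent_basisP p : S p -> row_free (tangent_basis S p) /\
  forall v, tangent S p v <-> (v <= tangent_basis S p)%MS.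
Proof.
move=> Sp; set g := hgrad (vproj p).
suff : exists E : 'M[R]_(2, 3), row_free E /\ forall v, tangent S p v <-> (v <= E)%MS.
  exact: getPex.
exists (frame_mx g); split.
  apply/row_freeP; exists proj_mx3; apply/row_matrixP => i.
  by rewrite row_mul -vproj_mul -[frame_mx g]mul1mx row_mul vproj_frame.
move=> v; rewrite tangent_frame // -/g; split=> [->|/submxP[D ->]].
  exact: submxMl.
by rewrite vproj_frame.
Qed.

(** The basis chosen by [tangent_basis] is unspecified, but it is an invertible [A] times the frame.
    Hence the shape matrix is conjugate by [A] to the Jacobian of [hgrad] times [dnu_mx], and the
    determinant does not see [A]. *)
Lemma gauss_curvE p : S p -> gauss_curv S p =
  \det ('J hgrad (vproj p)) / (1 - sqnorm2 (hgrad (vproj p))) ^+ 2.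
Proof.
move=> Sp; rewrite /gauss_curv /shape_mx.
have [Efree ET] := tangent_basisP Sp.
set E := tangent_basis S p in Efree ET *; set g := hgrad (vproj p).
set K := 'J hgrad (vproj p).
have q0 : 1 - sqnorm2 g != 0 by rewrite lt0r_neq0 // subr_gt0; exact: hgrad_lt1.
set A := E *m proj_mx3.
have rowT i : tangent S p (row i E) by apply/ET; exact: row_sub.
have EA : E = A *m frame_mx g.
  apply/row_matrixP => i; rewrite row_mul /A row_mul -vproj_mul.
  by apply/tangent_frame.
have Au : A \in unitmx.
  rewrite -row_free_unit /row_free eqn_leq rank_leq_row /=.
  by move: Efree; rewrite /row_free {1}EA => /eqP {1}<-; exact: mxrankM_maxl.
have -> : \matrix_(i < 2) shape_op S p (row i E) = A *m K *m dnu_mx g *m frame_mx g.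
  apply/row_matrixP => i; rewrite rowK shape_opE // dnuE ?hgrad_lt1 // /A !row_mul (vproj_mul (row i E)).
  have dE : 'd hgrad (vproj p) (row i E *m proj_mx3) = row i E *m proj_mx3 *m K.
    by rewrite /K /jacobian mul_rV_lin1.
  by rewrite dE.
have -> : frame_mx g = invmx A *m E by rewrite EA mulKmx.
rewrite -mulmxA mulmxKp // !det_mulmx det_inv.
rewrite det_dnu_mx; last exact: hgrad_lt1.
have dA : \det A != 0 by rewrite -unitfE -unitmxE.
by field; rewrite q0 dA.
Qed.

End SurfaceGraph.

(* The second order lower expansion of [w] at [y], which suffices for a function
   touching [u] from below. *)
Definition below2 {R : realType} (w : 'rV[R]_2 -> R) (y xh : 'rV[R]_2) (A B C : R) :=
  forall e, 0 < e -> exists2 d, 0 < d & forall z, `|z| < d ->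
    w y + dot xh z + qform A B C z / 2 - e * `|z| ^+ 2 <= w (y + z).

(** * Comparison principle for the support function *)

Section Comparison.
Context {R : realType}.
Local Notation R2 := 'rV[R]_2.
Context (S : set 'rV[R]_3) (f : R2 -> R) (G : R2 -> R2) (a : R).
Context (gS : forall p, S p <-> p 0 2 = f (vproj p)).
Context (fG : forall x v, is_derive x v f (dot (G x) v)).
Context (dG : forall x, differentiable G x).
Context (fconv : forall x y (t : R), 0 <= t <= 1 ->
  f ((1 - t) *: x + t *: y) <= (1 - t) * f x + t * f y).
Context (a0 : 0 < a) (G1 : forall x, sqnorm2 (G x) < 1).
Context (aG : forall x, a * (1 - sqnorm2 (G x)) ^+ 2 <= \det ('J G x)).
Local Notation u := (support_fun S).

Lemma dot_continuous (x : R2) : continuous (dot x).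
Proof.
move=> y; apply: differentiable_continuous.
by apply: differentiableD; apply: differentiableM => //; exact: differentiable_coord.
Qed.

(** [u] is a supremum of continuous functions, each giving an open condition. The margin [e] is
    there for [compact_near_coveringP], which makes it uniform over a compact set. *)
Lemma supp_lsc (g : R2 -> R) (y : R2) : {for y, continuous g} -> ((g y)%:E < u y)%E ->
  \forall y' \near y & e \near (0 : R)^'+, ((e + g y')%:E < u y')%E.
Proof.
move=> gc /(supp_gt gS)[x Hx].
pose m := dot x y - f x - g y; have m0 : 0 < m by rewrite /m; lra.
have m2 : 0 < m / 4 by rewrite divr_gt0.
near=> y' e => /=.
apply: lt_le_trans (supp_ge gS x y'); rewrite lte_fin.
have h1 : `|g y - g y'| < m / 4.
  by near: y'; move/cvgrPdist_lt : gc; apply.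
have h2 : `|dot x y - dot x y'| < m / 4.
  by near: y'; have /cvgrPdist_lt := @dot_continuous x y; apply.
have h3 : e < m / 4 by near: e; exact: nbhs_right_lt.
move: h1 h2; rewrite !ltr_norml => /andP[p1 p2] /andP[p3 p4].
rewrite /m in p1 p2 p3 p4 h3; lra.
Unshelve. all: by end_near. Qed.

Lemma supp_fin_le y c : (u y <= c%:E)%E -> exists2 v, u y = v%:E & v <= c.
Proof.
move=> uc; have : u y \is a fin_num by rewrite (supp_finE gS) (le_lt_trans uc) // ltry.
by move=> /fineK E; exists (fine (u y)); rewrite ?E // -lee_fin E.
Qed.

Lemma supp_lb y : ((- f 0)%:E <= u y)%E.
Proof.
have := supp_ge gS 0 y; suff -> : dot 0 y = 0 by rewrite sub0r.
by rewrite /dot !mxE; ring.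
Qed.

(** The infimum of u - w is taken over real r with u <= r + w at some point of [K], so infinite
    values do not interfere. Were it not attained, compactness would give a uniform margin [e] and
    hence a larger lower bound. *)
Lemma supp_min (K : set R2) (w : R2 -> R) y0 : compact K ->
  (forall y, K y -> {for y, continuous w}) -> K y0 -> (u y0 < (w y0)%:E)%E ->
  exists ys uy, [/\ K ys, u ys = uy%:E, uy < w ys &
    forall y, K y -> ((uy - w ys + w y)%:E <= u y)%E].
Proof.
move=> cK wc Ky0 uw0.
have [r0 ur0 r0w] : exists2 v, u y0 = v%:E & v < w y0.
  have [v uv _] := supp_fin_le (ltW uw0); exists v => //.
  by move: uw0; rewrite uv lte_fin.
pose I := [set r | exists2 y, K y & (u y <= (r + w y)%:E)%E].
have I0 : I (r0 - w y0) by exists y0 => //; rewrite ur0 subrK.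
have [M HM] : exists M, forall y, K y -> w y <= M.
  have wK : {within K, continuous w} by apply: continuous_in_subspaceT => y /set_mem; exact: wc.
  have K0 : K !=set0 by exists y0.
  have [c _ Hc] := compact_EVT_max K0 cK wK.
  by exists (w c) => y Ky; apply: Hc; exact: mem_set.
have Ilb : has_inf I.
  split; first by exists (r0 - w y0).
  exists (- f 0 - M) => r [y Ky uy].
  have := le_trans (supp_lb y) uy; rewrite lee_fin.
  have := HM y Ky; lra.
pose c := inf I.
have [ys Kys uys] : exists2 ys, K ys & (u ys <= (c + w ys)%:E)%E.
  apply: contrapT => H.
  have H' y : K y -> ((c + w y)%:E < u y)%E.
    by move=> Ky; rewrite ltNge; apply/negP => uy; apply: H; exists y.
  have /compact_near_coveringP cov := cK.
  have cov2 : \forall e \near (0 : R)^'+, K `<=` (fun y => ((e + (c + w y))%:E < u y)%E).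
    apply: cov => y Ky.
    have cw : {for y, continuous (fun y' => c + w y')}.
      by apply: (@continuousD _ _ _ (cst c) w); [exact: cst_continuous|exact: wc].
    exact: (supp_lsc cw (H' y Ky)).
  near (0 : R)^'+ => e.
  have e0 : 0 < e by near: e; exact: nbhs_right_gt.
  have Ke : K `<=` (fun y => ((e + (c + w y))%:E < u y)%E) by near: e.
  have : c + e <= inf I.
    apply: lb_le_inf; first by exists (r0 - w y0).
    move=> r [y Ky uy]; have := lt_le_trans (Ke y Ky) uy; rewrite lte_fin; lra.
  by rewrite -/c; lra.
have [uy uyE uyc] := supp_fin_le uys.
have cI r : I r -> c <= r by move=> Ir; exact: (ge_inf Ilb.2).
exists ys, uy; split => //.
  have := cI _ I0; lra.
move=> y Ky; rewrite leNgt; apply/negP => H.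
have [v vE _] := supp_fin_le (ltW H).
have := cI (v - w y); have := H; rewrite vE lte_fin => h h2.
have : c <= v - w y by apply: h2; exists y => //; rewrite vE subrK.
lra.
Unshelve. all: by end_near. Qed.

(** At a negative minimum of u - w, [touch_det] bounds the product of the two Hessian determinants
    by 1, against the strict inequality assumed of [w] and the bound [aG]. A side of [K] beyond
    which [u] is infinite counts as interior, since the lower expansion is trivial there. *)
Lemma comparison (K : set R2) (w : R2 -> R) y0 : compact K ->
  (forall y, K y -> {for y, continuous w}) -> K y0 ->
  (forall y, K y -> (u y < (w y)%:E)%E ->
     (\forall y' \near y, K y' \/ u y' = +oo%E) /\
     exists xh A B C, [/\ 0 < A, 0 < A * C - B ^+ 2,
       1 < (A * C - B ^+ 2) * (a * (1 - sqnorm2 y) ^+ 2) & below2 w y xh A B C]) ->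
  ((w y0)%:E <= u y0)%E.
Proof.
move=> cK wc Ky0 H; rewrite leNgt; apply/negP => uw0.
have [y [uy [Ky uyE uyw Kmin]]] := supp_min cK wc Ky0 uw0.
have uy1 : (u y < (w y)%:E)%E by rewrite uyE lte_fin.
have [Knear [xh [A [B [C [A0 D0 D1 low]]]]]] := H y Ky uy1.
have below : forall e : R, 0 < e -> exists2 d : R, 0 < d & forall z : R2, `|z| < d ->
    ((uy + dot xh z + qform A B C z / 2 - e * `|z| ^+ 2)%:E <= u (y + z)%R)%E.
  move=> e e0; have [d d0 Hd] := low e e0.
  have [d' /= d'0 Hd'] := (nbhs_ballP _ _).1 Knear.
  exists (Num.min d d'); first by rewrite lt_min d0.
  move=> z; rewrite lt_min => /andP[zd zd'].
  have /Hd' [Kz|->] : ball y d' (y + z).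
  - by rewrite -ball_normE /= opprD addrA subrr sub0r normrN.
  - apply: le_trans (Kmin _ Kz); rewrite lee_fin; have := Hd z zd; lra.
  - exact: leey.
have yG : y = G xh by apply: (touch_grad gS fG dG fconv A0 D0 uyE below).
have det0 : 0 < \det ('J G xh).
  by apply: lt_le_trans (aG xh); rewrite mulr_gt0 // exprn_gt0 // subr_gt0.
have := touch_det gS fG dG fconv A0 D0 uyE below det0.
apply/negP; rewrite -ltNge; apply: lt_le_trans D1 _.
by rewrite ler_pM2l // yG.
Qed.

End Comparison.

(** * A second order upper bound for the square root *)

Section SqrtTaylor.
Context {R : realType}.

(** By squaring: the term in [e] contributes 2 p0 e x^2 to the square of the right side, which beats
    the cubic remainder for small [x]. *)
Lemma sqrt_upper (P0 e : R) : 0 < P0 -> 0 < e ->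
  let p0 := Num.sqrt P0 in
  \forall x \near (0 : R),
    Num.sqrt (P0 + x) <= p0 + x / (2 * p0) - x ^+ 2 / (8 * p0 ^+ 3) + e * x ^+ 2.
Proof.
move=> P00 e0 p0; have p00 : 0 < p0 by rewrite sqrtr_gt0.
have pn0 : p0 != 0 by exact: lt0r_neq0.
have pp : P0 = p0 ^+ 2 by rewrite sqr_sqrtr // ltW.
pose k := (8 * p0 ^+ 3)^-1 - e.
have k1 : 0 < `|k| + 1 by rewrite ltr_wpDl.
have N (d : R) : 0 < d -> \forall x \near (0 : R), `|x| < d.
  move=> d0; apply/nbhs_ballP; exists d => // x.
  by rewrite -ball_normE /= sub0r normrN.
near=> x.
have x1 : `|x| < p0 ^+ 2 by near: x; apply: N; rewrite exprn_gt0.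
have : `|x| < 2 * p0 ^+ 2 * e / (`|k| + 1).
  by near: x; apply: N; rewrite divr_gt0 // !mulr_gt0 // exprn_gt0.
rewrite ltr_pdivlMr // => x2.
have : `|x| < 1 / (4 * p0 * e).
  by near: x; apply: N; rewrite divr_gt0 // !mulr_gt0.
rewrite ltr_pdivlMr ?mulr_gt0 // => x3.
have -> : p0 + x / (2 * p0) - x ^+ 2 / (8 * p0 ^+ 3) + e * x ^+ 2 =
  p0 + x / (2 * p0) - k * x ^+ 2 by rewrite /k; field.
have xl : - `|x| <= x by exact: lerNnormlW.
have kx : `|k * x| <= 2 * p0 ^+ 2 * e.
  by rewrite normrM mulrC; have := normr_ge0 x; lra.
have kx2 : `|k * x ^+ 2| <= p0 / 2.
  rewrite expr2 mulrA normrM; have := ler_wpM2r (normr_ge0 x) kx.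
  have := ler_wpM2l (ltW p00) (ltW x3); lra.
have r0 : 0 <= p0 + x / (2 * p0) - k * x ^+ 2.
  have : - (p0 / 2) <= x / (2 * p0).
    rewrite ler_pdivlMr ?mulr_gt0 //; lra.
  have := ler_norm (k * x ^+ 2); lra.
rewrite -[leRHS]ger0_norm // -sqrtr_sqr; apply: ler_wsqrtr.
have E : (p0 + x / (2 * p0) - k * x ^+ 2) ^+ 2 - (P0 + x) =
  x ^+ 2 / p0 * (2 * p0 ^+ 2 * e - k * x) + (k * x ^+ 2) ^+ 2.
  by rewrite pp /k; field.
rewrite -subr_ge0 E addr_ge0 ?sqr_ge0 // mulr_ge0 ?divr_ge0 ?sqr_ge0 ?(ltW p00) //.
by rewrite subr_ge0; apply: le_trans kx; exact: ler_norm.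
Unshelve. all: by end_near. Qed.

End SqrtTaylor.

(** * Barriers *)

Section Barriers.
Context {R : realType}.
Local Notation R2 := 'rV[R]_2.

Lemma near0_norm (d : R) : 0 < d -> \forall z \near (0 : R2), `|z| < d.
Proof.
move=> d0; apply/nbhs_ballP; exists d => // x.
by rewrite -ball_normE /= sub0r normrN.
Qed.

Lemma near0_ball (P : R2 -> Prop) : (\forall z \near (0 : R2), P z) ->
  exists2 d : R, 0 < d & forall z, `|z| < d -> P z.
Proof.
move=> /nbhs_ballP[d d0 Hd]; exists d => // z zd; apply: Hd.
by rewrite -ball_normE /= sub0r normrN.
Qed.

Section Expansion.
Context (L N : R2 -> R) (c Q0 : R).
Context (Lc : forall z, `|L z| <= c * `|z|) (Nc : forall z, `|N z| <= c * `|z| ^+ 2).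
Context (c0 : 0 < c) (Q00 : 0 < Q0).
Let q0 := Num.sqrt Q0.
Let q00 : 0 < q0. Proof. by rewrite sqrtr_gt0. Qed.

Lemma LN_small (e : R) : 0 < e -> \forall z \near (0 : R2), `|L z + N z| < e.
Proof.
move=> e0; near=> z.
have z1 : `|z| < 1 by near: z; exact: near0_norm.
have : `|z| < e / (2 * c) by near: z; apply: near0_norm; rewrite divr_gt0 // mulr_gt0.
rewrite ltr_pdivlMr ?mulr_gt0 // => z2.
have zz : `|z| ^+ 2 <= `|z| by rewrite expr2 ler_piMl // ltW.
have := ler_wpM2l (ltW c0) zz; have := Lc z; have := Nc z.
have := ler_normD (L z) (N z); lra.
Unshelve. all: by end_near. Qed.

(** [L] and [N] are the first and second order parts of the increment of the radicand. In the
    squared term only [L] survives: the square of [N] has a favourable sign and the cross term is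
    cubic. *)
Lemma sqrt_upper2 (e : R) : 0 < e -> \forall z \near (0 : R2),
  Num.sqrt (Q0 + (L z + N z)) <=
    q0 + L z / (2 * q0) + (N z / (2 * q0) - L z ^+ 2 / (8 * q0 ^+ 3)) + e * `|z| ^+ 2.
Proof.
move=> e0; set e1 := e / (8 * c ^+ 2).
have cc : 0 < c ^+ 2 by rewrite exprn_gt0.
have e10 : 0 < e1 by rewrite divr_gt0 // mulr_gt0.
have q3 : 0 < q0 ^+ 3 by rewrite exprn_gt0.
have /nbhs_ballP[d d0 Hd] := sqrt_upper Q00 e10.
near=> z.
have z1 : `|z| < 1 by near: z; exact: near0_norm.
have : `|z| < 2 * q0 ^+ 3 * e / c ^+ 2.
  by near: z; apply: near0_norm; rewrite divr_gt0 // !mulr_gt0.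
rewrite ltr_pdivlMr // => z2.
have xd : `|L z + N z| < d by near: z; exact: LN_small.
have := Hd (L z + N z); rewrite -ball_normE /= sub0r normrN => /(_ xd).
move=> H; apply: (le_trans H); rewrite -/q0.
set T := `|z|; have T0 : 0 <= T by exact: normr_ge0.
have LN : - (2 * (c ^+ 2 * T ^+ 3)) <= 2 * (L z * N z).
  have : `|L z * N z| <= c * T * (c * T ^+ 2) by rewrite normrM ler_pM.
  by rewrite ler_norml => /andP[h _]; lra.
have xx : (L z + N z) ^+ 2 <= 4 * c ^+ 2 * T ^+ 2.
  have : `|L z + N z| <= 2 * c * T.
    have zz : T ^+ 2 <= T by rewrite expr2 ler_piMl // ltW.
    have := ler_wpM2l (ltW c0) zz; have := Lc z; have := Nc z.
    have := ler_normD (L z) (N z); rewrite -/T; lra.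
  rewrite -(ler_pXn2r (n := 2)) // ?nnegrE ?mulr_ge0 ?(ltW c0) // real_normK ?num_real //.
  by move=> h; apply: le_trans h _; rewrite !exprMn; lra.
have N2 := sqr_ge0 (N z).
have i8 : 0 < (8 * q0 ^+ 3)^-1 by rewrite invr_gt0 mulr_gt0.
have A1 : e1 * (L z + N z) ^+ 2 <= e / 2 * T ^+ 2.
  apply: le_trans (ler_wpM2l (ltW e10) xx) _.
  have -> : e1 * (4 * c ^+ 2 * T ^+ 2) = e / 2 * T ^+ 2; last by [].
  by rewrite /e1; field; exact: lt0r_neq0.
have A2 : (L z ^+ 2 - (L z + N z) ^+ 2) / (8 * q0 ^+ 3) <= e / 2 * T ^+ 2.
  rewrite ler_pdivrMr ?mulr_gt0 //.
  have : T ^+ 2 * (T * c ^+ 2) <= T ^+ 2 * (2 * q0 ^+ 3 * e).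
    by apply: ler_wpM2l; [rewrite exprn_ge0|exact: ltW].
  lra.
have -> : (L z + N z) / (2 * q0) = L z / (2 * q0) + N z / (2 * q0) by rewrite mulrDl.
rewrite mulrBl in A2; lra.
Unshelve. all: by end_near. Qed.

(* Obtained from [h^2 / q >= 2 nu h - nu^2 q] with [nu] the first order expansion of
   [h / q], so that only the upper bound [sqrt_upper2] of [q] is needed. *)
Lemma persp_lower (eta : R2 -> R) (h0 del B : R) :
  (forall z, `|eta z| <= c * `|z|) -> 0 < del -> 0 < B ->
  let lam := h0 / q0 in
  forall e : R, 0 < e -> \forall z \near (0 : R2),
  (- del * q0 + B * h0 ^+ 2 / q0) +
  (2 * B * lam * eta z - (del + B * lam ^+ 2) * (L z / (2 * q0))) +
  ((del + B * lam ^+ 2) * (L z ^+ 2 / (8 * q0 ^+ 3) - N z / (2 * q0))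
   + B * (eta z - lam * (L z / (2 * q0))) ^+ 2 / q0) - e * `|z| ^+ 2
  <= - del * Num.sqrt (Q0 + (L z + N z))
     + B * (h0 + eta z) ^+ 2 / Num.sqrt (Q0 + (L z + N z)).
Proof.
move=> etac del0 B0 lam e e0.
have q0n : q0 != 0 by exact: lt0r_neq0.
have h0E : h0 = lam * q0 by rewrite /lam divfK.
clearbody lam.
pose k3 := c / (2 * q0); pose k2 := c / (2 * q0) + c ^+ 2 / (8 * q0 ^+ 3).
pose k1 := (c + `|lam| * k3) / q0.
have cg := ltW c0; have qg := ltW q00; have Bg := ltW B0; have dg := ltW del0.
have q3g : 0 <= 8 * q0 ^+ 3 by rewrite mulr_ge0 // exprn_ge0.
have k30 : 0 <= k3 by rewrite divr_ge0 // mulr_ge0.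
have k20 : 0 <= k2 by rewrite addr_ge0 // divr_ge0 // ?mulr_ge0 // exprn_ge0.
have k10 : 0 <= k1 by rewrite divr_ge0 // addr_ge0 // mulr_ge0.
(* [M] bounds the coefficient [del + B * nu ^+ 2] of the root, and [K] the terms of degree three and
   more. *)
pose M := del + B * (`|lam| + k1) ^+ 2.
have M0 : 0 < M by rewrite ltr_pwDl // mulr_ge0 // exprn_ge0 // addr_ge0.
pose K := 2 * B * `|lam| * k1 * k2 + B * k1 ^+ 2 * (k3 + k2).
have K0 : 0 <= K.
  apply: addr_ge0; first by do 4 (apply: mulr_ge0 => //).
  by apply: mulr_ge0; [apply: mulr_ge0 => //; rewrite exprn_ge0|rewrite addr_ge0].
pose e1 := e / (2 * M); have e10 : 0 < e1 by rewrite divr_gt0 // mulr_gt0.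
have K1 : 0 < 2 * (K + 1) by rewrite mulr_gt0 // ltr_wpDl.
near=> z.
have z1 : `|z| < 1 by near: z; exact: near0_norm.
have : `|z| < e / (2 * (K + 1)) by near: z; apply: near0_norm; rewrite divr_gt0.
rewrite ltr_pdivlMr // => z2.
have sq : Num.sqrt (Q0 + (L z + N z)) <=
    q0 + L z / (2 * q0) + (N z / (2 * q0) - L z ^+ 2 / (8 * q0 ^+ 3)) + e1 * `|z| ^+ 2.
  by near: z; exact: sqrt_upper2.
have qp : 0 < Num.sqrt (Q0 + (L z + N z)).
  have : `|L z + N z| < Q0 by near: z; exact: LN_small.
  by rewrite ltr_norml sqrtr_gt0 => /andP[h _]; lra.
move: sq qp; set q' := Num.sqrt _; set T := `|z|.
have T0 : 0 <= T by exact: normr_ge0.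
set l := L z / (2 * q0); set q2 := _ - _; set et := eta z => sq qp.
have hl : `|l| <= k3 * T.
  rewrite /l normrM normfV (gtr0_norm (x := 2 * q0)) ?mulr_gt0 //.
  rewrite /k3 mulrAC ler_pM2r ?invr_gt0 ?mulr_gt0 //; exact: Lc.
have hq2 : `|q2| <= k2 * T ^+ 2.
  rewrite /q2; apply: (le_trans (ler_normB _ _)); rewrite /k2 [X in _ <= X]mulrDl; apply: lerD.
    rewrite normrM normfV (gtr0_norm (x := 2 * q0)) ?mulr_gt0 //.
    rewrite mulrAC ler_pM2r ?invr_gt0 ?mulr_gt0 //; exact: Nc.
  have q3 : 0 < 8 * q0 ^+ 3 by rewrite mulr_gt0 // exprn_gt0.
  rewrite normrM normfV (gtr0_norm q3) mulrAC ler_pM2r ?invr_gt0 //.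
  rewrite normrX -exprMn lerXn2r ?nnegrE ?mulr_ge0 ?(ltW c0) //; exact: Lc.
pose mu := (et - lam * l) / q0.
have hmu : `|mu| <= k1 * T.
  rewrite /mu normrM normfV (gtr0_norm q00) /k1 [X in _ <= X]mulrAC ler_pM2r ?invr_gt0 //.
  apply: (le_trans (ler_normB _ _)); rewrite normrM [X in _ <= X]mulrDl; apply: lerD; first exact: etac.
  by rewrite -mulrA ler_wpM2l.
have etE : et = mu * q0 + lam * l by rewrite /mu divfK // subrK.
clearbody mu.
pose nu := lam + mu.
have hnu : nu ^+ 2 <= (`|lam| + k1) ^+ 2.
  rewrite -[nu ^+ 2]real_normK ?num_real // lerXn2r ?nnegrE ?addr_ge0 //.
  apply: (le_trans (ler_normD _ _)); rewrite lerD2l; apply: (le_trans hmu).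
  by rewrite ler_piMr // ltW.
have persp : 2 * nu * (h0 + et) - nu ^+ 2 * q' <= (h0 + et) ^+ 2 / q'.
  rewrite ler_pdivlMr // -subr_ge0.
  have -> : (h0 + et) ^+ 2 - (2 * nu * (h0 + et) - nu ^+ 2 * q') * q' =
    (h0 + et - nu * q') ^+ 2 by ring.
  exact: sqr_ge0.
have S1 : 2 * B * nu * (h0 + et) - (del + B * nu ^+ 2) * q' <=
    - del * q' + B * (h0 + et) ^+ 2 / q'.
  by have := ler_wpM2l (ltW B0) persp; rewrite [B * (_ / _)]mulrA; lra.
apply: le_trans S1.
have c1 : 0 <= del + B * nu ^+ 2 by rewrite addr_ge0 ?(ltW del0) // mulr_ge0 ?sqr_ge0 ?ltW.
have S2 := ler_wpM2l c1 sq.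
have c1M : del + B * nu ^+ 2 <= M by rewrite /M lerD2l ler_wpM2l // ltW.
have S3 : (del + B * nu ^+ 2) * (e1 * T ^+ 2) <= e / 2 * T ^+ 2.
  apply: le_trans (ler_wpM2r (_ : 0 <= e1 * T ^+ 2) c1M) _.
    by rewrite mulr_ge0 ?exprn_ge0 // ltW.
  have -> : M * (e1 * T ^+ 2) = e / 2 * T ^+ 2; last by [].
  by rewrite /e1; field; exact: lt0r_neq0.
have R1 : 2 * B * lam * mu * q2 + B * mu ^+ 2 * (l + q2) <= e / 2 * T ^+ 2.
  apply: (le_trans (ler_norm _)); apply: le_trans (_ : K * T * T ^+ 2 <= _); last first.
    rewrite ler_wpM2r ?exprn_ge0 //; move: z2; rewrite -/T; lra.
  have p1 : `|2 * B * lam * mu * q2| <= 2 * B * `|lam| * k1 * k2 * T * T ^+ 2.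
    rewrite !normrM (gtr0_norm B0) (ger0_norm (ler0n _ 2)).
    have -> : 2 * B * `|lam| * k1 * k2 * T * T ^+ 2 = (2 * B * `|lam|) * ((k1 * T) * (k2 * T ^+ 2)) by ring.
    rewrite -[X in X <= _]mulrA; apply: ler_wpM2l; first by rewrite !mulr_ge0 // ltW.
    by rewrite ler_pM.
  have p2 : `|B * mu ^+ 2 * (l + q2)| <= B * k1 ^+ 2 * (k3 + k2) * T * T ^+ 2.
    rewrite normrM [`|B * _|]normrM normrX (gtr0_norm B0).
    have -> : B * k1 ^+ 2 * (k3 + k2) * T * T ^+ 2 = B * (k1 * T) ^+ 2 * ((k3 + k2) * T) by ring.
    apply: ler_pM => //; first by rewrite mulr_ge0 ?exprn_ge0 // ltW.
      by apply: (ler_wpM2l Bg); apply: lerXn2r; rewrite ?nnegrE // mulr_ge0.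
    apply: (le_trans (ler_normD _ _)).
    have zz : k2 * T ^+ 2 <= k2 * T by rewrite ler_wpM2l // expr2 ler_piMl // ltW.
    lra.
  apply: (le_trans (ler_normD _ _)); rewrite /K; lra.
have -> : L z ^+ 2 / (8 * q0 ^+ 3) - N z / (2 * q0) = - q2 by rewrite /q2 opprB.
have E1 : B * h0 ^+ 2 / q0 = B * lam ^+ 2 * q0 by rewrite h0E; field.
have E2 : B * (et - lam * l) ^+ 2 / q0 = B * mu ^+ 2 * q0.
  by rewrite etE addrK; field.
rewrite E1 E2.
apply: le_trans (_ : 2 * B * nu * (h0 + et) -
  (del + B * nu ^+ 2) * (q0 + l + q2 + e1 * T ^+ 2) <= _); last by lra.
rewrite h0E etE /nu; rewrite /nu in S3; lra.
Unshelve. all: by end_near. Qed.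

End Expansion.

End Barriers.

Section TwoBarriers.
Context {R : realType}.
Local Notation R2 := 'rV[R]_2.

(** Up to an affine function, the barrier is the support function of the hyperboloid x3 = sqrt(kap^2
    + |x|^2), of constant curvature 1/kap^2; hence the constant product. The root enters negatively,
    so its upper expansion is the one required. *)
Lemma hyper_below2 (b kap : R) (l y : R2) : 0 < kap -> sqnorm2 y < 1 ->
  exists xh A B C, [/\ 0 < A, 0 < A * C - B ^+ 2,
    (A * C - B ^+ 2) * (1 - sqnorm2 y) ^+ 2 = kap ^+ 2 &
    below2 (fun y => b + dot l y - kap * Num.sqrt (1 - sqnorm2 y)) y xh A B C].
Proof.
move=> k0 y1; have Q0 : 0 < 1 - sqnorm2 y by rewrite subr_gt0.
pose L (z : R2) := - 2 * dot y z; pose N (z : R2) := - dot z z.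
pose c := 4 * `|y| + 2.
have c0 : 0 < c by rewrite ltr_wpDl // mulr_ge0.
have Lc z : `|L z| <= c * `|z|.
  rewrite /L normrM normrN (ger0_norm (ler0n _ 2)).
  have := dot_le y z; have := normr_ge0 z; rewrite /c; lra.
have Nc z : `|N z| <= c * `|z| ^+ 2.
  rewrite /N normrN; apply: (le_trans (dot_le _ _)); rewrite -mulrA -expr2 /c.
  by apply: ler_wpM2r; rewrite ?exprn_ge0 // lerDr mulr_ge0.
set p := Num.sqrt (1 - sqnorm2 y); have p0 : 0 < p by rewrite sqrtr_gt0.
have pn : p != 0 by exact: lt0r_neq0.
have pp : p ^+ 2 = 1 - sqnorm2 y by rewrite sqr_sqrtr // ltW.
exists (l + (kap / p) *: y), (kap * (1 / p + y 0 0 ^+ 2 / p ^+ 3)),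
  (kap * (y 0 0 * y 0 1 / p ^+ 3)), (kap * (1 / p + y 0 1 ^+ 2 / p ^+ 3)).
have E : kap * (1 / p + y 0 0 ^+ 2 / p ^+ 3) * (kap * (1 / p + y 0 1 ^+ 2 / p ^+ 3)) -
    (kap * (y 0 0 * y 0 1 / p ^+ 3)) ^+ 2 = kap ^+ 2 / p ^+ 4.
  have -> : kap ^+ 2 / p ^+ 4 = kap ^+ 2 * (p ^+ 2 + sqnorm2 y) / p ^+ 4.
    by rewrite pp subrK mulr1.
  by rewrite /sqnorm2; field.
split.
- by rewrite mulr_gt0 // ltr_pwDl ?divr_gt0 // divr_ge0 ?sqr_ge0 // exprn_ge0 // ltW.
- by rewrite E divr_gt0 // exprn_gt0.
- by rewrite E -pp; field.
move=> e e0; have e1 : 0 < e / kap by rewrite divr_gt0.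
have [d d0 Hd] := near0_ball (sqrt_upper2 Lc Nc c0 Q0 e1).
exists d => // z zd; have := Hd z zd; rewrite -/p.
have -> : 1 - sqnorm2 y + (L z + N z) = 1 - sqnorm2 (y + z).
  by rewrite /L /N /sqnorm2 /dot !mxE; ring.
move=> H; have := ler_wpM2l (ltW k0) H.
have E2 : kap * (p + L z / (2 * p) + (N z / (2 * p) - L z ^+ 2 / (8 * p ^+ 3)) + e / kap * `|z| ^+ 2)
  = kap * p - dot ((kap / p) *: y) z - qform (kap * (1 / p + y 0 0 ^+ 2 / p ^+ 3))
  (kap * (y 0 0 * y 0 1 / p ^+ 3)) (kap * (1 / p + y 0 1 ^+ 2 / p ^+ 3)) z / 2 + e * `|z| ^+ 2.
  rewrite /L /N dotZl /qform /dot; field.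
  by rewrite pn lt0r_neq0.
rewrite E2 dotDl dotDr; lra.
Qed.

Section Lens.
Context (e : R2) (c0 m : R).
Context (e1 : e 0 0 ^+ 2 + e 0 1 ^+ 2 = 1) (m0 : 0 < m) (cm : c0 ^+ 2 + m ^+ 2 = 1).

(* The chord is [hco = 0] in the plane with coordinates [hco y] and
   [s = dot rot90 y], and [Qco = (lco - s) * (lco + s)] is the product of the equations
   of the tangents to the circle at its endpoints. *)
Definition rot90 : R2 := pt (- e 0 1) (e 0 0).
Definition hco (y : R2) : R := (c0 - dot e y) / m.
Definition lco (y : R2) : R := m + c0 * hco y.
Definition Qco (y : R2) : R := lco y ^+ 2 - dot rot90 y ^+ 2.

Lemma rot90_0 : rot90 0 0 = - e 0 1. Proof. exact: pt0. Qed.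
Lemma rot90_1 : rot90 0 1 = e 0 0. Proof. exact: pt1. Qed.

(** The circle belongs to the pencil of conics spanned by the pair of tangents and the doubled
    chord; this is that relation, normalised. *)
Lemma QcoE y : Qco y = 1 - sqnorm2 y + hco y ^+ 2.
Proof.
have mn : m != 0 by exact: lt0r_neq0.
have y2 : sqnorm2 y = dot rot90 y ^+ 2 + dot e y ^+ 2.
  have -> : sqnorm2 y = (e 0 0 ^+ 2 + e 0 1 ^+ 2) * sqnorm2 y by rewrite e1 mul1r.
  by rewrite /sqnorm2 /dot rot90_0 rot90_1; ring.
have ey : dot e y = c0 - m * hco y by rewrite /hco; field.
rewrite y2 ey /Qco /lco -cm.
have -> : hco y ^+ 2 = (c0 ^+ 2 + m ^+ 2) * hco y ^+ 2 by rewrite cm mul1r.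
ring.
Qed.

Definition lensw (b : R) (l : R2) (del B : R) (y : R2) : R :=
  b + dot l y - del * Num.sqrt (Qco y) + B * hco y ^+ 2 / Num.sqrt (Qco y).

(** In the coordinates l = [lco] and s, q is a Lorentzian length, so the Hessian of -q is a multiple
    of the square of l ds - s dl. The term B h^2/q adds the square of dh - lam dq besides a multiple
    of the first. The determinant is 2 B (del + B lam^2) / q^4, from which the part in B^2 is
    dropped. *)
Lemma lens_below2 (b del B : R) (l y : R2) : 0 < del -> 0 < B -> 0 < Qco y ->
  exists xh A B' C, [/\ 0 < A, 0 < A * C - B' ^+ 2,
    2 * B * del <= (A * C - B' ^+ 2) * Qco y ^+ 2 &
    below2 (lensw b l del B) y xh A B' C].
Proof.
move=> del0 B0 Q0; have mn : m != 0 by exact: lt0r_neq0.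
set q := Num.sqrt (Qco y); have q0 : 0 < q by rewrite sqrtr_gt0.
have qn : q != 0 by exact: lt0r_neq0.
have qq : q ^+ 2 = Qco y by rewrite sqr_sqrtr // ltW.
set s0 := dot rot90 y; set L0 := lco y; set h0 := hco y.
have qE : q ^+ 2 = L0 ^+ 2 - s0 ^+ 2 by [].
pose eta (z : R2) := - dot e z / m; pose sig (z : R2) := dot rot90 z.
pose L (z : R2) := 2 * c0 * L0 * eta z - 2 * s0 * sig z.
pose N (z : R2) := c0 ^+ 2 * eta z ^+ 2 - sig z ^+ 2.
pose k := 2 * `|e| / m + 2 * `|rot90|.
have k0 : 0 <= k by rewrite addr_ge0 ?divr_ge0 ?mulr_ge0 // ltW.
have etak z : `|eta z| <= k * `|z|.
  rewrite /eta normrM normrN normfV (gtr0_norm m0) ler_pdivrMr //.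
  apply: (le_trans (dot_le _ _)).
  have -> : k * `|z| * m = 2 * `|e| * `|z| + 2 * `|rot90| * `|z| * m by rewrite /k; field.
  by rewrite lerDl !mulr_ge0 // ltW.
have sigk z : `|sig z| <= k * `|z|.
  apply: (le_trans (dot_le _ _)); rewrite ler_wpM2r // /k lerDr.
  by rewrite divr_ge0 ?mulr_ge0 // ltW.
pose c := k + (2 * `|c0 * L0| + 2 * `|s0|) * k + (c0 ^+ 2 + 1) * k ^+ 2 + 1.
have c1 : 0 <= (2 * `|c0 * L0| + 2 * `|s0|) * k.
  by rewrite mulr_ge0 // addr_ge0 // mulr_ge0.
have c2 : 0 <= (c0 ^+ 2 + 1) * k ^+ 2.
  by rewrite mulr_ge0 ?exprn_ge0 // addr_ge0 // sqr_ge0.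
have cp : 0 < c by rewrite /c; lra.
have etac z : `|eta z| <= c * `|z|.
  by apply: (le_trans (etak z)); rewrite ler_wpM2r // /c; lra.
have Lc z : `|L z| <= c * `|z|.
  apply: (le_trans (ler_normB _ _)).
  have -> : `|2 * c0 * L0 * eta z| = 2 * `|c0 * L0| * `|eta z|.
    by rewrite -(mulrA 2) normrM (normrM 2) (ger0_norm (ler0n _ 2)).
  have -> : `|2 * s0 * sig z| = 2 * `|s0| * `|sig z|.
    by rewrite normrM (normrM 2) (ger0_norm (ler0n _ 2)).
  apply: le_trans (_ : (2 * `|c0 * L0| + 2 * `|s0|) * (k * `|z|) <= _).
    by rewrite [X in _ <= X]mulrDl; apply: lerD; apply: ler_wpM2l => //; exact: mulr_ge0.
  by rewrite mulrA ler_wpM2r // /c; lra.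
have Nc z : `|N z| <= c * `|z| ^+ 2.
  apply: (le_trans (ler_normB _ _)); rewrite normrM !normrX real_normK ?num_real //.
  have sq (t : R) : `|t| <= k * `|z| -> `|t| ^+ 2 <= k ^+ 2 * `|z| ^+ 2.
    by move=> ht; rewrite -exprMn lerXn2r ?nnegrE ?mulr_ge0.
  apply: le_trans (_ : (c0 ^+ 2 + 1) * k ^+ 2 * `|z| ^+ 2 <= _); last first.
    by rewrite ler_wpM2r ?exprn_ge0 // /c; lra.
  rewrite -mulrA [X in _ <= X]mulrDl mul1r; apply: lerD; last exact/sq/sigk.
  by apply: ler_wpM2l; [exact: sqr_ge0|exact/sq/etak].
have EQ z : Qco (y + z) = Qco y + (L z + N z).
  have EL : lco (y + z) = L0 + c0 * eta z.
    by rewrite /lco /hco /L0 /lco /hco /eta dotDr; field.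
  by rewrite /Qco EL dotDr /L /N -/s0 -/L0 -/(sig z); ring.
have Eh z : hco (y + z) = h0 + eta z by rewrite /h0 /hco /eta dotDr; field.
pose lam := h0 / q.
pose a1 := (del + B * lam ^+ 2) / q ^+ 3; pose a2 := 2 * B / q.
have t0 : 0 < del + B * lam ^+ 2 by rewrite ltr_pwDl // mulr_ge0 ?sqr_ge0 // ltW.
have a10 : 0 < a1 by rewrite divr_gt0 // exprn_gt0.
have a20 : 0 < a2 by rewrite divr_gt0 // mulr_gt0.
(* [x0], [x1] are the coefficients of L0 sig - c0 s0 eta, and [d0], [d1] those of eta - lam L / (2
   q), which is q times the differential of h/q. *)
pose kk := 1 - lam * c0 * L0 / q; pose rr := lam * s0 / q.
pose x0 := - L0 * e 0 1 + c0 * s0 * e 0 0 / m; pose x1 := L0 * e 0 0 + c0 * s0 * e 0 1 / m.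
pose d0 := - kk * e 0 0 / m - rr * e 0 1; pose d1 := - kk * e 0 1 / m + rr * e 0 0.
have wedge : x0 * d1 - x1 * d0 = 1.
  have -> : x0 * d1 - x1 * d0 = (e 0 0 ^+ 2 + e 0 1 ^+ 2) * (L0 * kk + c0 * s0 * rr) / m.
    by rewrite /x0 /x1 /d0 /d1; field.
  rewrite e1 mul1r /kk /rr.
  have -> : L0 * (1 - lam * c0 * L0 / q) + c0 * s0 * (lam * s0 / q) =
    L0 - lam * c0 * (L0 ^+ 2 - s0 ^+ 2) / q by field.
  rewrite -qE /lam.
  have -> : L0 - h0 / q * c0 * q ^+ 2 / q = L0 - c0 * h0 by field.
  by rewrite /L0 /lco addrK divff.
(* The Hessian of the barrier is a1 X^2 + a2 D^2 for linear forms X and D of wedge 1. *)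
pose A := a1 * x0 ^+ 2 + a2 * d0 ^+ 2; pose B' := a1 * x0 * x1 + a2 * d0 * d1.
pose C := a1 * x1 ^+ 2 + a2 * d1 ^+ 2.
have D : A * C - B' ^+ 2 = a1 * a2.
  by rewrite -[RHS]mulr1 -(expr1n _ 2) -wedge /A /B' /C; ring.
have Dp : 0 < A * C - B' ^+ 2 by rewrite D mulr_gt0.
have A0 : 0 <= A by rewrite addr_ge0 // mulr_ge0 ?sqr_ge0 // ltW.
pose xh := l + (2 * B * lam / - m) *: e
   - ((del + B * lam ^+ 2) / (2 * q)) *: ((2 * c0 * L0 / - m) *: e - (2 * s0) *: rot90).
exists xh, A, B', C; split => //.
- rewrite lt_def A0 andbT; apply/negP => /eqP A00.
  by move: Dp; rewrite A00 mul0r sub0r oppr_gt0 ltNge sqr_ge0.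
- rewrite D -qq /a1 /a2.
  have -> : (del + B * lam ^+ 2) / q ^+ 3 * (2 * B / q) * (q ^+ 2) ^+ 2 =
    2 * B * (del + B * lam ^+ 2) by field.
  by rewrite ler_pM2l ?mulr_gt0 // lerDl mulr_ge0 ?sqr_ge0 // ltW.
move=> ep ep0.
have [d dp Hd] := near0_ball (persp_lower Lc Nc cp Q0 h0 etac del0 B0 ep0).
exists d => // z zd; have := Hd z zd; rewrite -EQ -Eh -/q -/lam.
rewrite /lensw -/q -/h0.
have -> : qform A B' C z / 2 =
  (del + B * lam ^+ 2) * (L z ^+ 2 / (8 * q ^+ 3) - N z / (2 * q))
   + B * (eta z - lam * (L z / (2 * q))) ^+ 2 / q.
  have -> : qform A B' C z = a1 * (x0 * z 0 0 + x1 * z 0 1) ^+ 2 + a2 * (d0 * z 0 0 + d1 * z 0 1) ^+ 2.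
    by rewrite /qform /A /B' /C; ring.
  have -> : x0 * z 0 0 + x1 * z 0 1 = L0 * sig z - c0 * s0 * eta z.
    by rewrite /x0 /x1 /sig /eta /dot rot90_0 rot90_1; field.
  have -> : d0 * z 0 0 + d1 * z 0 1 = eta z - lam * (L z / (2 * q)).
    by rewrite /L /d0 /d1 /kk /rr /sig /eta /dot rot90_0 rot90_1; field; rewrite mn qn.
  have -> : L z ^+ 2 / (8 * q ^+ 3) - N z / (2 * q) =
    ((c0 * L0 * eta z - s0 * sig z) ^+ 2 - N z * q ^+ 2) / (2 * q ^+ 3).
    by rewrite /L; field.
  rewrite qE /N /a1 /a2; field; exact: qn.
have -> : dot xh z = dot l z + (2 * B * lam * eta z - (del + B * lam ^+ 2) * (L z / (2 * q))).
  rewrite /xh dotBl dotDl !dotZl dotBl !dotZl /L /eta -/(sig z); field.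
  by rewrite mn qn.
rewrite dotDr; lra.
Qed.

End Lens.

End TwoBarriers.

(** * Continuity and compactness in the disk *)

Section PlaneTopology.
Context {R : realType}.
Local Notation R2 := 'rV[R]_2.

Lemma closed_le_fun (g h : R2 -> R) : continuous g -> continuous h ->
  closed [set y | g y <= h y].
Proof.
move=> gc hc.
have -> : [set y | g y <= h y] = (h \- g) @^-1` [set x | 0 <= x].
  by apply/seteqP; split => y /=; rewrite subr_ge0.
apply: closed_comp; last exact: closed_ge.
by move=> y _; apply: continuousB; [exact: hc|exact: gc].
Qed.

Lemma sqnorm2_continuous : continuous (@sqnorm2 R).
Proof.
have -> : @sqnorm2 R = (fun y => y 0 0 * y 0 0 + y 0 1 * y 0 1).
  by apply/funext => y; rewrite /sqnorm2 !expr2.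
move=> y; apply: differentiable_continuous.
by apply: differentiableD; apply: differentiableM => //; exact: differentiable_coord.
Qed.

Lemma cdisk_norm (y : R2) : cdisk y -> `|y| <= 1.
Proof.
rewrite /cdisk /= /sqnorm2 => H; have h0 := sqr_ge0 (y 0 0); have h1 := sqr_ge0 (y 0 1).
apply: norm_rv2_le; rewrite -(ler_pXn2r (n := 2)) ?nnegrE // real_normK ?num_real // expr1n; lra.
Qed.

Lemma compact_in_disk (K : set R2) : closed K -> K `<=` cdisk -> compact K.
Proof.
move=> clK Kd; apply: bounded_closed_compact => //.
exists 1; split; first exact: num_real.
by move=> x x1 y Ky; apply: (le_trans (cdisk_norm (Kd y Ky))); exact: ltW.
Qed.

Lemma dist_continuous (x : R2) : continuous (fun y : R2 => `|y - x|).
Proof.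
move=> y.
have h : {for y, continuous (fun y : R2 => y - x)}.
  by apply: (@continuousB _ _ _ id (cst x)); [exact: cvg_id|exact: cst_continuous].
exact: (continuous_comp h (@norm_continuous R R2 (y - x))).
Qed.

Lemma near_lt_fun (g h : R2 -> R) y : {for y, continuous g} -> {for y, continuous h} ->
  g y < h y -> \forall z \near y, g z < h z.
Proof.
move=> gc hc gh; pose m := (h y - g y) / 2; have m0 : 0 < m by rewrite /m; lra.
near=> z.
have h1 : `|g y - g z| < m by near: z; move/cvgrPdist_lt : gc; apply.
have h2 : `|h y - h z| < m by near: z; move/cvgrPdist_lt : hc; apply.
move: h1 h2; rewrite !ltr_norml /m => /andP[p1 p2] /andP[p3 p4]; lra.
Unshelve. all: by end_near. Qed.

Lemma sqrt_comp_continuous (g : R2 -> R) y : {for y, continuous g} ->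
  {for y, continuous (fun y => Num.sqrt (g y))}.
Proof.
move=> gc; apply: (@continuous_comp _ _ _ g Num.sqrt) => //.
exact: sqrt_continuous.
Qed.

Section Pointwise.
Context (f g : R2 -> R) (y : R2).
Context (fc : {for y, continuous f}) (gc : {for y, continuous g}).

Lemma for_continuousD : {for y, continuous (fun z => f z + g z)}.
Proof. exact: continuousD. Qed.
Lemma for_continuousB : {for y, continuous (fun z => f z - g z)}.
Proof. exact: continuousB. Qed.
Lemma for_continuousM : {for y, continuous (fun z => f z * g z)}.
Proof. exact: continuousM. Qed.
Lemma for_continuousV : g y != 0 -> {for y, continuous (fun z => f z / g z)}.
Proof. by move=> gy0; apply: continuousM => //; exact: continuousV. Qed.
Lemma for_continuousX n : {for y, continuous (fun z => f z ^+ n)}.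
Proof.
exact: (continuous_comp fc (@exprn_continuous R n (f y))).
Qed.

End Pointwise.

Lemma for_continuous_cst (b : R) (y : R2) : {for y, continuous (fun _ => b)}.
Proof. exact: cst_continuous. Qed.

Lemma affine_continuous (b : R) (l : R2) : continuous (fun y => b + dot l y).
Proof.
move=> y; apply: for_continuousD; first exact: for_continuous_cst.
exact: dot_continuous.
Qed.

Section LensTopology.
Context (e : R2) (c0 m : R) (m0 : 0 < m).

Lemma hco_continuous : continuous (hco e c0 m).
Proof.
have -> : hco e c0 m = (fun y => c0 / m + dot (- m^-1 *: e) y).
  apply/funext => y; rewrite /hco dotZl; field; exact: lt0r_neq0.
exact: affine_continuous.
Qed.

Lemma Qco_continuous : continuous (Qco e c0 m).
Proof.
move=> y; rewrite /Qco; apply: for_continuousB; apply: for_continuousX; last exact: dot_continuous.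
rewrite /lco; apply: for_continuousD; first exact: for_continuous_cst.
by apply: for_continuousM; [exact: for_continuous_cst|exact: hco_continuous].
Qed.

Lemma lensw_continuous b l del B y : 0 < Qco e c0 m y ->
  {for y, continuous (lensw e c0 m b l del B)}.
Proof.
move=> Q0; have qc := sqrt_comp_continuous (@Qco_continuous y).
have hc := @hco_continuous y.
rewrite /lensw; apply: for_continuousD.
  apply: for_continuousB; first exact: affine_continuous.
  by apply: for_continuousM => //; exact: for_continuous_cst.
apply: for_continuousV => //; last by rewrite gt_eqF // sqrtr_gt0.
by apply: for_continuousM; [exact: for_continuous_cst|exact: for_continuousX].
Qed.

End LensTopology.

End PlaneTopology.

(** * Boundary values of the support function *)

Section BoundaryValues.
Context {R : realType}.
Local Notation R2 := 'rV[R]_2.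
Context (S : set 'rV[R]_3) (f : R2 -> R) (G : R2 -> R2) (a : R).
Context (gS : forall p, S p <-> p 0 2 = f (vproj p)).
Context (fG : forall x v, is_derive x v f (dot (G x) v)).
Context (dG : forall x, differentiable G x).
Context (fconv : forall x y (t : R), 0 <= t <= 1 ->
  f ((1 - t) *: x + t *: y) <= (1 - t) * f x + t * f y).
Context (a0 : 0 < a) (G1 : forall x, sqnorm2 (G x) < 1).
Context (aG : forall x, a * (1 - sqnorm2 (G x)) ^+ 2 <= \det ('J G x)).
Local Notation u := (support_fun S).

Lemma closed_cdisk : closed (@cdisk R).
Proof.
by apply: closed_le_fun; [exact: sqnorm2_continuous|move=> ?; exact: cst_continuous].
Qed.

Lemma supp_lsc1 (g : R2 -> R) (y : R2) : {for y, continuous g} -> ((g y)%:E < u y)%E ->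
  \forall z \near y, ((g z)%:E < u z)%E.
Proof.
move=> gc gu; have [[P Q] /= [nP nQ] PQ] := supp_lsc gS gc gu.
apply: filterS nP => z Pz.
near (0 : R)^'+ => e.
have e0 : 0 < e by near: e; exact: nbhs_right_gt.
have Qe : Q e by near: e.
apply: lt_trans (PQ (z, e) (conj Pz Qe)) => /=.
by rewrite lte_fin; lra.
Unshelve. all: by end_near. Qed.

(** If [u] were finite at [y1], tilt the barrier about the chord. It stays below -f 0, hence below
    [u], on the chord; the arc imposes nothing because [u] is infinite there; a steep tilt puts it
    above [u] at [y1]. *)
Lemma cap_infinite (l : R2) (c : R) :
  (forall xi, circle xi -> c < dot l xi -> u xi = +oo%E) ->
  forall y, cdisk y -> c < dot l y -> u y = +oo%E.
Proof.
move=> H y1 y1d cy1; apply/eqP; rewrite -leye_eq leNgt; apply/negP => uy1.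
have [v vE _] : exists2 v, u y1 = v%:E & v <= fine (u y1).
  by apply: (supp_fin_le gS); rewrite fineK ?(supp_finE gS).
(* Any value with [1 < kap ^+ 2 * a] works; this one avoids a square root. *)
pose kap := a^-1 + 1.
have kap0 : 0 < kap by rewrite addr_gt0 // invr_gt0.
have kapa : 1 < kap ^+ 2 * a.
  have -> : kap ^+ 2 * a = a^-1 + 2 + a by rewrite /kap; field; exact: lt0r_neq0.
  have := a0; have : 0 < a^-1 by rewrite invr_gt0.
  lra.
(* As the root is at most 1, this slope gives w y1 >= v + 1. *)
pose N := (v + f 0 + kap + 1) / (dot l y1 - c).
have dl : dot l y1 - c != 0 by rewrite lt0r_neq0 // subr_gt0.
pose w (y : R2) := - f 0 - N * c + dot (N *: l) y - kap * Num.sqrt (1 - sqnorm2 y).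
have wE y : w y = - f 0 + N * (dot l y - c) - kap * Num.sqrt (1 - sqnorm2 y).
  by rewrite /w dotZl; ring.
pose K := [set y : R2 | sqnorm2 y <= 1] `&` [set y | c <= dot l y].
have cK : compact K.
  apply: compact_in_disk; last by move=> y [].
  apply: closedI; first exact: closed_cdisk.
  by apply: closed_le_fun; [move=> ?; exact: cst_continuous|exact: dot_continuous].
have wc y : {for y, continuous w}.
  rewrite /w; apply: for_continuousB; first exact: affine_continuous.
  apply: for_continuousM; first exact: for_continuous_cst.
  apply: sqrt_comp_continuous; apply: for_continuousB; first exact: for_continuous_cst.
  exact: sqnorm2_continuous.
have Ky1 : K y1 by split => //=; exact: ltW.
have := comparison gS fG dG fconv a0 G1 aG cK (fun y _ => wc y) Ky1.
have -> : ((w y1)%:E <= u y1)%E = false.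
  rewrite vE lee_fin wE /N divfK //; apply/negbTE; rewrite -ltNge.
  have : Num.sqrt (1 - sqnorm2 y1) <= 1.
    by rewrite -[leRHS]sqrtr1; apply: ler_wsqrtr; rewrite lerBlDr lerDl addr_ge0 // sqr_ge0.
  by have := kap0; nra.
move=> Cmp; apply: notF; apply: Cmp => y [yd cy] uw.
have cy' : c < dot l y.
  rewrite lt_neqAle cy andbT; apply/eqP => cE.
  have := lt_le_trans (le_lt_trans (supp_lb gS y) uw) (lexx _).
  rewrite lte_fin wE -cE subrr mulr0 addr0.
  have := mulr_ge0 (ltW kap0) (sqrtr_ge0 (1 - sqnorm2 y)); lra.
have y1' : sqnorm2 y < 1.
  rewrite lt_neqAle yd andbT; apply/eqP => yc.
  by move: uw; rewrite (H y yc cy').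
split.
  have n1 := near_lt_fun (@sqnorm2_continuous R y) (@for_continuous_cst R 1 y) y1'.
  have n2 := near_lt_fun (@for_continuous_cst R c y) (@dot_continuous R l y) cy'.
  by apply: filterS2 n1 n2 => z z1 z2; left; split; exact: ltW.
have [xh [A [B [C [A0 D0 DE bl]]]]] := hyper_below2 (- f 0 - N * c) (N *: l) kap0 y1'.
exists xh, A, B, C; split => //.
by rewrite mulrCA DE mulrC.
Qed.

Section Chord.
Context (e : R2) (c0 m : R).
Context (e1 : e 0 0 ^+ 2 + e 0 1 ^+ 2 = 1) (m0 : 0 < m) (cm : c0 ^+ 2 + m ^+ 2 = 1).
Context (side : forall y, cdisk y -> (u y < +oo)%E -> dot e y <= c0).
Local Notation hc := (hco e c0 m).
Local Notation Qc := (Qco e c0 m).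
Local Notation xim := (c0 *: e - m *: rot90 e).
Local Notation xip := (c0 *: e + m *: rot90 e).

Let mn : m != 0. Proof. exact: lt0r_neq0. Qed.
Let m1 : m <= 1.
Proof.
rewrite -(ler_pXn2r (n := 2)) ?nnegrE ?(ltW m0) // expr1n -cm.
by rewrite lerDr sqr_ge0.
Qed.
Let c1 : `|c0| <= 1.
Proof.
rewrite -(ler_pXn2r (n := 2)) ?nnegrE // expr1n real_normK ?num_real // -cm.
by rewrite lerDl sqr_ge0.
Qed.

Lemma coord_eq y : y = (c0 - m * hc y) *: e + dot (rot90 e) y *: rot90 e.
Proof.
have -> : c0 - m * hc y = dot e y by rewrite /hco; field.
apply: rv2P; rewrite !mxE /= /dot rot90_0 rot90_1.
  by rewrite -[LHS]mul1r -e1; ring.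
by rewrite -[LHS]mul1r -e1; ring.
Qed.

Lemma unit_norm : `|e| <= 1 /\ `|rot90 e| <= 1.
Proof.
have h0 := sqr_ge0 (e 0 0); have h1 := sqr_ge0 (e 0 1).
have b0 : `|e 0 0| <= 1.
  by rewrite -(ler_pXn2r (n := 2)) ?nnegrE // real_normK ?num_real // expr1n -e1 lerDl.
have b1 : `|e 0 1| <= 1.
  by rewrite -(ler_pXn2r (n := 2)) ?nnegrE // real_normK ?num_real // expr1n -e1 lerDr.
by split; apply: norm_rv2_le; rewrite ?rot90_0 ?rot90_1 ?normrN.
Qed.

Lemma chord_coord (s : R) : dot (rot90 e) (c0 *: e + s *: rot90 e) = s /\
  hc (c0 *: e + s *: rot90 e) = 0.
Proof.
rewrite /hco !dotDr !dotZr.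
have -> : dot (rot90 e) e = 0 by rewrite /dot rot90_0 rot90_1; ring.
have -> : dot e (rot90 e) = 0 by rewrite /dot rot90_0 rot90_1; ring.
have -> : dot (rot90 e) (rot90 e) = 1 by rewrite /dot rot90_0 rot90_1 -e1; ring.
have -> : dot e e = 1 by rewrite /dot -e1; ring.
by split; [ring|rewrite !mulr1 mulr0 addr0 subrr mul0r].
Qed.

Lemma chord_Q (s : R) : Qc (c0 *: e + s *: rot90 e) = m ^+ 2 - s ^+ 2.
Proof. by have [E1 E2] := chord_coord s; rewrite /Qco /lco E1 E2; ring. Qed.

Lemma lens_corner (r : R) y : 0 < r -> cdisk y -> 0 <= hc y ->
  2 * hc y = Num.sqrt (Qc y) -> r <= `|y - xim| -> r <= `|y - xip| ->
  Num.min (m / 16) (r / 3) <= hc y.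
Proof.
move=> r0 yd h0 hq rm rp; rewrite leNgt; apply/negP.
rewrite lt_min => /andP[hm hr].
set h := hc y in h0 hq hm hr *; set s := dot (rot90 e) y.
have Q0 : 0 <= Qc y.
  by rewrite (QcoE e1 m0 cm) addr_ge0 ?sqr_ge0 // subr_ge0.
have QE : 4 * h ^+ 2 = (m + c0 * h) ^+ 2 - s ^+ 2.
  have : (2 * h) ^+ 2 = Qc y by rewrite hq sqr_sqrtr.
  by rewrite /Qco /lco -/h -/s => <-; ring.
have ch : `|c0 * h| <= h by rewrite normrM (ger0_norm h0) ler_piMl.
have [nE nR] := unit_norm.
have far t : `|s - t| <= 3 / 2 * h -> `|y - (c0 *: e + t *: rot90 e)| < r.
  move=> st.
  have -> : y - (c0 *: e + t *: rot90 e) = (s - t) *: rot90 e - (m * h) *: e.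
    by rewrite {1}[y]coord_eq -/h -/s; apply: rv2P; rewrite !mxE; ring.
  apply: (le_lt_trans (ler_normB _ _)); rewrite [`|(s - t) *: _|]normrZ [`|(m * h) *: _|]normrZ.
  rewrite (ger0_norm (mulr_ge0 (ltW m0) h0)).
  have p1 : `|s - t| * `|rot90 e| <= `|s - t| by rewrite ler_piMr.
  have p2 : m * h * `|e| <= h.
    have mh : m * h <= h by rewrite ler_piMl.
    by apply: le_trans mh; rewrite ler_piMr // mulr_ge0 // ltW.
  lra.
move: ch; rewrite ler_norml => /andP[ch1 ch2].
have hh : h * h <= m / 16 * h by rewrite ler_wpM2r // ltW.
have [s0|s0] := leP 0 s.
  have k1 : m / 2 <= m + c0 * h + s by lra.
  have k2 : (m + c0 * h - s) * (m / 2) <= h / 2 * (m / 2).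
    have [d0|d0] := leP 0 (m + c0 * h - s).
      apply: le_trans (ler_wpM2l d0 k1) _.
      have -> : (m + c0 * h - s) * (m + c0 * h + s) = 4 * h ^+ 2 by rewrite QE; ring.
      by rewrite expr2; lra.
    by rewrite ler_pM2r ?divr_gt0 //; lra.
  rewrite ler_pM2r ?divr_gt0 // in k2.
  have k3 : 0 <= m + c0 * h - s.
    have k0 : 0 < m + c0 * h + s by apply: lt_le_trans k1; rewrite divr_gt0.
    rewrite -(pmulr_rge0 _ k0).
    have -> : (m + c0 * h + s) * (m + c0 * h - s) = 4 * h ^+ 2 by rewrite QE; ring.
    by rewrite mulr_ge0 // sqr_ge0.
  have st : `|s - m| <= 3 / 2 * h by rewrite ler_norml; lra.
  by have := far m st; rewrite ltNge rp.
have k1 : m / 2 <= m + c0 * h - s by lra.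
have k2 : (m + c0 * h + s) * (m / 2) <= h / 2 * (m / 2).
  have [d0|d0] := leP 0 (m + c0 * h + s).
    apply: le_trans (ler_wpM2l d0 k1) _.
    have -> : (m + c0 * h + s) * (m + c0 * h - s) = 4 * h ^+ 2 by rewrite QE; ring.
    by rewrite expr2; lra.
  by rewrite ler_pM2r ?divr_gt0 //; lra.
rewrite ler_pM2r ?divr_gt0 // in k2.
have k3 : 0 <= m + c0 * h + s.
  have k0 : 0 < m + c0 * h - s by apply: lt_le_trans k1; rewrite divr_gt0.
  rewrite -(pmulr_rge0 _ k0).
  have -> : (m + c0 * h - s) * (m + c0 * h + s) = 4 * h ^+ 2 by rewrite QE; ring.
  by rewrite mulr_ge0 // sqr_ge0.
have st : `|s - - m| <= 3 / 2 * h by rewrite ler_norml; lra.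
by have := far (- m) st; rewrite scaleNr ltNge rm.
Qed.

Lemma lens_corner_Q0 y : 0 <= hc y -> 2 * hc y <= Num.sqrt (Qc y) -> 0 <= Qc y ->
  y <> xim -> y <> xip -> 0 < Qc y.
Proof.
move=> h0 hq Q0 ym yp; rewrite lt_def Q0 andbT; apply/negP => /eqP QE.
have hE : hc y = 0 by move: hq; rewrite QE sqrtr0; lra.
have E := coord_eq y; rewrite hE mulr0 subr0 in E.
have : (m - dot (rot90 e) y) * (m + dot (rot90 e) y) = 0.
  by move: QE; rewrite /Qco /lco hE => QE; rewrite -[RHS]QE; ring.
move=> /eqP; rewrite mulf_eq0 => /orP[/eqP sE|/eqP sE].
  have sm : dot (rot90 e) y = m by lra.
  by apply: yp; rewrite E sm.
have sm : dot (rot90 e) y = - m by lra.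
by apply: ym; rewrite E sm scaleNr.
Qed.

Section LensBarrier.
Context (am ap : R) (am_lt : (am%:E < u xim)%E) (ap_lt : (ap%:E < u xip)%E).
Local Notation l := (((ap - am) / (2 * m)) *: rot90 e).
Local Notation b := ((am + ap) / 2).

Lemma lens_aff (s : R) :
  b + dot l (c0 *: e + s *: rot90 e) = (am * (m - s) + ap * (m + s)) / (2 * m).
Proof. by rewrite dotZl; have [-> _] := chord_coord s; field. Qed.

(** At a corner [Qc] vanishes and the left side is [am] or [ap], strictly below [u]; lower
    semicontinuity extends this to a ball. The term in [B] is meant to absorb the quotient h^2/q,
    which is at most q/4 in the lens. *)
Lemma lens_near_corner (B : R) : exists2 r, 0 < r & forall y,
  `|y - xim| <= r \/ `|y - xip| <= r ->
  ((b + dot l y + B * Num.sqrt (Qc y))%:E < u y)%E.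
Proof.
have gc y : {for y, continuous (fun y => b + dot l y + B * Num.sqrt (Qc y))}.
  apply: for_continuousD; first exact: affine_continuous.
  apply: for_continuousM; first exact: for_continuous_cst.
  by apply: sqrt_comp_continuous; exact: Qco_continuous.
have Em : xim = c0 *: e + (- m) *: rot90 e by rewrite scaleNr.
have um : ((b + dot l xim + B * Num.sqrt (Qc xim))%:E < u xim)%E.
  suff -> : b + dot l xim + B * Num.sqrt (Qc xim) = am by [].
  by rewrite Em lens_aff chord_Q sqrrN (subrr (m ^+ 2)) sqrtr0 mulr0 addr0; field.
have up : ((b + dot l xip + B * Num.sqrt (Qc xip))%:E < u xip)%E.
  suff -> : b + dot l xip + B * Num.sqrt (Qc xip) = ap by [].
  by rewrite lens_aff chord_Q (subrr (m ^+ 2)) sqrtr0 mulr0 addr0; field.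
have [d1 /= d10 H1] := (nbhs_ballP _ _).1 (supp_lsc1 (gc _) um).
have [d2 /= d20 H2] := (nbhs_ballP _ _).1 (supp_lsc1 (gc _) up).
exists (Num.min d1 d2 / 2); first by rewrite divr_gt0 // lt_min d10.
have lt2 d : 0 < d -> Num.min d1 d2 <= d -> Num.min d1 d2 / 2 < d.
  by move=> d0 hd; rewrite ltr_pdivrMr //; lra.
move=> y [hy|hy].
  apply: H1; rewrite -ball_normE /= distrC; apply: le_lt_trans hy _.
  by apply: lt2 => //; rewrite ge_min lexx.
apply: H2; rewrite -ball_normE /= distrC; apply: le_lt_trans hy _.
by apply: lt2 => //; rewrite ge_min lexx orbT.
Qed.

(** On the chord the barrier terms with coefficients [A] and [B], which depend on [del], vanish;
    what remains is the stated bound. *)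
Lemma lens_lower (del : R) y0 : 0 < del -> cdisk y0 -> hc y0 = 0 ->
  ((b + dot l y0 - del * Num.sqrt (Qc y0))%:E <= u y0)%E.
Proof.
move=> del0 y0d hy0.
(* Makes the determinant bound of [lens_below2] equal to 2 / (a Q^2). *)
pose B := (a * del)^-1; have B0 : 0 < B by rewrite invr_gt0 mulr_gt0.
have [r r0 near_corner] := lens_near_corner (B / 4).
pose h1 := Num.min (m / 16) (r / 3).
have h10 : 0 < h1 by rewrite lt_min !divr_gt0.
(* The large constant multiplying h: on the curved side away from the corners, where [h1 <= hc y],
   [A * hc y] outweighs the affine part, the quotient term and [f 0], so the barrier is below the
   universal bound [supp_lb]. *)
pose A := (`|b| + 2 * `|l| + B + `|f 0|) / h1.
have A0 : 0 <= A.
  by rewrite divr_ge0 ?(ltW h10) // !addr_ge0 // ?mulr_ge0 // ltW.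
pose w := lensw e c0 m (b - A * c0 / m) (l + (A / m) *: e) del B.
have wE y : w y = b + dot l y - A * hc y - del * Num.sqrt (Qc y)
    + B * hc y ^+ 2 / Num.sqrt (Qc y).
  rewrite /w /lensw dotDl [dot ((A / m) *: e) y]dotZl.
  have -> : A * hc y = A * c0 / m - A / m * dot e y by rewrite /hco; field.
  by ring.
have Q0 y : cdisk y -> 0 <= Qc y.
  by move=> yd; rewrite (QcoE e1 m0 cm) addr_ge0 ?sqr_ge0 // subr_ge0.
have persp y : 0 <= hc y -> 2 * hc y <= Num.sqrt (Qc y) ->
    B * hc y ^+ 2 / Num.sqrt (Qc y) <= B / 4 * Num.sqrt (Qc y).
  move=> h0 hq; have [q0|q0] := ltP 0 (Num.sqrt (Qc y)).
    rewrite ler_pdivrMr //.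
    have : (2 * hc y) ^+ 2 <= Num.sqrt (Qc y) ^+ 2.
      by apply: lerXn2r => //; rewrite nnegrE ?sqrtr_ge0 // mulr_ge0.
    rewrite exprMn => hh; have := ler_wpM2l (ltW B0) hh; lra.
  (* Where the root vanishes its inverse is 0 by convention, so both sides are 0. *)
  have -> : Num.sqrt (Qc y) = 0 by apply/eqP; rewrite eq_le q0 sqrtr_ge0.
  by rewrite invr0 !mulr0.
have w_corner y : 0 <= hc y -> 2 * hc y <= Num.sqrt (Qc y) ->
    `|y - xim| <= r \/ `|y - xip| <= r -> ((w y)%:E <= u y)%E.
  move=> h0 hq yr; apply: le_trans (ltW (near_corner y yr)); rewrite lee_fin wE.
  have p1 := persp y h0 hq; have p2 := mulr_ge0 A0 h0.
  have p3 := mulr_ge0 (ltW del0) (sqrtr_ge0 (Qc y)); lra.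
(* Balls about the corners are cut out because the denominator of the barrier vanishes there. *)
pose K := cdisk `&` [set y : R2 | 0 <= hc y] `&` [set y | 2 * hc y <= Num.sqrt (Qc y)]
  `&` [set y : R2 | r <= `|y - xim|] `&` [set y : R2 | r <= `|y - xip|].
have cst_c (t : R) : continuous (fun _ : R2 => t) by move=> ?; exact: cst_continuous.
have hcc : continuous hc by exact: hco_continuous.
have qcc : continuous (fun y => Num.sqrt (Qc y)).
  by move=> y; apply: sqrt_comp_continuous; exact: Qco_continuous.
have h2c : continuous (fun y => 2 * hc y).
  by move=> y; apply: for_continuousM; [exact: for_continuous_cst|exact: hcc].
have cK : compact K.
  apply: compact_in_disk; last by move=> y [[[[]]]].
  do 4 (apply: closedI; last by apply: closed_le_fun => //; exact: dist_continuous).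
  exact: closed_cdisk.
have KQ y : K y -> 0 < Qc y.
  move=> [[[[yd h0] hq] ym] yp]; apply: lens_corner_Q0 => //; first exact: Q0.
    by move=> yE; move: ym; rewrite /= yE subrr normr0 leNgt r0.
  by move=> yE; move: yp; rewrite /= yE subrr normr0 leNgt r0.
have wc y : K y -> {for y, continuous w}.
  by move=> Ky; apply: lensw_continuous => //; exact: KQ.
have target : w y0 = b + dot l y0 - del * Num.sqrt (Qc y0).
  by rewrite wE hy0 expr0n /= !mulr0 mul0r addr0 subr0.
rewrite -target.
have hq0 : 2 * hc y0 <= Num.sqrt (Qc y0) by rewrite hy0 mulr0 sqrtr_ge0.
have h00 : 0 <= hc y0 by rewrite hy0.
have [ym|ym] := leP `|y0 - xim| r; first by apply: w_corner => //; left.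
have [yp|yp] := leP `|y0 - xip| r; first by apply: w_corner => //; right.
apply: (comparison gS fG dG fconv a0 G1 aG cK wc).
  by split; [split; [split; [split|]|]|] => //=; exact: ltW.
move=> y Ky uw; have Qy := KQ y Ky.
have [[[[yd h0] hq] ym'] yp'] := Ky; rewrite /= in h0 hq ym' yp'.
have q0 : 0 < Num.sqrt (Qc y) by rewrite sqrtr_gt0.
have ym2 : r < `|y - xim|.
  rewrite ltNge; apply/negP => yr; move: uw; rewrite ltNge; apply/negP; rewrite negbK.
  by apply: w_corner => //; left.
have yp2 : r < `|y - xip|.
  rewrite ltNge; apply/negP => yr; move: uw; rewrite ltNge; apply/negP; rewrite negbK.
  by apply: w_corner => //; right.
have Q2 : Num.sqrt (Qc y) ^+ 2 = Qc y by rewrite sqr_sqrtr // ltW.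
have hQ : 4 * hc y ^+ 2 <= Qc y.
  rewrite -Q2; have -> : 4 * hc y ^+ 2 = (2 * hc y) ^+ 2 by ring.
  by apply: lerXn2r => //; rewrite nnegrE ?sqrtr_ge0 // mulr_ge0.
have QyE := QcoE e1 m0 cm y.
have hq2 : 2 * hc y < Num.sqrt (Qc y).
  rewrite lt_neqAle hq andbT; apply/eqP => hqE.
  have hh1 : h1 <= hc y by apply: (lens_corner r0 yd h0 hqE) => //; exact: ltW.
  move: uw; rewrite ltNge; apply/negP; rewrite negbK.
  apply: le_trans (supp_lb gS y); rewrite lee_fin wE.
  have p1 := persp y h0 hq.
  have p3 := mulr_ge0 (ltW del0) (sqrtr_ge0 (Qc y)).
  have p4 : `|b| + 2 * `|l| + B + `|f 0| <= A * hc y.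
    apply: le_trans (_ : A * h1 <= _); last by rewrite ler_wpM2l.
    by rewrite /A divfK // lt0r_neq0.
  have p5 := ler_norm b.
  have p6 : dot l y <= 2 * `|l|.
    apply: (le_trans (ler_norm _)); apply: (le_trans (dot_le _ _)).
    by rewrite ler_piMr ?mulr_ge0 // cdisk_norm.
  have p7 : - `|f 0| <= - f 0 by rewrite lerN2 ler_norm.
  (* From [4 * hc y ^+ 2 <= Qc y] one even gets Q <= 4/3; the crude bound 4 cancels the factor 1/4
     of [persp]. *)
  have p8 : Num.sqrt (Qc y) <= 4.
    have y0' : 0 <= sqnorm2 y by rewrite addr_ge0 // sqr_ge0.
    have q16 : Qc y <= 4 ^+ 2 by lra.
    by rewrite -(ger0_norm (ler0n R 4)) -sqrtr_sqr; apply: ler_wsqrtr.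
  have p9 : B / 4 * Num.sqrt (Qc y) <= B.
    have := ler_wpM2l (ltW B0) p8; lra.
  lra.
have y34 : 3 / 4 * Qc y <= 1 - sqnorm2 y by lra.
have y1 : sqnorm2 y < 1 by lra.
split.
  have n1 := near_lt_fun (@sqnorm2_continuous R y) (@for_continuous_cst R 1 y) y1.
  have n2 := near_lt_fun (h2c y) (qcc y) hq2.
  have n3 := near_lt_fun (@for_continuous_cst R r y) (@dist_continuous R xim y) ym2.
  have n4 := near_lt_fun (@for_continuous_cst R r y) (@dist_continuous R xip y) yp2.
  near=> z.
  have z1 : sqnorm2 z < 1 by near: z.
  have zd : cdisk z by exact: ltW.
  have [hz|hz] := leP 0 (hc z).
    left; split; [split; [split; [split|]|]|] => //=; apply: ltW; by near: z.
  (* Beyond the chord [side] makes [u] infinite, so the chord itself imposes no boundary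
     condition. *)
  right; apply/eqP; rewrite -leye_eq leNgt; apply/negP => uz.
  have := side zd uz; apply/negP; rewrite -ltNge.
  by move: hz; rewrite /hco ltr_pdivrMr // mul0r subr_lt0.
have [xh [A' [B' [C [A'0 D0 DE bl]]]]] :=
  lens_below2 e1 m0 (b - A * c0 / m) (l + (A / m) *: e) del0 B0 Qy.
exists xh, A', B', C; split => //.
(* The slope 2 in [2 * hc y] leaves enough room: the weight is at least 9/16 of Q^2, and 2 times
   9/16 is 9/8 > 1. *)
have qq : 9 / 16 * Qc y ^+ 2 <= (1 - sqnorm2 y) ^+ 2.
  have -> : 9 / 16 * Qc y ^+ 2 = (3 / 4 * Qc y) ^+ 2 by field.
  by apply: lerXn2r => //; rewrite ?nnegrE; lra.
apply: lt_le_trans (_ : (A' * C - B' ^+ 2) * (a * (9 / 16 * Qc y ^+ 2)) <= _); last first.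
  by rewrite ler_pM2l // ler_pM2l.
have -> : (A' * C - B' ^+ 2) * (a * (9 / 16 * Qc y ^+ 2)) =
  (9 / 16 * a) * ((A' * C - B' ^+ 2) * Qc y ^+ 2) by ring.
apply: lt_le_trans (_ : 9 / 16 * a * (2 * B * del) <= _); last first.
  by rewrite ler_pM2l // mulr_gt0 //; lra.
have -> : 9 / 16 * a * (2 * B * del) = 9 / 8.
  by rewrite /B; field; rewrite !lt0r_neq0.
lra.
Unshelve. all: by end_near. Qed.

End LensBarrier.

(** Let [del] tend to 0 in [lens_lower]: on the chord q <= m, so [del = ep / m] loses at most
    [ep]. *)
Lemma chord_lower (am ap t : R) : (am%:E < u xim)%E -> (ap%:E < u xip)%E ->
  0 <= t <= 1 ->
  (((1 - t) * am + t * ap)%:E <= u ((1 - t) *: xim + t *: xip)%R)%E.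
Proof.
move=> hm hp /andP[t0 t1].
pose s := (2 * t - 1) * m.
have -> : (1 - t) *: xim + t *: xip = c0 *: e + s *: rot90 e.
  by rewrite /s; apply: rv2P; rewrite !mxE; ring.
set y := c0 *: e + s *: rot90 e.
have tE : (1 - t) * am + t * ap = (am * (m - s) + ap * (m + s)) / (2 * m).
  by rewrite /s; field.
have [_ hy] := chord_coord s.
have Qy : Qc y <= m ^+ 2 by rewrite chord_Q gerBl sqr_ge0.
have s2 : s ^+ 2 <= m ^+ 2.
  rewrite /s exprMn ler_piMl ?sqr_ge0 //.
  rewrite -[leRHS](expr1n _ 2) -[leLHS]real_normK ?num_real // lerXn2r ?nnegrE //.
  by rewrite ler_norml; lra.
have yd : cdisk y.
  have := QcoE e1 m0 cm y; rewrite hy expr0n /= addr0 chord_Q => E.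
  by rewrite /cdisk /=; lra.
have sq : Num.sqrt (Qc y) <= m.
  by rewrite -[leRHS]ger0_norm ?(ltW m0) // -sqrtr_sqr; apply: ler_wsqrtr.
apply/lee_addgt0Pr => ep ep0.
have del0 : 0 < ep / m by rewrite divr_gt0.
have := lens_lower hm hp del0 yd hy; rewrite lens_aff -tE.
move=> H; rewrite -leeBlDr //; apply: le_trans H; rewrite -EFinB lee_fin lerD2l lerN2.
by have := ler_wpM2l (ltW del0) sq; rewrite divfK.
Qed.

End Chord.

End BoundaryValues.

(** * Convex sets in the plane *)

Section ConvexPlane.
Context {R : realType}.
Local Notation R2 := 'rV[R]_2.

Lemma convex_setP (M : lmodType R) (A : set M) : @convex_set R M A <->
  forall x y (t : R), 0 <= t <= 1 -> A x -> A y -> A ((1 - t) *: x + t *: y).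
Proof.
split=> [cA x y t /andP[t0 t1] Ax Ay|H x y l xA yA].
  have := cA y x (Itv01 t0 t1) (mem_set Ay) (mem_set Ax).
  by move=> /set_mem; rewrite addrC.
have := H y x l%:num _ (set_mem yA) (set_mem xA); rewrite ge0 le1 addrC => Al.
by apply/mem_set; exact: Al.
Qed.

Definition convexP (A : set R2) :=
  forall x y (t : R), 0 <= t <= 1 -> A x -> A y -> A ((1 - t) *: x + t *: y).

Lemma sqnorm2_dot (x : R2) : sqnorm2 x = dot x x.
Proof. by rewrite /sqnorm2 /dot !expr2. Qed.

Lemma sqnorm2_gt0 (x : R2) : x != 0 -> 0 < sqnorm2 x.
Proof.
move=> x0; have h0 := sqr_ge0 (x 0 0); have h1 := sqr_ge0 (x 0 1).
rewrite lt_def addr_ge0 // andbT; apply: contra x0 => /eqP E.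
by apply/eqP/rv2P; apply/eqP; rewrite [X in _ == X]mxE -sqrf_eq0 eq_le sqr_ge0 andbT;
  move: E; rewrite /sqnorm2; lra.
Qed.

Lemma dot_rot90 (d : R2) : dot d (rot90 d) = 0.
Proof. by rewrite /dot rot90_0 rot90_1; ring. Qed.

Lemma rot90_decomp (d x : R2) :
  sqnorm2 d *: x = dot d x *: d + dot (rot90 d) x *: rot90 d.
Proof. by apply: rv2P; rewrite !mxE /= /dot !mxE /sqnorm2 /=; ring. Qed.

(* Put the origin at [y0] and the first axis opposite to some [p] in [A]; the sought
   line through [y0] has as slope the supremum of those of the points of [A] above
   the axis. *)
Lemma weak_separation (A : set R2) y0 : convexP A -> ~ A y0 ->
  exists2 l : R2, l != 0 & forall x, A x -> dot l x <= dot l y0.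
Proof.
move=> cA Ay0; have [->|/set0P[p Ap]] := eqVneq A set0.
  by exists (pt 1 0) => //; apply/eqP => /rowP /(_ 0); rewrite !mxE /=; apply/eqP; rewrite oner_eq0.
pose d := p - y0.
have d0 : d != 0 by rewrite subr_eq0; apply/eqP => py; apply: Ay0; rewrite -py.
have dd := sqnorm2_gt0 d0.
have rd0 : rot90 d != 0.
  apply: contra d0 => /eqP/rowP rd; apply/eqP/rv2P; rewrite [RHS]mxE.
    by have := rd 1; rewrite rot90_1 [RHS]mxE.
  by have := rd 0; rewrite rot90_0 [RHS]mxE => /eqP; rewrite oppr_eq0 => /eqP.
pose al (x : R2) := - dot d (x - y0); pose be (x : R2) := dot (rot90 d) (x - y0).
have alp : al p = - sqnorm2 d by rewrite /al -/d sqnorm2_dot.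
have bep : be p = 0 by rewrite /be -/d dotC dot_rot90.
have axis x : A x -> be x = 0 -> al x < 0.
  move=> Ax bx; rewrite ltNge; apply/negP => ax; apply: Ay0.
  pose t := al x / (al x + sqnorm2 d).
  have s0 : 0 < al x + sqnorm2 d by rewrite ltr_wpDl.
  have -> : y0 = (1 - t) *: x + t *: p.
    apply/eqP; rewrite eq_sym -subr_eq0; apply/eqP.
    apply: (@scalerI _ _ (sqnorm2 d)); first exact: lt0r_neq0.
    rewrite rot90_decomp scaler0.
    have -> : (1 - t) *: x + t *: p - y0 = (1 - t) *: (x - y0) + t *: d.
      by rewrite /d; apply: rv2P; rewrite !mxE; ring.
    rewrite !dotDr !dotZr -/(be x) bx [dot (rot90 d) d]dotC dot_rot90 -sqnorm2_dot.
    have -> : dot d (x - y0) = - al x by rewrite /al opprK.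
    have -> : (1 - t) * - al x + t * sqnorm2 d = 0.
      by rewrite /t; field; exact: lt0r_neq0.
    by rewrite !mulr0 addr0 !scale0r addr0.
  apply: cA => //; rewrite divr_ge0 ?(ltW s0) //=.
  by rewrite ler_pdivrMr // mul1r lerDl ltW.
(* The segment from [x] to [y] meets the axis at a point of [A], where [al] is negative by
   [axis]. *)
have cross x y : A x -> A y -> 0 < be x -> be y < 0 -> al x * - be y + al y * be x < 0.
  move=> Ax Ay bx byy.
  have s0 : 0 < be x - be y by rewrite subr_gt0 (lt_trans byy).
  pose t := be x / (be x - be y).
  have t01 : 0 <= t <= 1.
    apply/andP; split; first by rewrite divr_ge0 // ltW.
    by rewrite ler_pdivrMr // mul1r lerDl oppr_ge0 ltW.
  have Az := cA x y t t01 Ax Ay.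
  have zE : (1 - t) *: x + t *: y - y0 = (1 - t) *: (x - y0) + t *: (y - y0).
    by apply: rv2P; rewrite !mxE; ring.
  have bz : be ((1 - t) *: x + t *: y) = 0.
    rewrite /be zE dotDr !dotZr -/(be x) -/(be y) /t; field; exact: lt0r_neq0.
  have := axis _ Az bz.
  have -> : al ((1 - t) *: x + t *: y) = (al x * - be y + al y * be x) / (be x - be y).
    by rewrite {1}/al zE dotDr !dotZr /al /t; field; exact: lt0r_neq0.
  by rewrite ltr_pdivrMr // mul0r.
have [[q [Aq bq]]|nup] := pselect (exists q, A q /\ 0 < be q); last first.
  exists (rot90 d) => // x Ax; rewrite -subr_le0 -dotBr leNgt; apply/negP => bx.
  by apply: nup; exists x.
have [[q' [Aq' bq']]|ndown] := pselect (exists q, A q /\ be q < 0); last first.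
  exists (- rot90 d); first by rewrite oppr_eq0.
  move=> x Ax; rewrite -subr_le0 -dotBr -scaleN1r dotZl mulN1r oppr_le0 leNgt.
  by apply/negP => bx; apply: ndown; exists x.
pose I := [set r | exists x, [/\ A x, 0 < be x & r = al x / be x]].
have slope x y : A x -> A y -> 0 < be x -> be y < 0 -> al x / be x <= al y / be y.
  move=> Ax Ay bx byy; have := cross x y Ax Ay bx byy.
  by rewrite ler_ndivlMr // mulrAC ler_pdivlMr //; lra.
have I0 : I !=set0 by exists (al q / be q); exists q.
have Iub : has_sup I.
  split => //; exists (al q' / be q') => _ [x [Ax bx ->]]; exact: slope.
pose k := sup I.
have ell x : dot (- d - k *: rot90 d) x - dot (- d - k *: rot90 d) y0 = al x - k * be x.
  by rewrite -dotBr dotBl dotZl -[- d]scaleN1r dotZl mulN1r.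
exists (- d - k *: rot90 d).
  apply/eqP => E; have := ell p; rewrite E /dot !mxE alp bep; lra.
move=> x Ax; rewrite -subr_le0 ell subr_le0.
have [bx|bx|bx] := ltgtP 0 (be x).
- rewrite -ler_pdivrMr //; apply: ub_le_sup; first exact: Iub.2.
  by exists x.
- rewrite -ler_ndivlMr //; apply: ge_sup => // _ [z [Az bz ->]]; exact: slope.
- by rewrite -bx mulr0 ltW // axis.
Qed.

(** The homothety of centre [p] and ratio 1 - t carries a ball about [o] inside [D] to a ball about
    the new point. *)
Lemma interior_absorb (D : set R2) o p (t : R) : convexP D -> interior D o -> D p ->
  0 <= t < 1 -> interior D ((1 - t) *: o + t *: p).
Proof.
move=> cD /nbhs_ballP[r /= r0 Hr] Dp /andP[t0 t1].
have s0 : 0 < 1 - t by rewrite subr_gt0.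
apply/nbhs_ballP; exists ((1 - t) * r); first by rewrite /= mulr_gt0.
move=> z; rewrite -ball_normE /= => zr.
pose o' := o + (1 - t)^-1 *: (z - ((1 - t) *: o + t *: p)).
have -> : z = (1 - t) *: o' + t *: p.
  by rewrite /o' scalerDr scalerA divff ?lt0r_neq0 // scale1r; apply: rv2P; rewrite !mxE; ring.
apply: cD => //; first by rewrite t0 ltW.
apply: Hr; rewrite -ball_normE /= /o' opprD addrA subrr sub0r normrN normrZ.
by rewrite gtr0_norm ?invr_gt0 // distrC ltr_pdivrMl.
Qed.

End ConvexPlane.

(** The only passage from the surface to [f] and [G]: convexity of the region above gives that of
    [f], and [gauss_curvE] turns the lower curvature bound into a determinant inequality. *)
Lemma entire_surface_graph (R : realType) (S : set 'rV[R]_3) (a b : R) :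
  smooth_surface S -> spacelike S -> entire S -> future_convex S ->
  (forall p, S p -> a <= gauss_curv S p <= b) ->
  exists (f : 'rV[R]_2 -> R) (G : 'rV[R]_2 -> 'rV[R]_2),
  [/\ (forall p, S p <-> p 0 2 = f (vproj p)),
      (forall x v, is_derive x v f (dot (G x) v)),
      (forall x, differentiable G x),
      (forall x y (t : R), 0 <= t <= 1 ->
        f ((1 - t) *: x + t *: y) <= (1 - t) * f x + t * f y) &
      (forall x, sqnorm2 (G x) < 1 /\
        a * (1 - sqnorm2 (G x)) ^+ 2 <= \det ('J G x))].
Proof.
move=> surfS slS [[_ _ vsurj] [sg [sgK _ sgc]]] convS curvS.
have Ksg p : S p -> sg (vproj p) = p by move=> Sp; rewrite sgK // inE.
have sgS x : S (sg x) by have [p Sp <-] := vsurj x I; rewrite Ksg.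
have vsg x : vproj (sg x) = x by have [p Sp <-] := vsurj x I; rewrite Ksg.
have sg_cont : continuous sg by apply/continuous_subspace_setT.
have gS := graph_height sgS vsg Ksg.
exists (height sg), (hgrad sg); split.
- exact: gS.
- exact: (height_derive surfS slS sgS vsg sg_cont).
- exact: (hgrad_differentiable surfS slS sgS vsg Ksg sg_cont).
- move=> x y t t01; have /convex_setP H := convS.
  have E z : exists p, [/\ S p, vproj p = vproj (sg z) & p 0 2 <= sg z 0 2].
    by exists (sg z).
  have [p [Sp pE pz]] := H _ _ t t01 (E x) (E y).
  move: pz; rewrite (gS p).1 // pE.
  have -> : vproj ((1 - t) *: sg x + t *: sg y) = (1 - t) *: x + t *: y.
    have -> : vproj ((1 - t) *: sg x + t *: sg y) =
       (1 - t) *: vproj (sg x) + t *: vproj (sg y) by apply: rv2P; rewrite !mxE.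
    by rewrite !vsg.
  by rewrite !mxE.
- move=> x; have g1 : sqnorm2 (hgrad sg x) < 1.
    exact: (hgrad_lt1 surfS slS sgS vsg Ksg sg_cont x).
  split => //; have := curvS _ (sgS x).
  rewrite (gauss_curvE surfS slS sgS vsg Ksg sg_cont) // vsg => /andP[+ _].
  by rewrite ler_pdivlMr // exprn_gt0 // subr_gt0.
Qed.

Lemma sqnorm2_frame (R : realType) (v : 'rV[R]_2) p q :
  sqnorm2 (p *: v + q *: rot90 v) = (p ^+ 2 + q ^+ 2) * sqnorm2 v.
Proof. by rewrite /sqnorm2 !mxE /=; ring. Qed.

(** * The essential domain and the chords in its boundary *)

Section Conclusion.
Context {R : realType}.
Local Notation R2 := 'rV[R]_2.
Context (S : set 'rV[R]_3) (f : R2 -> R) (G : R2 -> R2) (a : R).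
Context (gS : forall p, S p <-> p 0 2 = f (vproj p)).
Context (fG : forall x v, is_derive x v f (dot (G x) v)).
Context (dG : forall x, differentiable G x).
Context (fconv : forall x y (t : R), 0 <= t <= 1 ->
  f ((1 - t) *: x + t *: y) <= (1 - t) * f x + t * f y).
Context (a0 : 0 < a) (G1 : forall x, sqnorm2 (G x) < 1).
Context (aG : forall x, a * (1 - sqnorm2 (G x)) ^+ 2 <= \det ('J G x)).
Local Notation u := (support_fun S).

Lemma ess_domE y : ess_dom S y <-> cdisk y /\ (u y < +oo)%E.
Proof. by rewrite /ess_dom /= (supp_finE gS). Qed.

Lemma cdisk_convex : convexP (@cdisk R).
Proof.
move=> x y t /andP[t0 t1]; rewrite /cdisk /= => x1 y1.
have s1 : 0 <= 1 - t by rewrite subr_ge0.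
have -> : sqnorm2 ((1 - t) *: x + t *: y) =
  (1 - t) * sqnorm2 x + t * sqnorm2 y - t * (1 - t) * sqnorm2 (x - y).
  by rewrite /sqnorm2 !mxE; ring.
have : 0 <= t * (1 - t) * sqnorm2 (x - y).
  by rewrite !mulr_ge0 // addr_ge0 // sqr_ge0.
have := ler_wpM2l s1 x1; have := ler_wpM2l t0 y1; lra.
Qed.

Lemma ess_dom_convex : convexP (ess_dom S).
Proof.
move=> x y t t01 /ess_domE[xd ux] /ess_domE[yd uy]; apply/ess_domE; split.
  exact: cdisk_convex.
have [v vE _] : exists2 v, u x = v%:E & v <= fine (u x).
  by apply: (supp_fin_le gS); rewrite fineK ?(supp_finE gS).
have [w wE _] : exists2 v, u y = v%:E & v <= fine (u y).
  by apply: (supp_fin_le gS); rewrite fineK ?(supp_finE gS).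
apply: le_lt_trans (ltry ((1 - t) * v + t * w)).
by apply: (supp_conv gS) => //; rewrite ?vE ?wE.
Qed.

(** Real numbers strictly below the end values replace these values, so that infinite ends are
    included and lower semicontinuity applies at the ends. *)
Definition chord_below (x1 x2 : R2) := forall (al1 al2 t : R),
  (al1%:E < u x1)%E -> (al2%:E < u x2)%E -> 0 <= t <= 1 ->
  (((1 - t) * al1 + t * al2)%:E <= u ((1 - t) *: x1 + t *: x2)%R)%E.

Lemma chord_below_sym x1 x2 : chord_below x1 x2 -> chord_below x2 x1.
Proof.
move=> H al1 al2 t h1 h2 /andP[t0 t1].
have t01 : 0 <= 1 - t <= 1 by rewrite subr_ge0 t1 gerBl.
have := H al2 al1 (1 - t) h2 h1 t01; have -> : 1 - (1 - t) = t by ring.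
by rewrite addrC [t *: _ + _]addrC.
Qed.

Lemma chord_below_infinite x1 x2 t : chord_below x1 x2 -> u x1 = +oo%E ->
  0 <= t < 1 -> u ((1 - t) *: x1 + t *: x2) = +oo%E.
Proof.
move=> H u1 /andP[t0 t1]; apply/eqP; rewrite -leye_eq leNgt; apply/negP => uy.
have [v vE _] : exists2 v, u ((1 - t) *: x1 + t *: x2) = v%:E &
    v <= fine (u ((1 - t) *: x1 + t *: x2)).
  by apply: (supp_fin_le gS); rewrite fineK ?(supp_finE gS).
pose al2 := - f 0 - 1.
have h2 : (al2%:E < u x2)%E.
  by apply: lt_le_trans (supp_lb gS x2); rewrite lte_fin /al2; lra.
have s0 : 0 < 1 - t by rewrite subr_gt0.
(* Solves (1 - t) al1 + t al2 = v + 1, above the supposed finite value. *)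
pose al1 := (v + 1 - t * al2) / (1 - t).
have h1 : (al1%:E < u x1)%E by rewrite u1 ltry.
have t01 : 0 <= t <= 1 by rewrite t0 ltW.
have := H al1 al2 t h1 h2 t01; rewrite vE lee_fin /al1 mulrCA divff ?lt0r_neq0 //; lra.
Qed.

(** Suppose a convex [A] contains the finite boundary points but misses [y0]. The hull need not be
    closed, so the separating line may pass through [y0]. By [cap_infinite] the domain lies on one
    side of it, and [chord_lower] applies to the chord through [y0]. Finiteness at [y0] then forces
    both ends to be finite, which puts [y0] in [A]. *)
Lemma ess_dom_hull :
  ess_dom S = convex_hull [set xi | circle xi /\ (u xi < +oo)%E].
Proof.
apply/seteqP; split; last first.
  apply: smallest_sub; first by apply/convex_setP; exact: ess_dom_convex.
  by move=> xi [/= xic uxi]; apply/ess_domE; split => //; rewrite /cdisk /= xic.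
move=> y0 /ess_domE[y0d uy0] A [/convex_setP cA FA].
apply: contrapT => nA.
have [l l0 lA] := weak_separation cA nA.
have n0 := sqnorm2_gt0 l0.
pose n := Num.sqrt (sqnorm2 l); have np : 0 < n by rewrite sqrtr_gt0.
have nn : n ^+ 2 = sqnorm2 l by rewrite sqr_sqrtr // ltW.
have nn0 : n != 0 by exact: lt0r_neq0.
have sidel y : cdisk y -> (u y < +oo)%E -> dot l y <= dot l y0.
  move=> yd uy; rewrite leNgt; apply/negP => ly.
  have cap := cap_infinite gS fG dG fconv a0 G1 aG (l := l) (c := dot l y0).
  move: uy; rewrite cap ?ltxx // => xi xic lxi.
  apply/eqP; rewrite -leye_eq leNgt; apply/negP => uxi.
  by have := lA xi (FA xi (conj xic uxi)); rewrite leNgt lxi.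
have y0lt : sqnorm2 y0 < 1.
  rewrite lt_neqAle; apply/andP; split; last exact: y0d.
  by apply/eqP => y0c; apply: nA; apply: FA.
pose e := n^-1 *: l; pose c0 := dot e y0; pose s := dot (rot90 e) y0.
have e1 : e 0 0 ^+ 2 + e 0 1 ^+ 2 = 1.
  have -> : e 0 0 ^+ 2 + e 0 1 ^+ 2 = sqnorm2 l / n ^+ 2 by rewrite /e !mxE /sqnorm2; field.
  by rewrite -nn divff // expf_neq0.
have se : sqnorm2 e = 1 by rewrite /sqnorm2.
have y0E : y0 = c0 *: e + s *: rot90 e.
  by rewrite -[LHS]scale1r -se rot90_decomp.
have cs : c0 ^+ 2 + s ^+ 2 = sqnorm2 y0.
  by rewrite [in RHS]y0E sqnorm2_frame se mulr1.
pose m := Num.sqrt (1 - c0 ^+ 2).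
have c01 : 0 < 1 - c0 ^+ 2 by have := sqr_ge0 s; lra.
have m0 : 0 < m by rewrite sqrtr_gt0.
have mm : m ^+ 2 = 1 - c0 ^+ 2 by rewrite sqr_sqrtr // ltW.
have cm : c0 ^+ 2 + m ^+ 2 = 1 by rewrite mm; ring.
have side y : cdisk y -> (u y < +oo)%E -> dot e y <= c0.
  move=> yd uy; rewrite /c0 /e !dotZl ler_pM2l ?invr_gt0 //; exact: sidel.
have CB : chord_below (c0 *: e - m *: rot90 e) (c0 *: e + m *: rot90 e).
  by move=> al1 al2 t h1 h2 t01; apply: (chord_lower gS fG dG fconv a0 G1 aG e1 m0 cm side).
have sm : `|s| < m.
  rewrite -(ltr_pXn2r (n := 2)) ?nnegrE ?(ltW m0) // real_normK ?num_real // mm; lra.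
move: sm; rewrite ltr_norml => /andP[sm1 sm2].
pose t := (s / m + 1) / 2.
have mn : m != 0 by exact: lt0r_neq0.
have t0 : 0 < t by rewrite /t divr_gt0 // -ltrBlDr sub0r ltr_pdivlMr // mulN1r.
have t1 : t < 1.
  by rewrite /t ltr_pdivrMr // -ltrBrDr ltr_pdivrMr //; lra.
have yt : y0 = (1 - t) *: (c0 *: e - m *: rot90 e) + t *: (c0 *: e + m *: rot90 e).
  rewrite {1}y0E; have gen (v w : R2) : c0 *: v + s *: w =
      (1 - t) *: (c0 *: v - m *: w) + t *: (c0 *: v + m *: w).
    by apply: rv2P; rewrite !mxE /t; field.
  exact: gen.
have circ r : `|r| = m -> circle (c0 *: e + r *: rot90 e).
  move=> rm; rewrite /circle /=.
  have r2 : r ^+ 2 = m ^+ 2 by rewrite -rm real_normK ?num_real.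
  by rewrite sqnorm2_frame se mulr1 r2.
have fin1 : (u (c0 *: e - m *: rot90 e) < +oo)%E.
  rewrite ltNge leye_eq; apply/negP => /eqP ui.
  have t01 : 0 <= t < 1 by rewrite ltW.
  by move: uy0; rewrite yt (chord_below_infinite CB ui t01) ltxx.
have fin2 : (u (c0 *: e + m *: rot90 e) < +oo)%E.
  rewrite ltNge leye_eq; apply/negP => /eqP ui.
  have t01 : 0 <= 1 - t < 1 by apply/andP; split; lra.
  have := chord_below_infinite (chord_below_sym CB) ui t01.
  have -> : 1 - (1 - t) = t by ring.
  rewrite addrC -yt => ui0.
  by move: uy0; rewrite ui0 ltxx.
apply: nA; rewrite yt; apply: cA; first by rewrite !ltW.
  by apply: FA; split => //; rewrite -scaleNr; apply: circ; rewrite normrN gtr0_norm.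
by apply: FA; split => //; apply: circ; rewrite gtr0_norm.
Qed.

(** [m] is half the length of the chord and [rot90 e] its direction from [x1] to [x2], so [e] is a
    unit normal. *)
Lemma chord_frame (x1 x2 : R2) : circle x1 -> circle x2 -> x1 <> x2 ->
  exists (e : R2) (c0 m : R), [/\ e 0 0 ^+ 2 + e 0 1 ^+ 2 = 1, 0 < m, c0 ^+ 2 + m ^+ 2 = 1,
    x1 = c0 *: e - m *: rot90 e & x2 = c0 *: e + m *: rot90 e].
Proof.
rewrite /circle /= => h1 h2 x12.
have d0 : x2 - x1 != 0 by rewrite subr_eq0; apply/eqP => E; apply: x12.
have n0 := sqnorm2_gt0 d0; pose n := Num.sqrt (sqnorm2 (x2 - x1)).
have np : 0 < n by rewrite sqrtr_gt0.
have nn : n ^+ 2 = sqnorm2 (x2 - x1) by rewrite sqr_sqrtr // ltW.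
have nE : n ^+ 2 = (x2 0 0 - x1 0 0) ^+ 2 + (x2 0 1 - x1 0 1) ^+ 2.
  by rewrite nn /sqnorm2 !mxE.
have nn0 : n != 0 by exact: lt0r_neq0.
pose m := n / 2; have m0 : 0 < m by rewrite divr_gt0.
have mn : m != 0 by exact: lt0r_neq0.
have [e eE] : exists e, e = pt ((x2 0 1 - x1 0 1) / n) (- (x2 0 0 - x1 0 0) / n) by eexists.
have e1 : e 0 0 ^+ 2 + e 0 1 ^+ 2 = 1.
  have -> : e 0 0 ^+ 2 + e 0 1 ^+ 2 = n ^+ 2 / n ^+ 2.
    by rewrite {1}nE eE pt0 pt1; field.
  by rewrite divff // expf_neq0.
have se : sqnorm2 e = 1 by [].
have r0 : rot90 e 0 0 = (x2 0 0 - x1 0 0) / n by rewrite rot90_0 eE pt1 mulNr opprK.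
have r1 : rot90 e 0 1 = (x2 0 1 - x1 0 1) / n by rewrite rot90_1 eE pt0.
have nx : n ^+ 2 = 2 - 2 * dot x1 x2.
  rewrite nE; have -> : 2 - 2 * dot x1 x2 = sqnorm2 x1 + sqnorm2 x2 - 2 * dot x1 x2 by rewrite h1 h2.
  by rewrite /sqnorm2 /dot; ring.
have d1 : dot (rot90 e) x1 = - m.
  have -> : dot (rot90 e) x1 = (dot x1 x2 - sqnorm2 x1) / n.
    by rewrite /dot r0 r1 /sqnorm2; field.
  rewrite h1 (_ : dot x1 x2 - 1 = - n ^+ 2 / 2); last by rewrite nx; field.
  by rewrite /m; field.
have d2 : dot (rot90 e) x2 = m.
  have -> : dot (rot90 e) x2 = (sqnorm2 x2 - dot x1 x2) / n.
    by rewrite /dot r0 r1 /sqnorm2; field.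
  rewrite h2 (_ : 1 - dot x1 x2 = n ^+ 2 / 2); last by rewrite nx; field.
  by rewrite /m; field.
have ee : dot e x1 = dot e x2.
  by rewrite /dot eE pt0 pt1; field.
have x1E : x1 = dot e x1 *: e - m *: rot90 e.
  by rewrite -[LHS]scale1r -se rot90_decomp d1 scaleNr.
exists e, (dot e x1), m; split => //.
- rewrite -h1 [in RHS]x1E -scaleNr sqnorm2_frame se mulr1 sqrrN; congr (_ + _).
- by rewrite -[LHS]scale1r -se rot90_decomp d2 ee.
Qed.

(** [Omega S] is convex and misses the midpoint [z], so a line through [z] separates them weakly.
    Both ends lie in the closure and average to [z], so this is the line of the chord.
    [interior_absorb] carries the one-sidedness from [Omega S] to the whole domain, as [side]
    demands. *)
Lemma boundary_chord_below (x1 x2 : R2) : circle x1 -> circle x2 -> x1 <> x2 ->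
  segment x1 x2 `<=` boundary (Omega S) -> chord_below x1 x2.
Proof.
move=> h1 h2 x12 seg.
have [e [c0 [m [e1 m0 cm x1E x2E]]]] := chord_frame h1 h2 x12.
have se : sqnorm2 e = 1 by [].
have Ocv : convexP (Omega S).
  move=> x y t /andP[t0 t1] Ox Oy; move: t1; rewrite le_eqVlt => /orP[/eqP ->|t1].
    by rewrite subrr scale0r add0r scale1r.
  apply: interior_absorb => //; [exact: ess_dom_convex|exact: interior_subset|].
  by rewrite t0.
pose z := (1 - 2^-1) *: x1 + 2^-1 *: x2.
have segP t : 0 <= t <= 1 -> boundary (Omega S) ((1 - t) *: x1 + t *: x2).
  by move=> t01; apply: seg; exists t.
have zb : boundary (Omega S) z by apply: segP; apply/andP; split; lra.
have nz : ~ Omega S z.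
  move=> Oz; case: zb => _; apply.
  have : open (Omega S) by exact: open_interior.
  by rewrite openE; apply.
have [l l0 lO] := weak_separation Ocv nz.
have clO y : closure (Omega S) y -> dot l y <= dot l z.
  have cl : closed [set y | dot l y <= dot l z].
    by apply: closed_le_fun; [exact: dot_continuous|move=> ?; exact: cst_continuous].
  by move=> /(closure_subset (B := [set y | dot l y <= dot l z]) lO) /cl.
have b1 : dot l x1 <= dot l z.
  by apply: clO; have [+ _] := segP 0 (ltac:(by rewrite lexx ler01)); rewrite subr0 scale1r scale0r addr0.
have b2 : dot l x2 <= dot l z.
  by apply: clO; have [+ _] := segP 1 (ltac:(by rewrite lexx ler01)); rewrite subrr scale1r scale0r add0r.
have lz : dot l z = (dot l x1 + dot l x2) / 2 by rewrite /z dotDr !dotZr; field.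
have lr : dot l (rot90 e) = 0.
  have : dot l x1 = dot l x2 by lra.
  rewrite x1E x2E dotBr dotDr !dotZr => E.
  have : m * dot l (rot90 e) = 0 by lra.
  by move/eqP; rewrite mulf_eq0 gt_eqF //= => /eqP.
pose mu := dot l e.
have lE : l = mu *: e.
  by rewrite -[LHS]scale1r -se rot90_decomp [dot (rot90 e) l]dotC lr scale0r addr0 dotC.
have mu0 : mu != 0 by apply: contra l0 => /eqP mu0; rewrite lE mu0 scale0r.
have [ee er] : dot e e = 1 /\ dot e (rot90 e) = 0.
  by rewrite -sqnorm2_dot dot_rot90.
have ez : dot l z = mu * c0.
  by rewrite lz x1E x2E lE !dotZl dotBr dotDr !dotZr ee er; field.
have [p Op] : Omega S !=set0.
  have : closure (Omega S) !=set0 by exists z; case: zb.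
  by case=> w /(_ setT (filterT)) [p [Op _]]; exists p.
have sideD y : cdisk y -> (u y < +oo)%E -> mu * dot e y <= mu * c0.
  move=> yd uy; have Dy : ess_dom S y by apply/ess_domE.
  rewrite -ez -dotZl -lE leNgt; apply/negP => ly.
  have lo := lO p Op.
  have den : 0 < dot l y - dot l p by lra.
  (* This weight on [p] uses up half of the excess of [y] over [z], leaving a point of [Omega S]
     beyond the line. *)
  pose ep := (dot l y - dot l z) / (2 * (dot l y - dot l p)).
  have ep0 : 0 < ep by rewrite divr_gt0 ?subr_gt0 // mulr_gt0.
  have ep1 : ep <= 1 / 2 by rewrite ler_pdivrMr ?mulr_gt0 //; lra.
  have t01 : 0 <= 1 - ep < 1 by apply/andP; split; lra.
  have := lO _ (interior_absorb ess_dom_convex Op Dy t01).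
  rewrite dotDr !dotZr.
  have E : ep * (dot l y - dot l p) = (dot l y - dot l z) / 2.
    by rewrite /ep; field; exact: lt0r_neq0.
  lra.
have [mup|mun] := ltP 0 mu.
  have side y : cdisk y -> (u y < +oo)%E -> dot e y <= c0.
    by move=> yd uy; rewrite -(ler_pM2l mup); exact: sideD.
  move=> al1 al2 t; rewrite x1E x2E => k1 k2 t01.
  exact: (chord_lower gS fG dG fconv a0 G1 aG e1 m0 cm side).
have mun' : mu < 0 by rewrite lt_neqAle mu0.
(* With the domain on the other side, [e] is replaced by [- e], which exchanges the two ends. *)
apply: chord_below_sym => al1 al2 t.
have rN : rot90 (- e) = - rot90 e by apply: rv2P; rewrite !mxE /= ?mxE.
have -> : x2 = - c0 *: - e - m *: rot90 (- e).
  by rewrite x2E rN scaleNr !scalerN !opprK.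
have -> : x1 = - c0 *: - e + m *: rot90 (- e).
  by rewrite x1E rN scaleNr !scalerN !opprK.
move=> k1 k2 t01.
have e1' : (- e) 0 0 ^+ 2 + (- e) 0 1 ^+ 2 = 1 by rewrite !mxE !sqrrN.
have cm' : (- c0) ^+ 2 + m ^+ 2 = 1 by rewrite sqrrN.
have side y : cdisk y -> (u y < +oo)%E -> dot (- e) y <= - c0.
  move=> yd uy; rewrite -scaleN1r dotZl mulN1r lerN2 -(ler_nM2l mun').
  exact: sideD.
exact: (chord_lower gS fG dG fconv a0 G1 aG e1' m0 cm' side).
Qed.

Lemma chord_affine x1 x2 : chord_below x1 x2 -> (u x1 < +oo)%E -> (u x2 < +oo)%E ->
  forall t : R, 0 <= t <= 1 ->
  u ((1 - t) *: x1 + t *: x2) = ((1 - t)%:E * u x1 + t%:E * u x2)%E.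
Proof.
move=> CB u1 u2 t t01.
have [v1 v1E _] : exists2 v, u x1 = v%:E & v <= fine (u x1).
  by apply: (supp_fin_le gS); rewrite fineK ?(supp_finE gS).
have [v2 v2E _] : exists2 v, u x2 = v%:E & v <= fine (u x2).
  by apply: (supp_fin_le gS); rewrite fineK ?(supp_finE gS).
rewrite v1E v2E -!EFinM -EFinD; apply/eqP; rewrite eq_le; apply/andP; split.
  by apply: (supp_conv gS) => //; rewrite ?v1E ?v2E.
apply/lee_addgt0Pr => ep ep0.
have k1 : ((v1 - ep)%:E < u x1)%E by rewrite v1E lte_fin; lra.
have k2 : ((v2 - ep)%:E < u x2)%E by rewrite v2E lte_fin; lra.
have := CB _ _ _ k1 k2 t01; move=> H.
rewrite -leeBlDr //; apply: le_trans H; rewrite -EFinB lee_fin; lra.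
Qed.

(** Any two real numbers are the end values of an affine function, so the envelope is at least the
    interpolation of any real minorants of the end values. [chord_below] puts the envelope below
    [u]; the converse uses convexity when both ends are finite and, at an infinite end, a freely
    chosen minorant. *)
Lemma chord_envelope x1 x2 : chord_below x1 x2 -> x1 <> x2 ->
  forall y, segment x1 x2 y -> u y = convex_envelope [set x1; x2] u y.
Proof.
move=> CB x12 _ [t t01 <-]; have /andP[t0 t1] : 0 <= t <= 1 := t01.
set y := (1 - t) *: x1 + t *: x2; set env := convex_envelope _ _ _.
have envge (be1 be2 : R) : (be1%:E <= u x1)%E -> (be2%:E <= u x2)%E ->
    (((1 - t) * be1 + t * be2)%:E <= env)%E.
  move=> h1 h2; apply: ereal_sup_ubound.
  have d0 : x2 - x1 != 0 by rewrite subr_eq0; apply/eqP => E; apply: x12.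
  have n0 := lt0r_neq0 (sqnorm2_gt0 d0).
  pose l := ((be2 - be1) / sqnorm2 (x2 - x1)) *: (x2 - x1).
  have ld : dot l (x2 - x1) = be2 - be1.
    by rewrite /l dotZl -sqnorm2_dot divfK.
  have E1 : dot l x1 + (be1 - dot l x1) = be1 by ring.
  have E2 : dot l x2 + (be1 - dot l x1) = be2 by move: ld; rewrite dotBr; lra.
  exists l, (be1 - dot l x1); split.
    by move=> w [->|->]; rewrite -/(dot l _) ?E1 ?E2.
  rewrite -/(dot l y) /y dotDr !dotZr; congr (_%:E); rewrite -{1}E1 -{1}E2; ring.
apply/eqP; rewrite eq_le; apply/andP; split; last first.
  apply: ge_ereal_sup => _ [l [c [H ->]]]; rewrite -/(dot l y).
  apply/lee_addgt0Pr => ep ep0.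
  have H1 := H x1 (or_introl erefl); have H2 := H x2 (or_intror erefl).
  have k1 : ((dot l x1 + c - ep)%:E < u x1)%E.
    by apply: lt_le_trans H1; rewrite lte_fin /dot; lra.
  have k2 : ((dot l x2 + c - ep)%:E < u x2)%E.
    by apply: lt_le_trans H2; rewrite lte_fin /dot; lra.
  have CBt := CB _ _ _ k1 k2 t01.
  rewrite -leeBlDr //; apply: le_trans CBt; rewrite -EFinB lee_fin.
  by rewrite /y dotDr !dotZr; lra.
(* At t = 0 or t = 1 one weight vanishes, and the other end enters only through its lower bound -f
   0. *)
have below (K : R) : (K%:E <= u y)%E -> (K%:E <= env)%E.
  move=> Ky; have [t00|t00] := eqVneq t 0.
    have yE : y = x1 by rewrite /y t00 subr0 scale1r scale0r addr0.
    rewrite yE in Ky; have := envge K (- f 0) Ky (supp_lb gS x2).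
    by rewrite t00 subr0 mul1r mul0r addr0.
  have [t11|t11] := eqVneq t 1.
    have yE : y = x2 by rewrite /y t11 subrr scale1r scale0r add0r.
    rewrite yE in Ky; have := envge (- f 0) K (supp_lb gS x1) Ky.
    by rewrite t11 subrr mul1r mul0r add0r.
  have tp : 0 < t by rewrite lt_def t00.
  have tp' : 0 < 1 - t by rewrite subr_gt0 lt_neqAle t11.
  have [u1|u1] := leP +oo%E (u x1).
    have := envge ((K + t * f 0) / (1 - t)) (- f 0) (le_trans (leey _) u1) (supp_lb gS x2).
    have -> : (1 - t) * ((K + t * f 0) / (1 - t)) + t * - f 0 = K by field; exact: lt0r_neq0.
    by [].
  have [u2|u2] := leP +oo%E (u x2).
    have := envge (- f 0) ((K + (1 - t) * f 0) / t) (supp_lb gS x1) (le_trans (leey _) u2).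
    have -> : (1 - t) * - f 0 + t * ((K + (1 - t) * f 0) / t) = K by field; exact: lt0r_neq0.
    by [].
  apply: (le_trans Ky); rewrite /y chord_affine //.
  have [v1 v1E _] : exists2 v, u x1 = v%:E & v <= fine (u x1).
    by apply: (supp_fin_le gS); rewrite fineK ?(supp_finE gS).
  have [v2 v2E _] : exists2 v, u x2 = v%:E & v <= fine (u x2).
    by apply: (supp_fin_le gS); rewrite fineK ?(supp_finE gS).
  rewrite v1E v2E -!EFinM -EFinD; apply: envge; rewrite ?v1E ?v2E //.
(* Testing on real minorants of [u y] avoids deciding whether it is finite. *)
have aux (v : \bar R) : (forall K : R, (K%:E <= u y)%E -> (K%:E <= v)%E) -> (u y <= v)%E.
  move=> Hv; rewrite leNgt; apply/negP; case: v Hv => [r||] Hv vlt.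
  - have [x xr] := supp_gt gS vlt.
    by have := Hv _ (supp_ge gS x y); rewrite lee_fin leNgt xr.
  - by move: vlt; rewrite ltNge leey.
  - by have := Hv _ (supp_lb gS y); rewrite leNgt ltNyr.
exact: aux below.
Qed.

End Conclusion.

Theorem theorem4p4 (R : realType) (S : set 'rV[R]_3) (a b : R)
    (surfS : smooth_surface S) (slS : spacelike S) (entS : entire S)
    (convS : future_convex S)
    (a_gt0 : 0 < a) (b_gt0 : 0 < b)
    (curvS : forall p, S p -> a <= gauss_curv S p <= b) :
  let u := support_fun S in
  ess_dom S = convex_hull [set xi | circle xi /\ (u xi < +oo)%E]
  /\
  (forall xi1 xi2 : 'rV[R]_2, circle xi1 -> circle xi2 -> xi1 <> xi2 ->
     segment xi1 xi2 `<=` boundary (Omega S) ->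
     [/\ (forall y, segment xi1 xi2 y ->
            u y = convex_envelope [set xi1; xi2] u y),
         (u xi1 = +oo%E \/ u xi2 = +oo%E ->
            forall t : R, 0 < t < 1 ->
              u ((1 - t) *: xi1 + t *: xi2) = +oo%E)
       & ((u xi1 < +oo)%E -> (u xi2 < +oo)%E ->
            forall t : R, 0 <= t <= 1 ->
              u ((1 - t) *: xi1 + t *: xi2)
              = ((1 - t)%:E * u xi1 + t%:E * u xi2)%E)]).
Proof.
have [f [G [gS fG dG fconv /all_and2[G1 aG]]]] :=
  entire_surface_graph surfS slS entS convS curvS.
move=> u; split; first exact: (ess_dom_hull gS fG dG fconv a_gt0 G1 aG).
move=> xi1 xi2 h1 h2 h12 seg.
have CB := boundary_chord_below gS fG dG fconv a_gt0 G1 aG h1 h2 h12 seg.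
split.
- exact: (chord_envelope gS CB h12).
- move=> [u1|u2] t /andP[t0 t1].
    by apply: (chord_below_infinite gS CB u1); rewrite ltW.
  have t01 : 0 <= 1 - t < 1 by apply/andP; split; lra.
  have := chord_below_infinite gS (chord_below_sym CB) u2 t01.
  have -> : 1 - (1 - t) = t by ring.
  by rewrite addrC.
- exact: (chord_affine gS CB).
Qed.
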